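(* Consider the regression model $Y=f_0(X)+\eta$ with quadratic loss $\ell(u,y)=(u-y)^2$. Let $\alpha=r+\beta\ge1$ ($r\in\mathbb{N}_0$, $\beta\in(0,1]$), $\gamma=\lceil\log_2(d+r)\rceil$, and suppose Assumption 2.1 holds. Suppose $W\ge c(K/\log^\gamma K)^{(2d+\alpha)/(2d+2)}$ for a (suitable) constant $c>0$ and $L\ge4\gamma+2$. If $K\asymp n^{(d+1)/(2d+5\alpha)}$ and $WL\asymp n^{(2d+\alpha)/(4d+10\alpha)}$, then for any adversarial estimator $\widehat f_n^{ls}$ satisfying $\|\widehat f_n^{ls}\|_\infty\le M$ for a sufficiently large constant $M>0$, $$\widetilde{\mathcal{E}}(\widehat f_n^{ls},\varepsilon)\lesssim n^{-2\alpha/(2d+5\alpha)}(\log n)^{\lambda}+n^{(d+1)/(2d+5\alpha)}\varepsilon,\qquad \lambda=\max\{1,2\gamma\alpha/(d+1)\},$$ with $\lesssim$ hiding a constant not depending on $n$ and $\varepsilon$.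
   Context: Model: $Y=f_0(X)+\eta$, with $Y\in\mathcal{Y}\subseteq[-1,1]$, $X\in\mathcal{X}\subseteq[0,1]^d$, unknown $f_0\in\mathcal{H}^\alpha$, and error $\eta$ with $\mathbb{E}(\eta\mid X)=0$, $\mathbb{E}\eta^2<\infty$; $(X,Y)\sim P$; i.i.d. sample of size $n$ with empirical measure $P_n$. $B_\varepsilon(\boldsymbol{x})=\{\boldsymbol{x}'\in\mathcal{X}:\|\boldsymbol{x}'-\boldsymbol{x}\|_\infty\le\varepsilon\}$. Assumption 2.1: $\mathcal{X}\times\mathcal{Y}\subseteq[0,1]^d\times[-1,1]$ and $\bigcup_{\boldsymbol{x}\in\mathcal{X}}B_\varepsilon(\boldsymbol{x})\subseteq[0,1]^d$. Adversarial risk $\widetilde{\mathcal{R}}_Q(f,\varepsilon)=\mathbb{E}_Q[\sup_{X'\in B_\varepsilon(X)}(f(X')-Y)^2]$. $\mathcal{H}^\alpha$: restrictions to $[0,1]^d$ of $f:\mathbb{R}^d\to\mathbb{R}$ with all partial derivatives of order $\le r$ bounded by 1 in sup norm and all order-$r$ derivatives satisfying $|\partial^{\boldsymbol{s}}f(\boldsymbol{x}_1)-\partial^{\boldsymbol{s}}f(\boldsymbol{x}_2)|\le\|\boldsymbol{x}_1-\boldsymbol{x}_2\|_\infty^\beta$. $\mathcal{NN}(W,L,K)$: ReLU networks $g=g_L\circ\cdots\circ g_0$, $g_i(\boldsymbol{x})=\max\{A_i\boldsymbol{x}+\boldsymbol{b}_i,0\}$ ($i<L$), $g_L(\boldsymbol{x})=A_L\boldsymbol{x}$,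 with width $W$ (max hidden dimension), depth $L$, and $\|A_L\|\prod_{i=0}^{L-1}\max\{\|(A_i,\boldsymbol{b}_i)\|,1\}\le K$, where $\|A\|=\sup_{\|\boldsymbol{x}\|_\infty\le1}\|A\boldsymbol{x}\|_\infty$. Adversarial estimator: $\widehat f_n^{ls}\in\arg\min_{f\in\mathcal{NN}(W,L,K)}\widetilde{\mathcal{R}}_{P_n}(f,\varepsilon)$. Adversarial excess risk: $\widetilde{\mathcal{E}}(f,\varepsilon)=\widetilde{\mathcal{R}}_P(f,\varepsilon)-\inf_{g\in\mathcal{H}^\alpha\cup\mathcal{NN}(W,L,K)}\widetilde{\mathcal{R}}_P(g,\varepsilon)$. *)

(* Defs.v *)
From HB Require Import structures.
From mathcomp Require Import all_boot all_order all_algebra.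
From mathcomp Require Import all_classical all_reals all_analysis measurable_realfun.
Set Implicit Arguments. Unset Strict Implicit. Unset Printing Implicit Defensive.
Import Order.TTheory GRing.Theory Num.Theory.
Import numFieldNormedType.Exports.
Local Open Scope classical_set_scope.
Local Open Scope ring_scope.

Section Defs.
Variable R : realType.

Definition supn (m : nat) (x : 'cV[R]_m) : R := \big[Num.max/0]_(i < m) `|x i ord0|.

Definition cube (d : nat) : set 'cV[R]_d := [set x | forall i, 0 <= x i ord0 <= 1].

Definition advball (d : nat) (Xset : set 'cV[R]_d) (x : 'cV[R]_d) (eps : R)
  : set 'cV[R]_d := [set x' | Xset x' /\ supn (x' - x) <= eps].

Definition opnorm (m p : nat) (A : 'M[R]_(m, p)) : R :=
  sup [set supn (A *m x) | x in [set x : 'cV[R]_p | supn x <= 1]].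

Definition unitv (d : nat) (i : 'I_d) : 'cV[R]_d := delta_mx i ord0.

Fixpoint pder (d : nat) (s : seq 'I_d) (f : 'cV[R]_d -> R) : 'cV[R]_d -> R :=
  match s with
  | [::] => f
  | i :: s' => fun x => 'D_(unitv i) (pder s' f) x
  end.

Definition Hoelder_ext (d r : nat) (beta : R) (f : 'cV[R]_d -> R) : Prop :=
  [/\ (forall (s : seq 'I_d) (i : 'I_d) (x : 'cV[R]_d),
         (size s < r)%N -> derivable (pder s f) x (unitv i)),
      (forall (s : seq 'I_d) (x : 'cV[R]_d), (size s <= r)%N -> `|pder s f x| <= 1) &
      (forall (s : seq 'I_d) (x1 x2 : 'cV[R]_d), size s = r ->
         `|pder s f x1 - pder s f x2| <= supn (x1 - x2) `^ beta)].

Definition Hoelder (d r : nat) (beta : R) (g : 'cV[R]_d -> R) : Prop :=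
  exists f, Hoelder_ext r beta f /\ forall x, cube x -> g x = f x.

Definition relu (m : nat) (v : 'cV[R]_m) : 'cV[R]_m := map_mx (fun t => Num.max t 0) v.

(* A network of depth L = L'.+1 whose hidden layers all have W units
   (zero-padding makes this the same function class as
   "max hidden dimension <= W").
   g_0 x = relu (A0 x + b0), g_k h = relu (Am (k-1) h + bm (k-1)) for 1 <= k <= L',
   g_L h = AL h. *)
Record net (d W L' : nat) := Net {
  A0 : 'M[R]_(W, d); b0 : 'cV[R]_W;
  Am : nat -> 'M[R]_W; bm : nat -> 'cV[R]_W;
  AL : 'M[R]_(1, W) }.

Fixpoint net_hidden d W L' (N : net d W L') (x : 'cV[R]_d) (k : nat) : 'cV[R]_W :=
  match k with
  | 0 => relu (A0 N *m x + b0 N)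
  | k'.+1 => relu (Am N k' *m net_hidden N x k' + bm N k')
  end.

Definition net_eval d W L' (N : net d W L') (x : 'cV[R]_d) : R :=
  (AL N *m net_hidden N x L') ord0 ord0.

Definition net_normprod d W L' (N : net d W L') : R :=
  opnorm (AL N) * (Num.max (opnorm (row_mx (A0 N) (b0 N))) 1 *
     \prod_(k < L') Num.max (opnorm (row_mx (Am N k) (bm N k))) 1).

Definition NN (d W L : nat) (K : R) (f : 'cV[R]_d -> R) : Prop :=
  match L with
  | 0 => exists A : 'M[R]_(1, d), opnorm A <= K /\ forall x, f x = (A *m x) ord0 ord0
  | L'.+1 => exists N : net d W L', net_normprod N <= K /\ forall x, f x = net_eval N x
  end.

Local Open Scope ereal_scope.

Definition advloss (D : Type) (d : nat) (Xset : set 'cV[R]_d)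
  (X : D -> 'cV[R]_d) (Y : D -> R) (f : 'cV[R]_d -> R) (eps : R) (z : D) : \bar R :=
  ereal_sup [set ((f x' - Y z) ^+ 2)%:E | x' in advball Xset (X z) eps].

Definition advrisk (dD : measure_display) (D : measurableType dD)
  (P : probability D R) (d : nat) (Xset : set 'cV[R]_d)
  (X : D -> 'cV[R]_d) (Y : D -> R) (f : 'cV[R]_d -> R) (eps : R) : \bar R :=
  \int[P]_z advloss Xset X Y f eps z.

Definition emp_advrisk (D : Type) (n d : nat) (Xset : set 'cV[R]_d)
  (X : D -> 'cV[R]_d) (Y : D -> R) (zs : 'I_n -> D) (f : 'cV[R]_d -> R) (eps : R)
  : \bar R :=
  (n%:R^-1)%:E * \sum_(i < n) advloss Xset X Y f eps (zs i).

Definition adv_excess (dD : measure_display) (D : measurableType dD)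
  (P : probability D R) (d r : nat) (beta : R) (W L : nat) (K : R)
  (Xset : set 'cV[R]_d) (X : D -> 'cV[R]_d) (Y : D -> R)
  (f : 'cV[R]_d -> R) (eps : R) : \bar R :=
  advrisk P Xset X Y f eps -
  ereal_inf [set advrisk P Xset X Y g eps | g in Hoelder r beta `|` NN W L K].

Definition borelV (d : nat) : set (set 'cV[R]_d) := <<s [set A | open A] >>.

End Defs.

(* Main.v *)
(** A network of norm at most [K] is [K]-Lipschitz for the sup norm and all the functions involved
    are bounded, so its adversarial squared loss lies between its plain squared loss and that
    loss plus [O(K eps)]. Since [f0] minimises the plain risk, a lower bound
    of the adversarial one, the excess is at most the plain excess risk up to [O(K eps)], for the
    population as for the sample. The plain excess splits into a uniform deviation over the
    class and the squared sup-norm distance [tau] from [f0] to the class.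

    Deviation: rescaling the layers makes all row norms of the hidden layers at most 1; rounding
    the normalised parameters to a grid of mesh [1/q] moves the network by at most
    [K (d + 1 + L (W + 1)) / q] and leaves [exp (O (L W^2 ln q))] networks, to which a union bound
    on exponential moments applies. With [q] of order [n^3] the deviation is at most of order
    [W L ln n / sqrt n], that is [n^(-2 alpha / (2 d + 5 alpha)) ln n].

    Approximation: [f0] is approximated on a grid of mesh [1/N] by one-variable Taylor expansions,
    iterated over the coordinates and glued by hat functions. Each resulting monomial is a product
    of at most [d + r] ridge functions with values in [0, 1], and is computed by a binary tree of
    [gamma] approximate multiplications [xy = ((x + y)^2 - x^2 - y^2) / 2], in which the square is
    interpolated at the multiples of [1/k]. *)

Require Import Defs.
From HB Require Import structures.
From mathcomp Require Import all_boot all_order all_algebra.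
From mathcomp Require Import all_classical all_reals all_analysis measurable_realfun.
From mathcomp Require Import ring lra zify.
Set Implicit Arguments.
Unset Strict Implicit.
Unset Printing Implicit Defensive.
Import Order.TTheory GRing.Theory Num.Theory.
Import numFieldNormedType.Exports.
Local Open Scope classical_set_scope.
Local Open Scope ring_scope.

(** * Sup norm and operator norm *)

Section SupNorm.
Variable R : realType.
Implicit Types (m p : nat).

(** The exponents come from one balance. With [N] cells per axis the approximant has of order [N^d]
    terms, hats of slope [N], and squares with [2k] kinks, where [k] is of order [N^(alpha/2)] so
    that the error [k^-2] of a product matches the Taylor error [N^-alpha]. Hence its norm is of
    order [N^(d+1)] and its width of order [N^(d + alpha/2)], the power [(2d + alpha)/(2d + 2)] of
    the norm. The errors of the products must not be multiplied by the number of terms: an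
    approximate product is exactly 0 where a factor is, so only the boundedly many terms active at a
    point contribute. Measurability shapes the statistical half. The adversarial loss is a supremum
    over an uncountable ball and the estimator an arbitrary minimiser, so both are compared with
    measurable bounds: the plain loss shifted by [O(K eps)], and an integrable function [G]
    dominating the deviations of a finite family. Small [n] are absorbed in the constant by the
    trivial bound [(M + 1)^2]. *)

Lemma supn_ge0 m (x : 'cV[R]_m) : 0 <= supn x.
Proof. exact: bigmax_ge_id. Qed.

Lemma ler_supn m (x : 'cV[R]_m) i : `|x i ord0| <= supn x.
Proof. exact: (le_bigmax _ (fun i => `|x i ord0|)). Qed.

Lemma supn_le m (x : 'cV[R]_m) B : 0 <= B -> (forall i, `|x i ord0| <= B) -> supn x <= B.
Proof. by move=> B0 xB; apply: bigmax_le. Qed.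

Lemma supn0 m : supn (0 : 'cV[R]_m) = 0.
Proof.
by apply/le_anti; rewrite supn_ge0 andbT; apply: supn_le => // i; rewrite mxE normr0.
Qed.

Lemma supn_triangle m (x y : 'cV[R]_m) : supn (x + y) <= supn x + supn y.
Proof.
apply: supn_le => [|i]; first by rewrite addr_ge0 ?supn_ge0.
by rewrite mxE (le_trans (ler_normD _ _))// lerD ?ler_supn.
Qed.

Lemma supn_le_norm m (x : 'cV[R]_m) : supn x <= `|x|.
Proof.
apply: supn_le => // i; rewrite /Num.norm /= mx_normrE.
exact: (le_bigmax _ (fun ij => `|x ij.1 ij.2|) (i, ord0)).
Qed.

(** Stands for [opnorm A <= B], to which it is equivalent for [0 <= B] ([rowbd_opnorm],
    [opnorm_le]), but is entrywise, so that scaling and rounding act on it directly. *)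
Definition rowbd m p (A : 'M[R]_(m, p)) (B : R) := forall i, \sum_j `|A i j| <= B.

Lemma ler_mulmx_row m p (A : 'M[R]_(m, p)) (x : 'cV[R]_p) i b :
  supn x <= b -> `|(A *m x) i ord0| <= (\sum_j `|A i j|) * b.
Proof.
move=> xb; rewrite mxE (le_trans (ler_norm_sum _ _ _))// mulr_suml ler_sum// => j _.
by rewrite normrM ler_wpM2l// (le_trans (ler_supn _ _)).
Qed.

Lemma supn_mulmx m p (A : 'M[R]_(m, p)) (x : 'cV[R]_p) B b :
  0 <= B -> rowbd A B -> supn x <= b -> supn (A *m x) <= B * b.
Proof.
move=> B0 AB xb; have b0 : 0 <= b by rewrite (le_trans _ xb)// supn_ge0.
apply: supn_le => [|i]; first by rewrite mulr_ge0.
by rewrite (le_trans (ler_mulmx_row _ _ xb))// ler_wpM2r.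
Qed.

Lemma opnorm_has_sup m p (A : 'M[R]_(m, p)) :
  has_sup [set supn (A *m x) | x in [set x : 'cV[R]_p | supn x <= 1]].
Proof.
split; first by exists (supn (A *m 0)), 0 => //=; rewrite supn0.
exists (\sum_i \sum_j `|A i j|) => _ [x /= x1 <-].
apply: supn_le => [|i]; first by do 2![apply: sumr_ge0 => ? _].
rewrite (le_trans (ler_mulmx_row _ _ x1))// mulr1 (bigD1 i)//= lerDl.
by do 2![apply: sumr_ge0 => ? _].
Qed.

(** The sum of row [i] is attained at the vector of signs of that row. *)
Lemma rowbd_opnorm m p (A : 'M[R]_(m, p)) : rowbd A (opnorm A).
Proof.
move=> i; pose x : 'cV[R]_p := \col_j Num.sg (A i j).
have x1 : supn x <= 1.
  by apply: supn_le => // j; rewrite mxE normr_sg; case: eqP => //= _; rewrite lexx.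
apply: le_trans (sup_upper_bound (opnorm_has_sup A) _); last by exists x.
apply: le_trans (ler_supn _ i); rewrite mxE (le_trans _ (ler_norm _))//.
by apply: ler_sum => j _; rewrite [in leRHS]mxE mulrC -normrEsg.
Qed.

Lemma opnorm_le m p (A : 'M[R]_(m, p)) B : 0 <= B -> rowbd A B -> opnorm A <= B.
Proof.
move=> B0 AB; apply: sup_le_ub; first by case: (opnorm_has_sup A).
by move=> _ [x /= x1 <-]; rewrite -[B]mulr1 supn_mulmx.
Qed.

Lemma rowbdW m p (A : 'M[R]_(m, p)) B B' : B <= B' -> rowbd A B -> rowbd A B'.
Proof. by move=> BB AB i; apply: le_trans BB. Qed.

Lemma opnorm_ge0 m p (A : 'M[R]_(m, p)) : 0 <= opnorm A.
Proof.
apply: le_trans (sup_upper_bound (opnorm_has_sup A) _); last by exists 0 => //=; rewrite supn0.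
exact: supn_ge0.
Qed.

Lemma row_mx_sum m p (A : 'M[R]_(m, p)) (b : 'cV[R]_m) i :
  \sum_j `|row_mx A b i j| = \sum_j `|A i j| + `|b i ord0|.
Proof.
rewrite big_split_ord /= big_ord1; congr (_ + _); last by rewrite row_mxEr.
by apply: eq_bigr => j _; rewrite row_mxEl.
Qed.

Lemma relu_lip m (x y : 'cV[R]_m) : supn (relu x - relu y) <= supn (x - y).
Proof.
apply: supn_le => [|i]; first exact: supn_ge0.
apply: le_trans (ler_supn (x - y) i); rewrite !mxE.
move: (x i ord0) (y i ord0) => s t.
have e u : Num.max u 0 = if 0 <= u then u else 0 :> R by rewrite maxC /Num.max; case: ltgtP.
rewrite !e; case: (lerP 0 s); case: (lerP 0 t) => //= ht hs; rewrite ?subrr ?normr0//.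
  by rewrite subr0 !ger0_norm; lra.
by rewrite sub0r normrN (ger0_norm ht) ler0_norm; lra.
Qed.

Lemma supn_relu m (x : 'cV[R]_m) : supn (relu x) <= supn x.
Proof.
have := relu_lip x 0; rewrite (_ : relu 0 = 0) ?subr0//.
by apply/matrixP => i j; rewrite !mxE maxxx.
Qed.

End SupNorm.

(** * Normalised networks *)

Section Normalise.
Variable R : realType.
Implicit Types (d W L : nat).

Definition normalised d W L (N : net R d W L) :=
  rowbd (row_mx (A0 N) (b0 N)) 1 /\
  forall k, (k < L)%N -> rowbd (row_mx (Am N k) (bm N k)) 1.

Lemma relu_scale m (c : R) (v : 'cV[R]_m) : 0 <= c -> relu (c *: v) = c *: relu v.
Proof. by move=> c0; apply/matrixP => i j; rewrite !mxE maxr_pMr// mulr0. Qed.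

Lemma rowbd_scale m p (A : 'M[R]_(m, p)) c B :
  0 <= c -> rowbd A B -> rowbd (c *: A) (c * B).
Proof.
move=> c0 AB i; rewrite (le_trans _ (ler_wpM2l c0 (AB i)))// mulr_sumr ler_sum// => j _.
by rewrite mxE normrM ger0_norm.
Qed.

Lemma rowbd_row_scale m p (A : 'M[R]_(m, p)) (b : 'cV[R]_m) B c e :
  0 <= e -> e <= c -> rowbd (row_mx A b) B -> rowbd (row_mx (c *: A) (e *: b)) (c * B).
Proof.
move=> e0 ec AB i; have c0 : 0 <= c by apply: le_trans ec.
apply: le_trans (rowbd_scale c0 AB i).
rewrite scale_row_mx !row_mx_sum lerD2l !mxE !normrM ler_wpM2r// !ger0_norm//.
Qed.

Definition layer_norm d W L (N : net R d W L) (k : nat) : R :=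
  if k is k'.+1 then Num.max (opnorm (row_mx (Am N k') (bm N k'))) 1
  else Num.max (opnorm (row_mx (A0 N) (b0 N))) 1.

Definition cum_norm d W L (N : net R d W L) (k : nat) : R :=
  \prod_(j < k.+1) layer_norm N j.

(* By positive homogeneity of [relu], each layer may be divided by its norm, provided the biases
   are divided by the cumulated norm of the layers up to theirs. *)
Definition normalise d W L (N : net R d W L) : net R d W L :=
  Net L ((layer_norm N 0)^-1 *: A0 N) ((layer_norm N 0)^-1 *: b0 N)
    (fun k => (layer_norm N k.+1)^-1 *: Am N k)
    (fun k => (cum_norm N k.+1)^-1 *: bm N k)
    (cum_norm N L *: AL N).

Lemma layer_norm_ge1 d W L (N : net R d W L) k : 1 <= layer_norm N k.
Proof. by case: k => [|k]; rewrite le_max lexx orbT. Qed.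

Lemma layer_norm_gt0 d W L (N : net R d W L) k : 0 < layer_norm N k.
Proof. exact: lt_le_trans (layer_norm_ge1 N k). Qed.

Lemma cum_normS d W L (N : net R d W L) k :
  cum_norm N k.+1 = cum_norm N k * layer_norm N k.+1.
Proof. by rewrite /cum_norm big_ord_recr. Qed.

Lemma cum_norm_ge1 d W L (N : net R d W L) k : 1 <= cum_norm N k.
Proof.
apply: (big_ind (fun c => 1 <= c)) => // [c c' *|j _]; last exact: layer_norm_ge1.
exact: mulr_ege1.
Qed.

Lemma normalise_hidden d W L (N : net R d W L) x k :
  net_hidden (normalise N) x k = (cum_norm N k)^-1 *: net_hidden N x k.
Proof.
have c0 j : 0 <= (cum_norm N j)^-1 by rewrite invr_ge0 (le_trans ler01)// cum_norm_ge1.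
elim: k => [|k IH] /=.
  rewrite -relu_scale//; congr relu.
  by rewrite /cum_norm big_ord1 /= scalerDr scalemxAl.
rewrite IH -relu_scale//; congr relu; rewrite scalerDr; congr (_ + _).
by rewrite cum_normS invfM -scalemxAl -scalemxAr scalerA [in LHS]mulrC.
Qed.

(** A hidden bias is divided by the cumulated norm, which is at least the norm of its own layer, so
    it shrinks at least as much as the weights. *)
Lemma normaliseP d W L (N : net R d W L) : normalised (normalise N).
Proof.
have H k (p : nat) (A : 'M[R]_(W, p)) (b : 'cV[R]_W) e :
    layer_norm N k = Num.max (opnorm (row_mx A b)) 1 -> layer_norm N k <= e ->
    rowbd (row_mx ((layer_norm N k)^-1 *: A) (e^-1 *: b)) 1.
  move=> ek ke; have k0 := layer_norm_gt0 N k.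
  have e0 : 0 < e by apply: lt_le_trans ke.
  rewrite -(mulVf (lt0r_neq0 k0)); apply: rowbd_row_scale.
  - by rewrite invr_ge0 ltW.
  - by rewrite lef_pV2.
  - by apply: rowbdW (rowbd_opnorm _); rewrite ek le_max lexx.
split=> [|k _] /=; first exact: (H 0).
apply: (H k.+1) => //; rewrite cum_normS ler_peMl//; first exact/ltW/layer_norm_gt0.
exact: cum_norm_ge1.
Qed.

(** The whole norm moves to the output layer. The hidden layers become 1-Lipschitz and map the unit
    ball to itself, so that rounding errors add up over the layers instead of multiplying. *)
Lemma NN_normalised d W L (K : R) f : NN W L.+1 K f ->
  exists N : net R d W L, [/\ normalised N, rowbd (AL N) K & forall x, f x = net_eval N x].
Proof.
move=> [N [NK fN]]; exists (normalise N); split; first exact: normaliseP.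
  have -> : K = cum_norm N L * (K / cum_norm N L).
    by rewrite mulrC divfK// gt_eqF// (lt_le_trans _ (cum_norm_ge1 N L)).
  have c0 : 0 < cum_norm N L by rewrite (lt_le_trans _ (cum_norm_ge1 N L)).
  apply: rowbd_scale; first exact: ltW.
  apply: rowbdW (rowbd_opnorm _); rewrite ler_pdivlMr//.
  by apply: le_trans NK; rewrite /net_normprod /cum_norm big_ord_recl /=.
move=> x; rewrite fN /net_eval normalise_hidden /=.
rewrite -scalemxAl -scalemxAr scalerA divff ?scale1r//.
by rewrite gt_eqF// (lt_le_trans _ (cum_norm_ge1 N L)).
Qed.

Lemma rowbd_rowl m p (A : 'M[R]_(m, p)) (b : 'cV[R]_m) B : rowbd (row_mx A b) B -> rowbd A B.
Proof.
by move=> AB i; have := AB i; rewrite row_mx_sum; apply: le_trans; rewrite lerDl.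
Qed.

Lemma hidden_lip d W L (N : net R d W L) x y k : normalised N -> (k <= L)%N ->
  supn (net_hidden N x k - net_hidden N y k) <= supn (x - y).
Proof.
move=> [N0 Nk]; elim: k => [|k IH] kL /=; apply: le_trans (relu_lip _ _) _.
  rewrite opprD addrACA subrr addr0 -mulmxBr -[leRHS]mul1r supn_mulmx//.
  exact: rowbd_rowl N0.
rewrite opprD addrACA subrr addr0 -mulmxBr -[leRHS]mul1r supn_mulmx//.
  exact: rowbd_rowl (Nk _ kL).
exact: IH (ltnW kL).
Qed.

Lemma supn_affine m p (A : 'M[R]_(m, p)) b (x : 'cV[R]_p) :
  rowbd (row_mx A b) 1 -> supn x <= 1 -> supn (A *m x + b) <= 1.
Proof.
move=> AB x1; apply: supn_le => // i; have := AB i; rewrite row_mx_sum.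
apply: le_trans; rewrite mxE (le_trans (ler_normD _ _))// lerD2r.
by rewrite (le_trans (ler_mulmx_row _ _ x1))// mulr1.
Qed.

Lemma hidden_le1 d W L (N : net R d W L) x k : normalised N -> (k <= L)%N ->
  supn x <= 1 -> supn (net_hidden N x k) <= 1.
Proof.
move=> [N0 Nk] + x1; elim: k => [|k IH] kL /=; apply: le_trans (supn_relu _) _.
  exact: supn_affine.
by apply: supn_affine; [exact: Nk|exact/IH/ltnW].
Qed.

Lemma NN_lip d W L (K : R) (f : 'cV[R]_d -> R) x y : 0 <= K -> NN W L.+1 K f ->
  `|f x - f y| <= K * supn (x - y).
Proof.
move=> K0 /NN_normalised[N [Nn NK fN]]; rewrite !fN /net_eval.
have -> : (AL N *m net_hidden N x L) ord0 ord0 - (AL N *m net_hidden N y L) ord0 ord0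
   = (AL N *m (net_hidden N x L - net_hidden N y L)) ord0 ord0.
  by rewrite mulmxBr !mxE.
by rewrite (le_trans (ler_supn _ _))// supn_mulmx// hidden_lip.
Qed.

End Normalise.

(** * Covering by quantised networks *)

Section Covering.
Variable R : realType.
Implicit Types (d W L q : nat).

Definition lvl q (c : 'I_q.*2.+1) : R := ((c : nat)%:R - q%:R) / q%:R.

(* Rounds towards 0, so that the row norms do not increase. *)
Definition rnd q (a : R) : 'I_q.*2.+1 :=
  inord (if 0 <= a then (q + Num.truncn (q%:R * a)%R)%N else (q - Num.truncn (q%:R * - a)%R)%N).

Lemma rndP q a : (0 < q)%N -> `|a| <= 1 ->
  `|lvl (rnd q a)| <= `|a| /\ `|a - lvl (rnd q a)| <= q%:R^-1.
Proof.
move=> q0 a1; have q0' : 0 < q%:R :> R by rewrite ltr0n.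
have H (b : R) : 0 <= b -> b <= 1 -> let t := Num.truncn (q%:R * b) in
   [/\ (t <= q)%N, t%:R / q%:R <= b & b - t%:R / q%:R <= q%:R^-1].
  move=> b0 b1 t; have qb0 : 0 <= q%:R * b by rewrite mulr_ge0.
  have /andP[t1 t2] := truncn_itv qb0; split.
  - by rewrite -(ler_nat R) (le_trans t1)// ler_piMr// ltW.
  - by rewrite ler_pdivrMr// mulrC.
  - by rewrite lerBlDr -[X in X + _]mul1r -mulrDl ler_pdivlMr// mulrC addrC natr1 ltW.
rewrite /lvl /rnd; case: (lerP 0 a) => a0.
  rewrite ger0_norm// in a1; have [tq t1 t2] := H _ a0 a1.
  rewrite inordK; last by rewrite ltnS -addnn leq_add2l.
  rewrite natrD addrC addKr; split; first by rewrite !ger0_norm// divr_ge0.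
  by rewrite ger0_norm// subr_ge0.
rewrite ltr0_norm// in a1 *.
have a0' : 0 <= - a by rewrite oppr_ge0 ltW.
have [tq t1 t2] := H _ a0' a1.
rewrite inordK; last by rewrite ltnS -addnn (leq_trans (leq_subr _ _))// leq_addr.
rewrite natrB// addrAC subrr add0r mulNr normrN opprK; split.
  by rewrite ger0_norm// divr_ge0.
by rewrite ler0_norm ?opprD//; lra.
Qed.

Definition code d W L q : finType :=
  ('M['I_q.*2.+1]_(W, d) * 'cV['I_q.*2.+1]_W *
   {ffun 'I_L -> 'M['I_q.*2.+1]_W * 'cV['I_q.*2.+1]_W} * 'rV['I_q.*2.+1]_W)%type.

Lemma card_code d W L q :
  #|code d W L q| = (q.*2.+1 ^ (W * d + W + (W * W + W) * L + W))%N.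
Proof.
by rewrite !card_prod card_ffun !card_prod !card_mx !card_ord !muln1 mul1n -!expnD -expnM -!expnD.
Qed.

Lemma card_code_le d W L q :
  (#|code d W L q| <= q.*2.+1 ^ (d.+2 * L.+1 * W ^ 2))%N.
Proof.
rewrite card_code leq_pexp2l//.
have WW : (W <= W ^ 2)%N by case: (W) => // w; rewrite -mulnn leq_pmulr.
rewrite !mulnn; nia.
Qed.

(** The output weights are coded after division by [K], so that every coded entry lies in [[-1, 1]].
    The value 0 beyond the [L] coded layers only makes [Am] and [bm] total; [net_eval] does not read
    it. *)
Definition decode d W L q (K : R) (c : code d W L q) : net R d W L :=
  let: (a0, b0, am, al) := c in
  Net L (map_mx (@lvl q) a0) (map_mx (@lvl q) b0)
    (fun k => if insub k is Some i then map_mx (@lvl q) (am i).1 else 0)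
    (fun k => if insub k is Some i then map_mx (@lvl q) (am i).2 else 0)
    (K *: map_mx (@lvl q) al).

Definition encode d W L q (K : R) (N : net R d W L) : code d W L q :=
  (map_mx (rnd q) (A0 N), map_mx (rnd q) (b0 N),
   [ffun i : 'I_L => (map_mx (rnd q) (Am N i), map_mx (rnd q) (bm N i))],
   map_mx (fun a => rnd q (a / K)) (AL N)).

Definition mxnear m p q (A A' : 'M[R]_(m, p)) :=
  forall i j, `|A' i j| <= `|A i j| /\ `|A i j - A' i j| <= q%:R^-1.

Lemma mxnear_rnd m p q (A : 'M[R]_(m, p)) : (0 < q)%N -> rowbd A 1 ->
  mxnear q A (map_mx (@lvl q) (map_mx (rnd q) A)).
Proof.
move=> q0 A1 i j; rewrite !mxE; apply: rndP => //.
apply: le_trans (A1 i); rewrite (bigD1 j)//= lerDl; exact: sumr_ge0.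
Qed.

Lemma rowbd_near m p q (A A' : 'M[R]_(m, p)) B : mxnear q A A' -> rowbd A B -> rowbd A' B.
Proof.
by move=> AA' AB i; apply: le_trans (AB i); apply: ler_sum => j _; case: (AA' i j).
Qed.

(** The split [A (x - y) + (A - A') y] asks for a row bound of [A] only and for a bound on the
    second input only. *)
Lemma mulmx_near m p (A A' : 'M[R]_(m, p)) x y B b : 0 <= B -> 0 <= b -> rowbd A B ->
  (forall i j, `|A i j - A' i j| <= b) -> supn y <= 1 ->
  supn (A *m x - A' *m y) <= B * supn (x - y) + p%:R * b.
Proof.
move=> B0 b0 AB Ab y1.
have -> : A *m x - A' *m y = A *m (x - y) + (A - A') *m y.
  by rewrite mulmxBr mulmxBl addrA subrK.
apply: le_trans (supn_triangle _ _) _; apply: lerD; first exact: supn_mulmx.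
rewrite -[leRHS]mulr1; apply: supn_mulmx => //; first by rewrite mulr_ge0.
move=> i; rewrite (@le_trans _ _ (\sum_(j < p) b))//; last first.
  by rewrite sumr_const card_ord mulr_natl.
by apply: ler_sum => j _; rewrite !mxE.
Qed.

Lemma decode_Am d W L q K (N : net R d W L) k (kL : (k < L)%N) :
  Am (decode K (encode q K N)) k = map_mx (@lvl q) (map_mx (rnd q) (Am N k)).
Proof. by rewrite /= insubT /= ffunE. Qed.

Lemma decode_bm d W L q K (N : net R d W L) k (kL : (k < L)%N) :
  bm (decode K (encode q K N)) k = map_mx (@lvl q) (map_mx (rnd q) (bm N k)).
Proof. by rewrite /= insubT /= ffunE. Qed.

Lemma rowbd_rowr m p (A : 'M[R]_(m, p)) (b : 'cV[R]_m) B :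
  rowbd (row_mx A b) B -> rowbd b B.
Proof.
move=> AB i; have := AB i; rewrite row_mx_sum big_ord1; apply: le_trans.
by rewrite lerDr sumr_ge0.
Qed.

Lemma near_affine m p q (A : 'M[R]_(m, p)) (b : 'cV[R]_m) x y :
  (0 < q)%N -> rowbd (row_mx A b) 1 -> supn y <= 1 ->
  supn (relu (A *m x + b) -
        relu (map_mx (@lvl q) (map_mx (rnd q) A) *m y + map_mx (@lvl q) (map_mx (rnd q) b)))
    <= supn (x - y) + p.+1%:R / q%:R.
Proof.
move=> q0 AB y1; apply: le_trans (relu_lip _ _) _.
rewrite opprD addrACA -natr1 mulrDl [leRHS]addrA mul1r.
apply: le_trans (supn_triangle _ _) _; apply: lerD.
  rewrite -[supn (x - y)]mul1r; apply: mulmx_near => //.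
  - exact: rowbd_rowl AB.
  - by move=> i j; case: (mxnear_rnd q0 (rowbd_rowl AB) i j).
apply: supn_le => // i; rewrite mxE.
by have [_ h] := mxnear_rnd q0 (rowbd_rowr AB) i ord0; apply: le_trans h; rewrite [X in _ + X]mxE.
Qed.

Lemma normalised_decode d W L q K (N : net R d W L) : (0 < q)%N ->
  normalised N -> normalised (decode K (encode q K N)).
Proof.
move=> q0 [N0 Nk]; have H m p (A : 'M[R]_(m, p)) (b : 'cV[R]_m) :
    rowbd (row_mx A b) 1 ->
    rowbd (row_mx (map_mx (@lvl q) (map_mx (rnd q) A)) (map_mx (@lvl q) (map_mx (rnd q) b))) 1.
  by rewrite -!map_row_mx => AB; apply: rowbd_near (mxnear_rnd q0 AB) AB.
split; first exact: H.
by move=> k kL; rewrite decode_Am// decode_bm//; exact/H/Nk.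
Qed.

(** Each hidden layer adds [(W + 1)/q] and transmits the earlier error with factor 1. The decoded
    network is normalised too, so the activations that meet the rounding errors stay in the unit
    ball. *)
Lemma decode_hidden d W L q K (N : net R d W L) x k : (0 < q)%N -> normalised N ->
  supn x <= 1 -> (k <= L)%N ->
  supn (net_hidden N x k - net_hidden (decode K (encode q K N)) x k)
  <= (d.+1 + k * W.+1)%:R / q%:R.
Proof.
move=> q0 Nn x1; elim: k => [|k IH] kL.
  rewrite mul0n addn0; have [N0 _] := Nn.
  by have := near_affine x q0 N0 x1; rewrite subrr supn0 add0r.
have [_ Nk] := Nn.
have y1 := hidden_le1 (normalised_decode K q0 Nn) (ltnW kL) x1.
have := near_affine (net_hidden N x k) q0 (Nk _ kL) y1.
rewrite -(decode_Am q K N kL) -(decode_bm q K N kL).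
move/le_trans; apply; rewrite mulSn addnCA natrD mulrDl addrC lerD2l.
exact/IH/ltnW.
Qed.

Lemma rowbd_entry m p (A : 'M[R]_(m, p)) B i j : rowbd A B -> `|A i j| <= B.
Proof. by move/(_ i); apply: le_trans; rewrite (bigD1 j)//= lerDl sumr_ge0. Qed.

Lemma rowbd_decode d W L q (K : R) (N : net R d W L) : (0 < q)%N -> 0 < K ->
  rowbd (AL N) K -> mxnear q (K^-1 *: AL N) (K^-1 *: AL (decode K (encode q K N))).
Proof.
move=> q0 K0 NK /= i j; rewrite scalerA mulVf ?gt_eqF// scale1r !mxE [K^-1 * AL N i j]mulrC.
apply: rndP => //; rewrite normrM [ `|K^-1| ]ger0_norm ?invr_ge0 ?(ltW K0)//.
by rewrite ler_pdivrMr// mul1r rowbd_entry.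
Qed.

Lemma decode_eval d W L q (K : R) (N : net R d W L) x : (0 < q)%N -> 0 < K ->
  normalised N -> rowbd (AL N) K -> supn x <= 1 ->
  `|net_eval N x - net_eval (decode K (encode q K N)) x|
  <= K * (d.+1 + L.+1 * W.+1)%:R / q%:R.
Proof.
move=> q0 K0 Nn NK x1; rewrite /net_eval.
set N' := decode _ _.
have y1 : supn (net_hidden N' x L) <= 1 by apply: hidden_le1 => //; exact: normalised_decode.
have near := rowbd_decode q0 K0 NK.
(* Divided by [K], the output layer is treated like a normalised one. *)
have B : rowbd (K^-1 *: AL N) 1.
  by rewrite -(mulVf (lt0r_neq0 K0)); apply: rowbd_scale => //; rewrite invr_ge0 ltW.
have qi0 : 0 <= q%:R^-1 :> R by rewrite invr_ge0.
have := @mulmx_near _ _ _ _ (net_hidden N x L) _ _ _ ler01 qi0 B (fun i j => (near i j).2) y1.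
rewrite -!scalemxAl -scalerBr => H.
have := le_trans (ler_supn _ ord0) H.
set u := AL N *m _; set v := K *: (_ *m _).
have -> : (K^-1 *: (u - v)) ord0 ord0 = K^-1 * (u ord0 ord0 - v ord0 ord0) by rewrite !mxE.
rewrite normrM ger0_norm ?invr_ge0 ?(ltW K0)// mulrC ler_pdivrMr// => /le_trans; apply.
rewrite mulrC -mulrA ler_wpM2l ?(ltW K0)//.
rewrite mul1r mulSn addnCA natrD mulrDl addrC lerD//; last exact: decode_hidden.
by rewrite ler_wpM2r// ler_nat.
Qed.

End Covering.

(** * Networks with units in a finite type *)

Section Builder.
Variable R : realType.
Variables (I : finType) (d W : nat).
Hypothesis cardI : (#|I| <= W)%N.

(* The units of the network are indexed by [I]; the remaining [W - #|I|] units are idle. *)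
Definition emb (a : I) : 'I_W := widen_ord cardI (enum_rank a).

Definition pemb (j : 'I_W) : option I := [pick a | emb a == j].

Lemma embK : pcancel emb pemb.
Proof.
move=> a; rewrite /pemb; case: pickP => [b /eqP /(congr1 val) /= /val_inj /enum_rank_inj ->//|].
by move/(_ a); rewrite eqxx.
Qed.

Lemma sum_pemb (F : I -> R) : \sum_(j < W) oapp F 0 (pemb j) = \sum_a F a.
Proof.
rewrite (bigID (fun j => isSome (pemb j)))/= [X in _ + X]big1 ?addr0; last first.
  by move=> j; case: (pemb j).
rewrite (reindex_omap emb pemb) => [|j]; last first.
  by rewrite /pemb; case: pickP => // a /eqP <-.
by apply: eq_big => [a|a _]; rewrite embK//= ?eqxx.
Qed.

Variables (w : I -> 'I_d -> R) (b : I -> R) (A : nat -> I -> I -> R) (B : nat -> I -> R)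
  (o : I -> R).

Fixpoint unit_val (k : nat) (x : 'cV[R]_d) (a : I) : R :=
  if k is k'.+1 then Num.max (\sum_a' A k' a a' * unit_val k' x a' + B k' a) 0
  else Num.max (\sum_j w a j * x j ord0 + b a) 0.

Definition built (L : nat) : net R d W L :=
  Net L (\matrix_(i, j) oapp (w^~ j) 0 (pemb i)) (\col_i oapp b 0 (pemb i))
    (fun k => \matrix_(i, j) oapp (fun a => oapp (A k a) 0 (pemb j)) 0 (pemb i))
    (fun k => \col_i oapp (B k) 0 (pemb i))
    (\row_j oapp o 0 (pemb j)).

Lemma built_hidden L k x i :
  net_hidden (built L) x k i ord0 = oapp (unit_val k x) 0 (pemb i).
Proof.
elim: k i => [|k IH] i; rewrite /= !mxE; case pi: (pemb i) => [a|] /=.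
- by congr (Num.max (_ + _) _); apply: eq_bigr => j _; rewrite mxE pi.
- by rewrite big1 ?add0r ?maxxx// => j _; rewrite mxE pi /= mul0r.
- congr (Num.max (_ + _) _); rewrite -sum_pemb; apply: eq_bigr => j _.
  by rewrite mxE pi /= IH; case: (pemb j) => //=; rewrite mul0r.
- by rewrite big1 ?add0r ?maxxx// => j _; rewrite mxE pi /= mul0r.
Qed.

Lemma NN_built (L : nat) (lam : nat -> R) (lout K : R) :
  (forall k, 1 <= lam k) -> 0 <= lout ->
  (forall a, \sum_j `|w a j| + `|b a| <= lam 0) ->
  (forall k a, (k < L)%N -> \sum_a' `|A k a a'| + `|B k a| <= lam k.+1) ->
  \sum_a `|o a| <= lout ->
  lout * \prod_(k < L.+1) lam k <= K ->
  NN W L.+1 K (fun x => \sum_a o a * unit_val L x a).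
Proof.
move=> lam1 lout0 wb AB oout KK; exists (built L); split.
  apply: le_trans KK; rewrite /net_normprod big_ord_recl.
  have pos k : 0 <= lam k by apply: le_trans (lam1 k).
  apply: ler_pM.
  - exact: opnorm_ge0.
  - by rewrite mulr_ge0 ?prodr_ge0// => *; rewrite le_max ler01 orbT.
  - apply: opnorm_le => // i; rewrite (le_trans _ oout)// -sum_pemb ler_sum// => j _.
    by rewrite mxE; case: (pemb j); rewrite //= normr0.
  apply: ler_pM; rewrite ?prodr_ge0 ?le_max ?ler01 ?orbT//.
  - by move=> *; rewrite le_max ler01 orbT.
  - rewrite ge_max lam1 andbT opnorm_le// => i; rewrite row_mx_sum mxE.
    case pi: (pemb i) => [a|] /=; last first.
      by rewrite normr0 addr0 big1 ?pos// => j _; rewrite mxE pi normr0.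
    by apply: le_trans (wb a); rewrite lerD2r ler_sum// => j _; rewrite mxE pi.
  apply: ler_prod => k _; rewrite le_max ler01 orbT /= ge_max lam1 andbT.
  rewrite opnorm_le// => i; rewrite row_mx_sum mxE.
  case pi: (pemb i) => [a|] /=; last first.
    by rewrite normr0 addr0 big1 ?pos// => j _; rewrite mxE pi normr0.
  apply: le_trans (AB k a _); rewrite // lerD2r -sum_pemb ler_sum// => j _.
  by rewrite mxE pi /=; case: (pemb j); rewrite //= normr0.
move=> x; rewrite /net_eval mxE -sum_pemb; apply: eq_bigr => j _.
by rewrite built_hidden mxE; case: (pemb j); rewrite //= mul0r.
Qed.

End Builder.

(** * Approximate multiplication *)

Section Square.
Variables (R : realType) (k : nat).
Hypothesis k0 : (0 < k)%N.

Definition pos (t : R) : R := Num.max t 0.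

(* [sq] interpolates the square at the multiples of [1/k] in [0, 2]; its slope increases by
   [sqc i] at [i/k]. *)
Definition sqc (i : nat) : R := (if i == 0%N then 1 else 2) / k%:R.

Definition sq (t : R) : R := \sum_(i < k.*2) sqc i * pos (t - i%:R / k%:R).

Lemma posE t : pos t = if 0 <= t then t else 0.
Proof. by rewrite /pos maxC /Num.max; case: ltgtP. Qed.

Lemma sqc_ge0 i : 0 <= sqc i.
Proof. by rewrite /sqc divr_ge0//; case: ifP. Qed.

Lemma sqc2_ge0 i : 0 <= sqc i / 2.
Proof. by rewrite divr_ge0// sqc_ge0. Qed.

Lemma sq0 t : t <= 0 -> sq t = 0.
Proof.
move=> t0; apply: big1 => i _; rewrite /pos max_r ?mulr0//.
by rewrite subr_le0 (le_trans t0)// divr_ge0.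
Qed.

Lemma sum_sqc : \sum_(i < k.*2) sqc i <= 4.
Proof.
have kp : 0 < k%:R :> R by rewrite ltr0n.
rewrite (@le_trans _ _ (\sum_(i < k.*2) 2 / k%:R))//.
  by apply: ler_sum => i _; rewrite /sqc ler_pM2r ?invr_gt0//; case: ifP; rewrite ?ler1n.
rewrite sumr_const card_ord -[X in X <= _]mulr_natr -muln2 natrM.
suff -> : 2 / k%:R * (k%:R * 2) = 4 :> R by [].
by field; rewrite gt_eqF.
Qed.

(** On the cell from [j/k] to [(j+1)/k] exactly the first [j + 1] kinks are active, so this is the
    chord of the square over that cell. *)
Lemma sq_partial j t : \sum_(i < j.+1) sqc i * (t - i%:R / k%:R) =
  j.*2.+1%:R / k%:R * t - (j * j.+1)%:R / k%:R ^+ 2.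
Proof.
have kp : k%:R != 0 :> R by rewrite pnatr_eq0 -lt0n.
elim: j => [|j IH]; first by rewrite big_ord1 /sqc eqxx double0 mul0n mulr0n !mul0r !subr0.
have e : sqc j.+1 = 2 / k%:R by [].
rewrite big_ord_recr [LHS]/= IH e doubleS !natrM -!natr1 -muln2 natrM.
by field.
Qed.

Lemma sq_cell j t : (j < k.*2)%N -> j%:R / k%:R <= t <= j.+1%:R / k%:R ->
  sq t = j.*2.+1%:R / k%:R * t - (j * j.+1)%:R / k%:R ^+ 2.
Proof.
move=> jk /andP[jt tj]; rewrite -sq_partial /sq.
have kp : 0 < k%:R :> R by rewrite ltr0n.
rewrite [RHS](big_ord_widen _ (fun i => sqc i * (t - i%:R / k%:R)) jk) [RHS]big_mkcond /=.
apply: eq_bigr => i _; case: ltnP => ij.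
  rewrite /pos max_l// subr_ge0 (le_trans _ jt)// ler_pM2r ?invr_gt0// ler_nat.
  by rewrite -ltnS.
rewrite /pos max_r ?mulr0// subr_le0 (le_trans tj)// ler_pM2r ?invr_gt0// ler_nat//.
Qed.

Lemma sqB j t : (j < k.*2)%N -> j%:R / k%:R <= t <= j.+1%:R / k%:R ->
  sq t - t ^+ 2 = (t - j%:R / k%:R) * (j.+1%:R / k%:R - t).
Proof.
move=> jk jt; rewrite (sq_cell jk jt).
have kp : k%:R != 0 :> R by rewrite pnatr_eq0 -lt0n.
rewrite -!natr1 !natrM -!natr1 -muln2 natrM; field.
exact: kp.
Qed.

Lemma sq_err t : 0 <= t <= 2 -> 0 <= sq t - t ^+ 2 <= k%:R ^- 2.
Proof.
have kp : 0 < k%:R :> R by rewrite ltr0n.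
move=> /andP[t0 t2].
have [j jk jt] : exists2 j, (j < k.*2)%N & j%:R / k%:R <= t <= j.+1%:R / k%:R.
  have kt0 : 0 <= k%:R * t by rewrite mulr_ge0.
  have /andP[h1 h2] := truncn_itv kt0.
  have [tk|tk] := ltnP (Num.truncn (k%:R * t)) k.*2.
    exists (Num.truncn (k%:R * t)) => //.
    by rewrite ler_pdivrMr// ler_pdivlMr// ![t * _]mulrC h1 /= ltW.
  (* Here [t = 2], which belongs to the last cell, of index [2k - 1], as its right end. *)
  have k2 : k%:R * t = k.*2%:R.
    apply/le_anti/andP; split; first by rewrite -muln2 natrM ler_pM2l.
    by rewrite (le_trans _ h1)// ler_nat.
  exists k.*2.-1; first by rewrite prednK// double_gt0.
  rewrite prednK ?double_gt0// ler_pdivrMr// ler_pdivlMr// ![t * _]mulrC k2 lexx andbT.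
  by rewrite ler_nat leq_pred.
rewrite (sqB jk jt); case/andP: jt => j1 j2.
rewrite mulr_ge0 ?subr_ge0//= expr2 invfM; apply: ler_pM; rewrite ?subr_ge0//.
  by rewrite lerBlDr -[X in X + _]mul1r -mulrDl addrC natr1.
by rewrite lerBlDr -natr1 mulrDl mul1r addrC lerD2l.
Qed.

Lemma sq_node j : (j <= k.*2)%N -> sq (j%:R / k%:R) = (j%:R / k%:R) ^+ 2.
Proof.
move=> jk; have kp : 0 < k%:R :> R by rewrite ltr0n.
case: j jk => [|j] jk; first by rewrite mul0r sq0// expr0n.
apply/eqP; rewrite -subr_eq0 (@sqB j)//; first by rewrite subrr mulr0.
by rewrite lexx andbT ler_pM2r ?invr_gt0// ler_nat.
Qed.

Definition amul (x y : R) : R := 2^-1 * (sq (x + y) - sq x - sq y).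

(** Written kink by kink: each summand is nonnegative for nonnegative arguments and largest at
    [x = y = 1] on the unit square, which a case analysis on signs can check. *)
Lemma amulE x y : amul x y = \sum_(i < k.*2) (sqc i / 2 *
  (pos (x + y - i%:R / k%:R) - pos (x - i%:R / k%:R) - pos (y - i%:R / k%:R))).
Proof.
rewrite /amul /sq -!sumrB mulr_sumr; apply: eq_bigr => i _.
by rewrite -!mulrBr mulrA [_ / 2]mulrC.
Qed.

(** Exact, unlike [amul_err]: a vanishing factor annihilates the whole tree ([tree_prod0]), which
    confines the errors to the active terms. *)
Lemma amul0x y : amul 0 y = 0.
Proof. by rewrite /amul add0r (sq0 (lexx _)) subr0 subrr mulr0. Qed.

Lemma amulx0 x : amul x 0 = 0.
Proof. by rewrite /amul addr0 subrr (sq0 (lexx _)) subr0 mulr0. Qed.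

Lemma amul_ge0 x y : 0 <= x -> 0 <= y -> 0 <= amul x y.
Proof.
move=> x0 y0; rewrite amulE sumr_ge0// => i _; rewrite mulr_ge0 ?sqc2_ge0//.
have : 0 <= i%:R / k%:R :> R by rewrite divr_ge0.
move: (i%:R / k%:R) => a a0; rewrite !posE.
by case: (lerP 0 (x + y - a)); case: (lerP 0 (x - a)); case: (lerP 0 (y - a)); lra.
Qed.

Lemma amul11 : amul 1 1 = 1.
Proof.
have kp : k%:R != 0 :> R by rewrite pnatr_eq0 -lt0n.
have e1 : sq 1 = 1.
  have kk : (k <= k.*2)%N by rewrite -addnn leq_addr.
  by have := sq_node kk; rewrite mulfV// expr1n.
have e2 : sq (1 + 1) = 4.
  have := sq_node (leqnn k.*2); rewrite -muln2 natrM mulrAC mulfV// mul1r => ->.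
  by rewrite -natrX.
by rewrite /amul e1 e2; field.
Qed.

(** The maximum is at [x = y = 1], where the value is exactly 1 because 1 and 2 are nodes of [sq].
    Hence the tree never leaves the square on which [amul_err] holds, without any clipping. *)
Lemma amul_le1 x y : 0 <= x <= 1 -> 0 <= y <= 1 -> amul x y <= 1.
Proof.
move=> /andP[x0 x1] /andP[y0 y1]; rewrite -amul11 !amulE; apply: ler_sum => i _.
rewrite ler_wpM2l ?sqc2_ge0//.
have : 0 <= i%:R / k%:R :> R by rewrite divr_ge0.
move: (i%:R / k%:R) => a a0; rewrite !posE.
case: (lerP 0 (x + y - a)); case: (lerP 0 (x - a)); case: (lerP 0 (y - a));
case: (lerP 0 (1 - a)); case: (lerP 0 (1 + 1 - a)); lra.
Qed.

Lemma amul_err x y : 0 <= x <= 1 -> 0 <= y <= 1 -> `|amul x y - x * y| <= k%:R ^- 2.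
Proof.
move=> x01 y01; move: (x01) (y01) => /andP[x0 x1] /andP[y0 y1].
have xy : 0 <= x + y <= 2 by lra.
have /andP[x0' x2'] : 0 <= x <= 2 by lra.
have hx : 0 <= x <= 2 by lra.
have hy : 0 <= y <= 2 by lra.
have := sq_err xy; have := sq_err hx; have := sq_err hy.
have := sq_err xy.
rewrite /amul; move: (sq x) (sq y) (sq (x + y)) (k%:R ^- 2 : R) => a b c e.
move=> /andP[? ?] /andP[? ?] /andP[? ?] /andP[? ?].
by rewrite ler_norml; apply/andP; split; nra.
Qed.

Variables (F : nat -> R).

(** Node [j] of level [l] has the children [2j] and [2j + 1] and multiplies the leaves from [2^l j]
    to [2^l j + 2^l - 1]. *)
Fixpoint tree (l j : nat) : R :=
  if l is l'.+1 then amul (tree l' j.*2) (tree l' j.*2.+1) else F j.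

Lemma tree_itv : (forall j, 0 <= F j <= 1) -> forall l j, 0 <= tree l j <= 1.
Proof.
move=> F01; elim=> [//|l IH] j /=.
by case/andP: (IH j.*2) (IH j.*2.+1) => ? ? /andP[? ?]; rewrite amul_ge0// amul_le1//; lra.
Qed.

Lemma tree_prod0 l j : \prod_(i < 2 ^ l) F (2 ^ l * j + i) = 0 -> tree l j = 0.
Proof.
elim: l j => [|l IH] j /=; first by rewrite expn0 big_ord1 mul1n addn0.
rewrite expnS mul2n -addnn big_split_ord /= => /eqP; rewrite mulf_eq0 => /orP[]/eqP e.
  by rewrite IH ?amul0x// -e; apply: eq_bigr => i _; congr F; lia.
by rewrite [tree l j.*2.+1]IH ?amulx0// -e; apply: eq_bigr => i _; congr F; lia.
Qed.

Lemma tree_err : (forall j, 0 <= F j <= 1) -> forall l j,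
  `|tree l j - \prod_(i < 2 ^ l) F (2 ^ l * j + i)| <= (2 ^ l)%:R * k%:R ^- 2.
Proof.
move=> F01 l j.
have e0 : 0 <= k%:R ^- 2 :> R by rewrite invr_ge0 exprn_ge0.
(* [2^l - 1] is the number of multiplications in the subtree. Factors in [[0, 1]] do not amplify
   errors, so each multiplication counts once. *)
suff : `|tree l j - \prod_(i < 2 ^ l) F (2 ^ l * j + i)| <= ((2 ^ l)%:R - 1) * k%:R ^- 2.
  by move=> /le_trans; apply; rewrite ler_wpM2r// gerBl.
elim: l j => [|l IH] j /=.
  by rewrite expn0 big_ord1 mul1n addn0 !subrr normr0 mul0r.
have P01 (G : nat -> nat) n : 0 <= \prod_(i < n) F (G i) <= 1.
  apply: (big_ind (fun x => 0 <= x <= 1)) => //; first by rewrite ler01 lexx.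
  by move=> x y /andP[? ?] /andP[? ?]; rewrite mulr_ge0//= mulr_ile1.
have -> : (2 ^ l.+1 = 2 ^ l + 2 ^ l)%N by rewrite expnS mul2n addnn.
rewrite big_split_ord /=.
have := IH j.*2; have := IH j.*2.+1.
have -> : \prod_(i < 2 ^ l) F (2 ^ l * j.*2 + i)
  = \prod_(i < 2 ^ l) F ((2 ^ l + 2 ^ l) * j + i).
  by apply: eq_bigr => i _; congr F; lia.
have -> : \prod_(i < 2 ^ l) F (2 ^ l * j.*2.+1 + i)
  = \prod_(i < 2 ^ l) F ((2 ^ l + 2 ^ l) * j + (2 ^ l + i)).
  by apply: eq_bigr => i _; congr F; lia.
have /andP[p1 p1'] := P01 (fun i => (2 ^ l + 2 ^ l) * j + i)%N (2 ^ l)%N.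
have := amul_err (tree_itv F01 l j.*2) (tree_itv F01 l j.*2.+1).
move: (\prod_i F _) (\prod_i F _) p1 p1' => P Q P0 P1.
have /andP[] := tree_itv F01 l j.*2; have /andP[] := tree_itv F01 l j.*2.+1.
move: (tree _ _) (tree _ _) => a b a0 a1 b0 b1 e1 e2 e3 .
have -> : amul a b - Q * P = (amul a b - a * b) + ((a - Q) * b + Q * (b - P)) by ring.
have -> : ((2 ^ l + 2 ^ l)%:R - 1) * k%:R ^- 2 =
  k%:R ^- 2 + (((2 ^ l)%:R - 1) * k%:R ^- 2 + ((2 ^ l)%:R - 1) * k%:R ^- 2) :> R.
  by rewrite natrD; ring.
rewrite (le_trans (ler_normD _ _))// lerD// (le_trans (ler_normD _ _))// !normrM.
rewrite [ `|b|]ger0_norm// [ `|Q|]ger0_norm//; apply: lerD.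
  by apply: le_trans e3; rewrite ler_piMr.
by apply: le_trans e2; rewrite ler_piMl.
Qed.

End Square.

(** * Product networks *)

Lemma sum_pair (R : nmodType) (I J : finType) (F : I * J -> R) :
  \sum_p F p = \sum_i \sum_j F (i, j).
Proof. by rewrite pair_bigA; apply: eq_bigr => -[]. Qed.

Section ProductNet.
Variables (R : realType) (d k g : nat).
Hypothesis k0 : (0 < k)%N.

(* [f q = ((u, w), b)] describes a summand [u * max (w x + b) 0] of a factor, a network with one
   hidden layer of 3 units. *)
Definition fac := 'I_3 -> R * ('I_d -> R) * R.

Definition fval (f : fac) (x : 'cV[R]_d) : R :=
  \sum_q (f q).1.1 * Num.max (\sum_j (f q).1.2 j * x j ord0 + (f q).2) 0.

(** 6 is the bound for the output weights of an inner node, three sums of at most 2 ([sum_pnout]),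
    so that factors and inner nodes are treated alike. A hat uses 4 of it. *)
Definition fac_ok (lam : R) (f : fac) :=
  \sum_q `|(f q).1.1| <= 6 /\ forall q, \sum_j `|(f q).1.2 j| + `|(f q).2| <= lam.

Definition fac1 : fac := fun q => ((q == ord0)%:R, fun=> 0, 1).

Lemma fval1 x : fval fac1 x = 1.
Proof.
rewrite /fval !big_ord_recl big_ord0 /= !mul0r !addr0 mul1r big1 ?add0r ?max_l// => j _.
by rewrite mul0r.
Qed.

Lemma fac1_ok lam : 1 <= lam -> fac_ok lam fac1.
Proof.
move=> lam1; split=> [|q] /=.
  rewrite (bigD1 ord0)//= big1 ?addr0 ?normr1 ?ler1n// => i /negbTE e.
  by rewrite e normr0.
by rewrite big1 ?add0r ?normr1// => j _; rewrite normr0.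
Qed.

(** Missing factors default to the constant 1, whereas leaves from [2^g] on are 0: nodes outside the
    index range then have value 0 ([tree_out]), and [sum_child] may ignore them. *)
Definition leaf (fs : seq fac) (x : 'cV[R]_d) (j : nat) : R :=
  if (j < 2 ^ g)%N then fval (nth fac1 fs j) x else 0.

Definition tprod (fs : seq fac) (x : 'cV[R]_d) : R := tree k (leaf fs x) g 0.

Lemma tree_out fs x l j : (2 ^ g <= j)%N -> tree k (leaf fs x) l j = 0.
Proof.
elim: l j => [|l IH] j gj /=; first by rewrite /leaf ltnNge gj.
by rewrite !IH ?amul0x//; lia.
Qed.

Variable ts : seq (R * seq fac).
(* The unit [((t, j), (q, i))] of layer 0 is the [q]-th unit of factor [j] of term [t] (a copy for
   each [i], only [i = 0] being read); in layer [l > 0] it is the kink at [i/k] of [sq], applied in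
   node [j] of the tree for term [t] to the sum of both children ([q = 0]), to the left child
   ([q = 1]) or to the right one ([q = 2]). *)
Definition pnidx : finType := (('I_(size ts) * 'I_(2 ^ g)) * ('I_3 * 'I_k.*2))%type.
Definition pnfac (t : nat) := (nth (0, [::]) ts t).2.
Definition pncoef (t : nat) := (nth (0, [::]) ts t).1.

Definition pnout (l : nat) (p : 'I_(size ts) * 'I_(2 ^ g)) (u : 'I_3 * 'I_k.*2) : R :=
  if l is 0 then (if u.2 == 0%N :> nat then (nth fac1 (pnfac p.1) p.2 u.1).1.1 else 0)
  else (if u.1 == ord0 then 1 else -1) * (sqc R k u.2 / 2).

Definition child (q : 'I_3) (j j' : nat) : R :=
  ((q != 2%N :> nat) && (j' == j.*2))%:R + ((q != 1%N :> nat) && (j' == j.*2.+1))%:R.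

Definition pnw (a : pnidx) : 'I_d -> R := (nth fac1 (pnfac a.1.1) a.1.2 a.2.1).1.2.
Definition pnb (a : pnidx) : R := (nth fac1 (pnfac a.1.1) a.1.2 a.2.1).2.
Definition pnA (l : nat) (a a' : pnidx) : R :=
  if (l < g)%N then (a'.1.1 == a.1.1)%:R * child a.2.1 a.1.2 a'.1.2 * pnout l a'.1 a'.2
  else (a' == a)%:R.
Definition pnB (l : nat) (a : pnidx) : R := if (l < g)%N then - ((a.2.2 : nat)%:R / k%:R) else 0.
Definition pno (a : pnidx) : R := (a.1.2 == 0%N :> nat)%:R * pncoef a.1.1 * pnout g a.1 a.2.

Lemma sum_child q j (h : nat -> R) : (forall i, (2 ^ g <= i)%N -> h i = 0) ->
  \sum_(j' < 2 ^ g) child q j j' * h j' =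
  (q != 2%N :> nat)%:R * h j.*2 + (q != 1%N :> nat)%:R * h j.*2.+1.
Proof.
move=> h0; have H (s : bool) c : \sum_(j' < 2 ^ g) (s && (j' == c :> nat))%:R * h j' = s%:R * h c.
  case: s => /=; last by rewrite mul0r big1// => i _; rewrite mul0r.
  have [cg|gc] := ltnP c (2 ^ g).
    rewrite (bigD1 (Ordinal cg))//= eqxx big1 ?addr0// => i ic.
    by rewrite -val_eqE /= in ic; rewrite (negbTE ic) mul0r.
  rewrite h0// mulr0 big1// => i _; case: eqP => [ic|]; last by rewrite mul0r.
  by have := ltn_ord i; rewrite ic ltnNge gc.
by under eq_bigr do rewrite mulrDl; rewrite big_split /= !H.
Qed.

Lemma unit_val_child l x t j q i : (l < g)%N ->
  (forall p, \sum_u pnout l p u * unit_val pnw pnb pnA pnB l x (p, u)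
    = tree k (leaf (pnfac p.1) x) l p.2) ->
  unit_val pnw pnb pnA pnB l.+1 x ((t, j), (q, i)) =
    pos ((q != 2%N :> nat)%:R * tree k (leaf (pnfac t) x) l j.*2 +
     (q != 1%N :> nat)%:R * tree k (leaf (pnfac t) x) l j.*2.+1 - i%:R / k%:R).
Proof.
move=> lg IH; rewrite /= /pos /pnB lg; congr (Num.max (_ + _) 0).
rewrite -(sum_child q j (tree_out (pnfac t) x l)) sum_pair sum_pair /=.
rewrite (bigD1 t)//= [X in _ + X]big1 ?addr0 => [|t' /negbTE e]; last first.
  by rewrite big1// => j' _; rewrite big1// => u _; rewrite /pnA lg /= e !mul0r.
apply: eq_bigr => j' _; rewrite -(IH (t, j')) mulr_sumr; apply: eq_bigr => u _.
by rewrite /pnA lg eqxx mul1r mulrA.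
Qed.

(** No unit holds the value of a node: it is the [pnout]-combination of the units of that node, and
    this combination is absorbed into the weights of the next layer. One multiplication therefore
    costs one layer. *)
Lemma sum_unit l p x : (l <= g)%N ->
  \sum_u pnout l p u * unit_val pnw pnb pnA pnB l x (p, u) = tree k (leaf (pnfac p.1) x) l p.2.
Proof.
elim: l p => [|l IH] [t j] lg.
  rewrite sum_pair /= /leaf ltn_ord /fval /=.
  apply: eq_bigr => q _; have k2 : (0 < k.*2)%N by rewrite double_gt0.
  rewrite (bigD1 (Ordinal k2))//= [X in _ + X]big1 ?addr0// => i.
  by rewrite -val_eqE /= => /negbTE ->; rewrite mul0r.
rewrite sum_pair.
under eq_bigr do (under eq_bigr do rewrite (unit_val_child _ _ _ _ lg (fun p => IH p (ltnW lg)))).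
rewrite !big_ord_recl big_ord0 addr0 /= amulE -!big_split /=.
by apply: eq_bigr => i _; rewrite /pnout /= !mul1r !mul0r addr0 add0r; ring.
Qed.

(** After level [g] the layers are identities, harmless under [relu] since units are nonnegative;
    this adjusts the depth. *)
Lemma unit_val_pad l x a : (g <= l)%N ->
  unit_val pnw pnb pnA pnB l x a = unit_val pnw pnb pnA pnB g x a.
Proof.
move=> gl; rewrite -(subnK gl); elim: (l - g)%N => [//|m IH].
rewrite addSn /= /pnA /pnB ltnNge leq_addl /= addr0 (bigD1 a)//= eqxx mul1r big1 ?addr0.
  rewrite IH max_l//; case: (g) => [|g'] /=; first by rewrite le_max lexx orbT.
  by rewrite le_max lexx orbT.
by move=> i /negbTE ->; rewrite mul0r.
Qed.

Lemma pno_val L x : (g <= L)%N ->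
  \sum_a pno a * unit_val pnw pnb pnA pnB L x a =
  \sum_(t <- ts) t.1 * tprod t.2 x.
Proof.
move=> gL; under eq_bigr do rewrite unit_val_pad//.
rewrite sum_pair sum_pair (big_nth (0, [::])) big_mkord; apply: eq_bigr => t _.
have g0 : (0 < 2 ^ g)%N by rewrite expn_gt0.
rewrite (bigD1 (Ordinal g0))//= [X in _ + X]big1 ?addr0 => [|j]; last first.
  by rewrite -val_eqE /= => /negbTE e; rewrite big1// => u _; rewrite /pno /= e !mul0r.
rewrite /tprod -(sum_unit (t, Ordinal g0) x (leqnn g)) mulr_sumr; apply: eq_bigr => u _.
by rewrite /pno /= mul1r mulrA.
Qed.

Variable lam : R.
Hypothesis lam1 : 1 <= lam.
Hypothesis ts_ok : forall t j, fac_ok lam (nth fac1 (pnfac t) j).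

Lemma sum_pnout l p : \sum_u `|pnout l p u| <= 6.
Proof.
rewrite sum_pair; case: l => [|l] /=.
  have [a6 _] := ts_ok p.1 p.2; apply: le_trans a6; apply: ler_sum => q _.
  have k2 : (0 < k.*2)%N by rewrite double_gt0.
  rewrite (bigD1 (Ordinal k2))//= [X in _ + X]big1 ?addr0// => i.
  by rewrite -val_eqE /= => /negbTE ->; rewrite normr0.
rewrite (@le_trans _ _ (\sum_(q < 3) 2))//; last first.
  by rewrite sumr_const card_ord -mulrnA.
apply: ler_sum => q _; rewrite (@le_trans _ _ (\sum_(i < k.*2) sqc R k i / 2))//.
  apply: ler_sum => i _; rewrite normrM [X in _ * X]ger0_norm ?sqc2_ge0//.
  by rewrite ler_piMl ?sqc2_ge0//; case: ifP; rewrite ?normrN normr1.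
by rewrite -mulr_suml ler_pdivrMr// -natrM sum_sqc.
Qed.

Lemma sum_child_le q (j : nat) : \sum_(j' < 2 ^ g) child q j j' <= 2.
Proof.
have H (s : bool) c : \sum_(j' < 2 ^ g) (s && (j' == c :> nat))%:R <= 1 :> R.
  case: s => /=; last by rewrite big1.
  have [cg|gc] := ltnP c (2 ^ g).
    rewrite (bigD1 (Ordinal cg))//= eqxx big1 ?addr0// => i ic.
    by rewrite -val_eqE /= in ic; rewrite (negbTE ic).
  rewrite big1 ?ler01// => i _; case: eqP => [ic|//].
  by have := ltn_ord i; rewrite ic ltnNge gc.
by rewrite big_split /= -[2]/(1 + 1) lerD.
Qed.

Lemma NN_tprod (W L : nat) (K S : R) :
  (g <= L)%N -> (size ts * 2 ^ g * (3 * k.*2) <= W)%N ->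
  \sum_(t <- ts) `|t.1| <= S -> 6 * S * (lam * 14 ^+ g) <= K ->
  NN W L.+1 K (fun x => \sum_(t <- ts) t.1 * tprod t.2 x).
Proof.
move=> gL IW cS SK.
have IW' : (#|pnidx| <= W)%N by rewrite !card_prod !card_ord.
pose lamf l : R := if l is l'.+1 then (if (l' < g)%N then 14 else 1) else lam.
have S0 : 0 <= S by apply: le_trans cS; apply: sumr_ge0.
have := @NN_built R pnidx d W IW' pnw pnb pnA pnB pno L lamf (6 * S) K.
have -> : (fun x => \sum_a pno a * unit_val pnw pnb pnA pnB L x a)
    = (fun x => \sum_(t <- ts) t.1 * tprod t.2 x).
  by apply/funext => x; exact: pno_val.
apply.
- by case=> [//|l] /=; case: ifP; rewrite ?ler1n.
- by rewrite mulr_ge0.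
- by move=> a; have [_] := ts_ok a.1.1 a.1.2; apply.
- move=> l [[t j] [q i]] _; rewrite /pnA /pnB /=; case: ifP => lg; last first.
    rewrite normr0 addr0 (bigD1 (t, j, (q, i)))//= eqxx normr1 big1 ?addr0// => a /negbTE ->.
    by rewrite normr0.
  (* At most two children, each with output weights of sum at most 6, and a bias [i/k] of at most
     2. *)
  have -> : 14 = 2 * 6 + 2 :> R by rewrite -natrM -natrD.
  apply: lerD; last first.
    rewrite normrN ger0_norm ?divr_ge0// ler_pdivrMr ?ltr0n// -natrM ler_nat mul2n.
    exact: ltnW.
  rewrite sum_pair sum_pair /= (bigD1 t)//= [X in _ + X]big1 ?addr0 => [|t' /negbTE e]; last first.
    by rewrite big1// => j' _; rewrite big1// => u _; rewrite e !mul0r normr0.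
  rewrite (@le_trans _ _ (\sum_(j' < 2 ^ g) child q j j' * 6))//; last first.
    by rewrite -mulr_suml ler_wpM2r// sum_child_le.
  apply: ler_sum => j' _; rewrite eqxx; under eq_bigr do rewrite mul1r normrM.
  rewrite -mulr_sumr; have c0 : 0 <= child q j j' by rewrite /child addr_ge0.
  by rewrite ger0_norm// ler_wpM2l// sum_pnout.
- apply: le_trans (_ : 6 * \sum_(t <- ts) `|t.1| <= _); last by rewrite ler_wpM2l.
  rewrite sum_pair sum_pair (big_nth (0, [::])) big_mkord mulr_sumr; apply: ler_sum => t _.
  have g0 : (0 < 2 ^ g)%N by rewrite expn_gt0.
  rewrite (bigD1 (Ordinal g0))//= [X in _ + X]big1 ?addr0 => [|j]; last first.
    by rewrite -val_eqE /= => /negbTE e; rewrite big1// => u _; rewrite /pno /= e !mul0r normr0.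
  rewrite mulrC -/(pncoef t); under eq_bigr do rewrite /pno /= mul1r normrM.
  by rewrite -mulr_sumr ler_wpM2l// sum_pnout.
- apply: le_trans SK; rewrite big_ord_recl /= ler_wpM2l ?mulr_ge0//.
  rewrite ler_wpM2l ?(le_trans ler01)// -big_mkcond /=.
  by rewrite -(big_ord_widen L (fun=> 14) gL) prodr_const card_ord.
Qed.

End ProductNet.

(** * Local Taylor approximation *)

Section Taylor.
Variable R : realType.

Definition taylor (a : nat -> R) (m : nat) : {poly R} := \poly_(j < m) (a j / j`!%:R).

Lemma taylorE a m t : (taylor a m).[t] = \sum_(j < m) t ^+ j / j`!%:R * a j.
Proof. by rewrite horner_poly; apply: eq_bigr => j _; rewrite mulrC mulrA mulrAC. Qed.

Lemma deriv_taylor a m : (taylor a m.+1)^`() = taylor (a \o succn) m.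
Proof.
apply/polyP => j; rewrite coef_deriv !coef_poly ltnS; case: ifP => jm; last by rewrite mul0rn.
rewrite factS natrM /= -mulr_natr; field.
by rewrite nat1r !pnatr_eq0 -lt0n fact_gt0.
Qed.

Lemma taylor0 a m : (taylor a m.+1).[0] = a 0%N.
Proof. by rewrite horner_coef0 coef_poly /= fact0 divr1. Qed.

(** Induction on [m]: the derivative of the remainder is the remainder of order [m] of the
    derivative, and the mean value theorem supplies one more factor [t]. *)
Lemma taylor_remainder (beta : R) m (G : nat -> R -> R) : 0 <= beta ->
  (forall j (t : R), (j < m)%N -> is_derive t 1 (G j) (G j.+1 t)) ->
  (forall t, `|G m t - G m 0| <= `|t| `^ beta) ->
  forall t, 0 <= t -> `|G 0 t - (taylor (G^~ 0) m.+1).[t]| <= t ^+ m * t `^ beta.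
Proof.
move=> beta0; elim: m G => [|m IH] G dG Hb t t0.
  rewrite taylorE big_ord1 expr0 fact0 divr1 !mul1r.
  by rewrite (le_trans (Hb t))// ger0_norm.
pose h : R -> R := G 0%N - horner (taylor (G^~ 0) m.+2).
have dh (s : R) : is_derive s 1 h (G 1%N s - (taylor (G^~ 0 \o succn) m.+1).[s]).
  rewrite -deriv_taylor; apply: is_deriveB; first exact: dG.
have [|c ct e] := MVT_segment t0 (fun s _ => dh s).
  apply: derivable_within_continuous => s _; by case: (dh s).
have h0 : h 0 = 0.
  by rewrite (_ : h 0 = G 0%N 0 - (taylor (G^~ 0) m.+2).[0])// taylor0 subrr.
have -> : G 0%N t - (taylor (G^~ 0) m.+2).[t] = h t - h 0 by rewrite h0 subr0.
rewrite e subr0 normrM [ `|t|]ger0_norm// exprS -mulrA mulrC ler_wpM2l//.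
move: ct; rewrite in_itv /= => /andP[c0 ct].
have -> : G 1%N c = (G \o succn) 0%N c by [].
apply: le_trans (IH (G \o succn) _ _ c c0) _ => /=.
- by move=> j s jm; exact: dG.
- exact: Hb.
apply: ler_pM; rewrite ?exprn_ge0 ?powR_ge0//.
  by rewrite lerXn2r// nnegrE.
by rewrite ge0_ler_powR// nnegrE.
Qed.

End Taylor.

Lemma ord_subD m r (j : 'I_(r - m).+1) : (m <= r)%N -> (j + m <= r)%N.
Proof. by move=> mr; rewrite addnC -leq_subRL// -ltnS. Qed.

(** * Taylor expansion along coordinate lines *)

Section Partials.
Variables (R : realType) (d r : nat) (beta : R) (f : 'cV[R]_d -> R).
Hypothesis beta0 : 0 < beta.
Hypothesis Hf : Hoelder_ext r beta f.

Lemma unitvE (i j : 'I_d) : unitv R i j ord0 = (j == i)%:R.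
Proof. by rewrite mxE eqxx andbT. Qed.

Lemma supn_unitv (i : 'I_d) t : supn (t *: unitv R i) <= `|t|.
Proof.
by apply: supn_le => // j; rewrite mxE unitvE; case: eqP; rewrite (mulr1, mulr0)// normr0.
Qed.

Lemma line_derive (s : seq 'I_d) i y (t : R) : (size s < r)%N ->
  is_derive t 1 (fun u => pder s f (y + u *: unitv R i)) (pder (i :: s) f (y + t *: unitv R i)).
Proof.
move=> sr; have [dr _ _] := Hf; have D := dr s i (y + t *: unitv R i) sr.
have e : (fun h : R => h^-1 *: (((fun u => pder s f (y + u *: unitv R i)) \o shift t) (h *: 1) -
    pder s f (y + t *: unitv R i))) =
  (fun h : R => h^-1 *: ((pder s f \o shift (y + t *: unitv R i)) (h *: unitv R i) -
    pder s f (y + t *: unitv R i))).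
  apply/funext => h /=; congr (_ *: (pder s f _ - _)).
  by have -> : h%:A = h :> R; [exact: mulr1|rewrite scalerDl addrCA].
by split; [rewrite /derivable e|rewrite /derive e].
Qed.

(** Only one coordinate moves, and the new derivatives are applied on top of [s]. Mixed partials
    thus keep the order in which the coordinates are expanded, and their symmetry is never
    invoked. *)
Lemma line_taylor (s : seq 'I_d) i y (t : R) : (size s <= r)%N -> 0 <= t ->
  `|pder s f (y + t *: unitv R i) -
    \sum_(j < (r - size s).+1) t ^+ j / j`!%:R * pder (nseq j i ++ s) f y|
  <= t ^+ (r - size s) * t `^ beta.
Proof.
move=> sr t0; pose G j u := pder (nseq j i ++ s) f (y + u *: unitv R i).
have := @taylor_remainder R beta (r - size s) G (ltW beta0) _ _ t t0.
rewrite taylorE /G /= scale0r addr0; apply.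
- move=> j u jr; apply: (line_derive (s := nseq j i ++ s)).
  by rewrite size_cat size_nseq addnC -ltn_subRL.
- move=> u; have [_ _ H] := Hf.
  have sz : size (nseq (r - size s) i ++ s) = r by rewrite size_cat size_nseq subnK.
  apply: le_trans (H _ _ _ sz) _; rewrite addrAC subrr add0r.
  by rewrite ge0_ler_powR ?nnegrE ?supn_ge0 ?supn_unitv// ltW.
Qed.

Lemma pder_le1 s y : (size s <= r)%N -> `|pder s f y| <= 1.
Proof. by case: Hf => _ H _; exact: H. Qed.

Definition upd (y : 'cV[R]_d) i a := y + (a - y i ord0) *: unitv R i.

Lemma updE y i a j : upd y i a j ord0 = if j == i then a else y j ord0.
Proof.
rewrite !mxE -/(unitv R i j ord0) eqxx andbT; case: eqP => [->|_].
  by rewrite mulr1 addrC subrK.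
by rewrite mulr0 addr0.
Qed.

Lemma line_lip i y (t : R) : (0 < r)%N -> `|f (y + t *: unitv R i) - f y| <= `|t|.
Proof.
move=> r0; wlog t0 : y t / 0 <= t => [H|].
  have [t0|t0] := lerP 0 t; first exact: H.
  have := H (y + t *: unitv R i) (- t); rewrite -addrA -scalerDl subrr scale0r addr0.
  by rewrite normrN distrC; apply; rewrite oppr_ge0 ltW.
pose h u := f (y + u *: unitv R i).
have dh (s : R) : is_derive s 1 h (pder [:: i] f (y + s *: unitv R i)).
  exact: (line_derive (s := [::])).
have [|c _ e] := MVT_segment t0 (fun s _ => dh s).
  by apply: derivable_within_continuous => s _; case: (dh s).
move: e; rewrite /h scale0r addr0 subr0 => ->; rewrite normrM ler_piMl//.
exact: pder_le1.
Qed.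

(** For [r = 0] the assumption forces [beta = 1]. Otherwise the coordinates are changed one at a
    time, each at unit cost by the bound on first partials, whence the constant [d]. Serves to make
    the class Borel measurable. *)
Lemma Hoelder_lip : 1 <= r%:R + beta -> beta <= 1 ->
  exists2 C : R, 0 <= C & forall x y, `|f x - f y| <= C * supn (x - y).
Proof.
have [r0|r0] := posnP r.
  rewrite r0 add0r => b1 b1'; have be : beta = 1 by apply/le_anti/andP.
  exists 1 => // x y; have [_ _ H] := Hf.
  have sz : size ([::] : seq 'I_d) = r by rewrite r0.
  by have := H _ x y sz; rewrite be powRr1 ?supn_ge0// mul1r.
move=> _ _; exists d%:R => // x y.
pose mv := foldl (fun z i => upd z i (x i ord0)).
have mvE l (z : 'cV[R]_d) j : mv z l j ord0 = if j \in l then x j ord0 else z j ord0.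
  elim: l z => [//|i l IH] z; rewrite /= IH updE in_cons.
  by case: (j \in l); rewrite ?orbT ?orbF//; case: eqP => // ->.
have H l (z : 'cV[R]_d) s : (forall j, `|x j ord0 - z j ord0| <= s) ->
    `|f (mv z l) - f z| <= (size l)%:R * s.
  elim: l z => [|i l IH] z zs /=; first by rewrite subrr normr0 mul0r.
  rewrite -(subrK (f (upd z i (x i ord0))) (f (mv _ _))) -addrA.
  rewrite (le_trans (ler_normD _ _))// -[(size l).+1%:R]natr1 mulrDl mul1r lerD//.
    apply: IH => j; rewrite updE; case: eqP => // ->; rewrite subrr normr0.
    exact: le_trans (zs i).
  by rewrite (le_trans (line_lip _ _ _ _)).
have {1}-> : x = mv y (enum 'I_d).
  by apply/matrixP => i j; rewrite ord1 mvE mem_enum.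
set z := mv _ _; rewrite [X in supn (X - y)](_ : x = z); last first.
  by apply/matrixP => i j; rewrite ord1 mvE mem_enum.
have := H (enum 'I_d) y (supn (z - y)); rewrite size_enum_ord; apply => j.
by rewrite (le_trans _ (ler_supn _ j))// mxE mxE /z !mvE mem_enum.
Qed.

(** * Hat functions and interpolation on a grid *)

Variable N : nat.
Hypothesis N0 : (0 < N)%N.

Definition clip01 (v : R) := pos v - pos (v - 1).
(** The tent on [[-1, 1]] with peak 1 at 0, written as a difference of shifted ramps so that sums
    over integer translates telescope. *)
Definition hat (u : R) : R := clip01 (u + 1) - clip01 u.
Definition node (n : nat) : R := (n%:R - 1) / N%:R.

Lemma clip01_itv v : 0 <= clip01 v <= 1.
Proof.
rewrite /clip01 !posE.
by case: (lerP 0 v); case: (lerP 0 (v - 1)); lra.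
Qed.

Lemma clip01_eq1 v : 1 <= v -> clip01 v = 1.
Proof. by move=> v1; rewrite /clip01 /pos !max_l; lra. Qed.

Lemma clip01_eq0 v : v <= 0 -> clip01 v = 0.
Proof. by move=> v1; rewrite /clip01 /pos !max_r; lra. Qed.

Lemma hat_itv u : 0 <= hat u <= 1.
Proof.
rewrite /hat /clip01 addrK !posE.
by case: (lerP 0 (u + 1)); case: (lerP 0 u); case: (lerP 0 (u - 1)); lra.
Qed.

Lemma hat_supp u : hat u != 0 -> -1 < u < 1.
Proof.
have [u1|u1] := leP u (-1).
  by rewrite /hat !clip01_eq0 ?subrr ?eqxx//; lra.
have [u2|u2] := leP 1 u; last by [].
by rewrite /hat !clip01_eq1 ?subrr ?eqxx//; lra.
Qed.

Lemma telescope_shift (h : R -> R) (t : R) M :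
  \sum_(n < M) (h (t - n%:R + 1) - h (t - n%:R)) = h (t + 1) - h (t - M%:R + 1).
Proof.
elim: M => [|M IH]; first by rewrite big_ord0 subr0 subrr.
rewrite big_ord_recr IH /= -natr1 (_ : t - (M%:R + 1) + 1 = t - M%:R); last by ring.
by rewrite addrA subrK.
Qed.

Lemma sum_hat t : 0 <= t <= N%:R -> \sum_(n < N.+1) hat (t - n%:R) = 1.
Proof.
move=> /andP[t0 tN]; rewrite telescope_shift clip01_eq1; last by lra.
by rewrite clip01_eq0 ?subr0// -natr1; lra.
Qed.

(** The indicator of [-1 < u < 1] is at most the unit increment of [h], a sum of three ramps with
    values in [[0, 3]], and the increments telescope. *)
Lemma sum_hat_supp t : \sum_(n < N.+1) (hat (t - n%:R) != 0)%:R <= 3 :> R.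
Proof.
pose h v := clip01 (v + 1) + clip01 v + clip01 (v - 1).
rewrite (@le_trans _ _ (\sum_(n < N.+1) (h (t - n%:R + 1) - h (t - n%:R))))//.
  apply: ler_sum => n _; move: (t - n%:R) => u; rewrite /h addrK.
  have : clip01 (u + 1 + 1) - clip01 (u - 1) <= clip01 (u + 1 + 1) + clip01 (u + 1) + clip01 u
      - (clip01 (u + 1) + clip01 u + clip01 (u - 1)) by lra.
  apply: le_trans; case: eqP => /= [_|/eqP /hat_supp /andP[u1 u2]].
    rewrite subr_ge0 /clip01 !posE.
    case: (lerP 0 (u - 1)); case: (lerP 0 (u - 1 - 1)); case: (lerP 0 (u + 1 + 1));
    by case: (lerP 0 (u + 1 + 1 - 1)); lra.
  by rewrite clip01_eq1 ?clip01_eq0 ?subr0//; lra.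
rewrite telescope_shift /h.
move: (clip01_itv (t + 1 + 1)) (clip01_itv (t + 1)) (clip01_itv (t + 1 - 1)).
move: (t - N.+1%:R + 1) => v.
by move: (clip01_itv (v + 1)) (clip01_itv v) (clip01_itv (v - 1)); lra.
Qed.

Lemma sum_const_le m M (c : R) : (m <= M)%N -> 0 <= c -> \sum_(j < m) c <= M%:R * c.
Proof. by move=> mM c0; rewrite sumr_const card_ord -[leLHS]mulr_natl ler_wpM2r// ler_nat. Qed.

(* Expands [pder s f], frozen at [y] in the coordinates not in [l], along the coordinates in [l].
   The node of the [n]-th hat is [(n - 1) / N], one step to the left of its peak: the increments
   [x i - node n] are then nonnegative on its support, and the monomials are powers of a [pos]. *)
Fixpoint taylor_interp (l s : seq 'I_d) (y x : 'cV[R]_d) : R :=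
  if l is i :: l' then
    \sum_(n < N.+1) hat (N%:R * x i ord0 - n%:R) *
      \sum_(j < (r - size s).+1) pos (x i ord0 - node n) ^+ j / j`!%:R *
        taylor_interp l' (nseq j i ++ s) (upd y i (node n)) x
  else pder s f y.

(** Each expansion has at most [r + 1] coefficients, carrying the error of the remaining
    coordinates, and adds one remainder of its own. *)
Definition taylor_interpC (m : nat) : R := iter m (fun c => r.+1%:R * c + 1) 0.

Lemma taylor_interpC_ge0 m : 0 <= taylor_interpC m.
Proof. by elim: m => [//|m IH] /=; rewrite addr_ge0// mulr_ge0. Qed.

(** On the support of the [n]-th hat the increment lies in [[0, 2/N]]. A coefficient of order [j]
    has [j] fewer derivatives left, but its monomial supplies the missing power [(2/N)^j], so every
    coordinate contributes the same order. *)
Lemma taylor_interp_err l s (y x : 'cV[R]_d) : uniq l -> (size s <= r)%N -> cube x ->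
  (forall i, i \in l -> y i ord0 = x i ord0) ->
  `|taylor_interp l s y x - pder s f y| <=
    taylor_interpC (size l) * ((2 / N%:R) ^+ (r - size s) * (2 / N%:R) `^ beta).
Proof.
have Np : 0 < N%:R :> R by rewrite ltr0n.
have h0 : 0 <= 2 / N%:R :> R by rewrite divr_ge0.
move=> + + cx; elim: l s y => [|i l IH] s y /=.
  by move=> _ _ _; rewrite subrr normr0 mul0r.
move=> /andP[il ul] sr yx; set h := 2 / N%:R in h0 IH *.
have /andP[xi0 xi1] := cx i.
have tN : 0 <= N%:R * x i ord0 <= N%:R by rewrite mulr_ge0//= ler_piMr// ltW.
set E := (_ * _ + 1) * _.
have -> : pder s f y = \sum_(n < N.+1) hat (N%:R * x i ord0 - n%:R) * pder s f y.
  by rewrite -mulr_suml sum_hat// mul1r.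
rewrite -sumrB (le_trans (ler_norm_sum _ _ _))//.
rewrite [leRHS](_ : E = \sum_(n < N.+1) hat (N%:R * x i ord0 - n%:R) * E); last first.
  by rewrite -mulr_suml sum_hat// mul1r.
apply: ler_sum => n _.
rewrite -mulrBr normrM; have /andP[hat0 hat1] := hat_itv (N%:R * x i ord0 - n%:R).
rewrite ger0_norm//; have [->|hn] := eqVneq (hat (N%:R * x i ord0 - n%:R)) 0.
  by rewrite !mul0r.
have /andP[u1 u2] := hat_supp hn; apply: ler_wpM2l => //.
set u := x i ord0 - node n; have u0 : 0 <= u.
  rewrite subr_ge0 ler_pdivrMr// mulrC; lra.
have uh : u <= h.
  rewrite /u /node /h lerBlDr -mulrDl ler_pdivlMr// mulrC; lra.
rewrite /pos max_l//; set y' := upd y i (node n).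
have ey : y = y' + u *: unitv R i.
  by rewrite /y' /upd /u -(yx i) ?mem_head// -addrA -scalerDl addrA subrK subrr scale0r addr0.
have -> : pder s f y = pder s f (y' + u *: unitv R i) by rewrite -ey.
have := line_taylor i y' sr u0; rewrite distrC.
set S := \sum_(j < _) _ / _ * pder _ f y'; set A := \sum_(j < _) _.
set B := pder s f _ => SB.
(* [S] is [A] with exact derivatives as coefficients: [S - B] is the remainder in coordinate [i],
   [A - S] the error from the other coordinates. *)
rewrite -(subrK S A) -addrA (le_trans (ler_normD _ _))// /E mulrDl mul1r lerD//; last first.
  apply: le_trans SB _; apply: ler_pM; rewrite ?exprn_ge0 ?powR_ge0//.
    by rewrite lerXn2r// nnegrE.
  by rewrite ge0_ler_powR ?nnegrE// ltW.
rewrite /A /S -sumrB (le_trans (ler_norm_sum _ _ _))//.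
rewrite (@le_trans _ _ (\sum_(j < (r - size s).+1)
  (taylor_interpC (size l) * (h ^+ (r - size s) * h `^ beta))))//; last first.
  rewrite -[leRHS]mulrA; apply: sum_const_le; first by rewrite ltnS leq_subr.
  by rewrite mulr_ge0 ?taylor_interpC_ge0// mulr_ge0 ?powR_ge0 ?exprn_ge0.
apply: ler_sum => j _; rewrite -mulrBr normrM.
have jr : (j <= r - size s)%N by rewrite -ltnS.
have sz : size (nseq j i ++ s) = (j + size s)%N by rewrite size_cat size_nseq.
have yx' i' : i' \in l -> y' i' ord0 = x i' ord0.
  move=> i'l; rewrite updE; case: eqP => [e|_]; first by rewrite -e i'l in il.
  by rewrite yx// in_cons i'l orbT.
have jr' : (j + size s <= r)%N by exact: ord_subD.
have := IH (nseq j i ++ s) y' ul; rewrite sz => /(_ jr' yx') H.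
have -> : h ^+ (r - size s) = h ^+ j * h ^+ (r - (j + size s)).
  by rewrite -exprD addnC [(j + size s)%N]addnC subnDA subnK.
set H' := h ^+ (r - (j + size s)) in H *.
have -> : taylor_interpC (size l) * (h ^+ j * H' * h `^ beta) =
    h ^+ j * (taylor_interpC (size l) * (H' * h `^ beta)).
  by ring.
apply: ler_pM => //; rewrite ger0_norm; last by rewrite divr_ge0 ?exprn_ge0.
rewrite ler_pdivrMr ?ltr0n ?fact_gt0// (@le_trans _ _ (h ^+ j))//.
  by rewrite lerXn2r// nnegrE.
by rewrite ler_peMr ?exprn_ge0// ler1n fact_gt0.
Qed.

(** * The interpolant as a sum of products of ridge functions *)

Definition vec1 (c : R) (i : 'I_d) : 'I_d -> R := fun j => if j == i then c else 0.

Definition hatf (i : 'I_d) (n : nat) : fac R d :=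
  fun q => (if q == 1 :> nat then -2 else 1, vec1 N%:R i, 1 - n%:R - (q : nat)%:R).

(* The factor 1/2 keeps the values of the monomials in [0, 1]; [terms] compensates it by [2 ^+ j]. *)
Definition monof (i : 'I_d) (n : nat) : fac R d :=
  fun q => (if q == 0 :> nat then 2^-1 else 0, vec1 1 i, - node n).

Fixpoint terms (l s : seq 'I_d) (y : 'cV[R]_d) : seq (R * seq (fac R d)) :=
  if l is i :: l' then
    flatten [seq flatten [seq [seq (2 ^+ j / j`!%:R * t.1,
                                    hatf i n :: nseq j (monof i n) ++ t.2)
                              | t <- terms l' (nseq j i ++ s) (upd y i (node n))]
                         | j <- iota 0 (r - size s).+1]
            | n <- iota 0 N.+1]
  else [:: (pder s f y, [::])].

Lemma terms_sum (V : nmodType) (Phi : R * seq (fac R d) -> V) i l s y :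
  \sum_(t <- terms (i :: l) s y) Phi t =
  \sum_(n < N.+1) \sum_(j < (r - size s).+1)
    \sum_(t <- terms l (nseq j i ++ s) (upd y i (node n)))
      Phi (2 ^+ j / j`!%:R * t.1, hatf i n :: nseq j (monof i n) ++ t.2).
Proof.
cbn [terms]; rewrite big_flatten big_map -[iota 0 N.+1]/(index_iota 0 N.+1) big_mkord.
apply: eq_bigr => n _; rewrite big_flatten big_map.
rewrite -[iota 0 (r - size s).+1]/(index_iota 0 (r - size s).+1) big_mkord.
by apply: eq_bigr => j _; rewrite big_map.
Qed.

Lemma sum_vec1 c i (g : 'I_d -> R) : \sum_j vec1 c i j * g j = c * g i.
Proof.
rewrite (bigD1 i)//= /vec1 eqxx big1 ?addr0// => j /negbTE ->; exact: mul0r.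
Qed.

Lemma fval_hatf i n x : fval (hatf i n) x = hat (N%:R * x i ord0 - n%:R).
Proof.
rewrite /fval !big_ord_recl big_ord0 /= !sum_vec1 /hat /clip01 /pos.
set u := N%:R * x i ord0; rewrite addrK.
have -> : u + (1 - n%:R - 0) = u - n%:R + 1 by ring.
have -> : u + (1 - n%:R - 1) = u - n%:R by ring.
have -> : u + (1 - n%:R - 2) = u - n%:R - 1 by ring.
by ring.
Qed.

Lemma fval_monof i n x : fval (monof i n) x = 2^-1 * pos (x i ord0 - node n).
Proof.
by rewrite /fval !big_ord_recl big_ord0 /= !sum_vec1 mul1r !mul0r !addr0.
Qed.

Lemma prod_facs i n j (fs : seq (fac R d)) x :
  \prod_(g <- hatf i n :: nseq j (monof i n) ++ fs) fval g x =
  hat (N%:R * x i ord0 - n%:R) * ((2^-1 * pos (x i ord0 - node n)) ^+ j *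
    \prod_(g <- fs) fval g x).
Proof.
by rewrite big_cons big_cat big_nseq iter_mulr_1 /= fval_hatf fval_monof.
Qed.

Lemma terms_taylor_interp l s y x :
  \sum_(t <- terms l s y) t.1 * \prod_(g <- t.2) fval g x = taylor_interp l s y x.
Proof.
elim: l s y => [|i l IH] s y; first by rewrite big_seq1 big_nil mulr1.
rewrite terms_sum; cbn [taylor_interp].
apply: eq_bigr => n _; rewrite mulr_sumr; apply: eq_bigr => j _.
rewrite -IH !mulr_sumr; apply: eq_bigr => t _; rewrite prod_facs /= exprMn.
have : (2 : R) ^+ j * 2^-1 ^+ j = 1 by rewrite -exprMn mulfV// expr1n.
move: (2 ^+ j) (2^-1 ^+ j) (j`!%:R^-1) (pos _ ^+ j) (hat _) (\prod_(g <- _) _) => a b c p u v e.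
by transitivity ((a * b) * (u * (p * c * (t.1 * v)))); [ring|rewrite e mul1r].
Qed.

Lemma coef_le j : (j <= r)%N -> 0 <= (2 : R) ^+ j / j`!%:R <= 2 ^+ r.
Proof.
move=> jr; rewrite divr_ge0 ?exprn_ge0//= ler_pdivrMr ?ltr0n ?fact_gt0//.
by rewrite (@le_trans _ _ (2 ^+ r))// ?ler_weXn2l ?ler1n// ler_peMr ?exprn_ge0// ler1n fact_gt0.
Qed.

Lemma terms_coef l s y : (size s <= r)%N ->
  \sum_(t <- terms l s y) `|t.1| <= (N.+1%:R * (r.+1%:R * 2 ^+ r)) ^+ size l.
Proof.
elim: l s y => [|i l IH] s y sr; first by rewrite big_seq1 pder_le1.
set P := (N.+1%:R * _) ^+ size l in IH *.
have P0 : 0 <= P by rewrite /P exprn_ge0// mulr_ge0// mulr_ge0// exprn_ge0.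
rewrite terms_sum [size _]/= exprS -/P -mulrA.
apply: le_trans (sum_const_le (leqnn _) _); last by rewrite mulr_ge0// mulr_ge0// exprn_ge0.
apply: ler_sum => n _; rewrite -mulrA.
rewrite (@le_trans _ _ (\sum_(j < (r - size s).+1) (2 ^+ r * P)))//; last first.
  by apply: sum_const_le; [by rewrite ltnS leq_subr|rewrite mulr_ge0// exprn_ge0].
apply: ler_sum => j _; have jr : (j <= r)%N by apply: leq_trans (ord_subD j sr); exact: leq_addr.
have /andP[c0 c1] := coef_le jr.
under eq_bigr do rewrite normrM ger0_norm//.
rewrite -mulr_sumr ler_pM// ?sumr_ge0//; apply: IH.
by rewrite size_cat size_nseq ord_subD.
Qed.

Lemma terms_size l s y : (size s <= r)%N ->
  (size (terms l s y) <= (N.+1 * r.+1) ^ size l)%N.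
Proof.
elim: l s y => [//|i l IH] s y sr; rewrite -sum1_size terms_sum expnS -mulnA.
rewrite -[X in (_ <= X * _)%N]card_ord -sum_nat_const leq_sum// => n _.
rewrite (@leq_trans (\sum_(j < (r - size s).+1) (N.+1 * r.+1) ^ size l))//; last first.
  by rewrite sum_nat_const card_ord leq_mul2r ltnS leq_subr orbT.
apply: leq_sum => j _; rewrite sum1_size; apply: IH.
by rewrite size_cat size_nseq ord_subD.
Qed.

(** Few hats per coordinate are nonzero at a given [x], so this sum, which multiplies the error of a
    product, is free of [N]. The sum over all terms in [terms_coef] grows like [N^d] and enters only
    the norm. *)
Lemma terms_active l s y x : (size s <= r)%N ->
  \sum_(t <- terms l s y) `|t.1| * (\prod_(g <- t.2) fval g x != 0)%:R
  <= (3 * (r.+1%:R * 2 ^+ r)) ^+ size l.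
Proof.
elim: l s y => [|i l IH] s y sr.
  by rewrite big_seq1 big_nil oner_eq0 mulr1 pder_le1.
set P := _ ^+ _; rewrite terms_sum.
set Q := (3 * (r.+1%:R * 2 ^+ r)) ^+ size l in IH.
have Q0 : 0 <= Q by rewrite /Q exprn_ge0// mulr_ge0// mulr_ge0// exprn_ge0.
apply: (@le_trans _ _ (\sum_(n < N.+1)
    (hat (N%:R * x i ord0 - n%:R) != 0)%:R * (r.+1%:R * 2 ^+ r * Q))); last first.
  rewrite -mulr_suml (le_trans (ler_wpM2r _ (sum_hat_supp _)))//.
    by rewrite mulr_ge0// mulr_ge0// exprn_ge0.
  by rewrite [leLHS]mulrA /P exprS; exact: lexx.
apply: ler_sum => n _; have [h0|h0] := eqVneq (hat (N%:R * x i ord0 - n%:R)) 0.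
  rewrite mul0r big1// => j _; rewrite big1// => t _.
  by rewrite prod_facs h0 mul0r eqxx mulr0.
rewrite mul1r (@le_trans _ _ (\sum_(j < (r - size s).+1) (2 ^+ r * Q)))//; last first.
  by rewrite -mulrA; apply: sum_const_le; [by rewrite ltnS leq_subr|rewrite mulr_ge0// exprn_ge0].
apply: ler_sum => j _; have jr : (j <= r)%N by apply: leq_trans (ord_subD j sr); exact: leq_addr.
have /andP[c0 c1] := coef_le jr.
apply: (@le_trans _ _ (\sum_(t <- terms l (nseq j i ++ s) (upd y i (node n)))
   (2 ^+ j / j`!%:R * (`|t.1| * (\prod_(g <- t.2) fval g x != 0)%:R)))).
  apply: ler_sum => t _ /=; rewrite normrM (ger0_norm c0) -[leLHS]mulrA ler_wpM2l// ler_wpM2l//.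
  rewrite prod_facs; case: (eqVneq (\prod_(g <- t.2) fval g x) 0) => [->|_].
    by rewrite !mulr0 eqxx.
  by rewrite ler_nat leq_b1.
rewrite -mulr_sumr ler_pM// ?sumr_ge0//.
by apply: IH; rewrite size_cat size_nseq ord_subD.
Qed.

(** [2N + 1] is set by the hats: slope [N] and a bias of at most [N + 1]. *)
Definition goodfac (g : fac R d) :=
  fac_ok (2 * N%:R + 1) g /\ forall x, cube x -> 0 <= fval g x <= 1.

Lemma node_norm n : (n <= N)%N -> `|node n| <= 1.
Proof.
move=> nN; have Np : 0 < N%:R :> R by rewrite ltr0n.
rewrite /node normrM [ `|_^-1|]ger0_norm ?invr_ge0// ler_pdivrMr// mul1r ler_norml.
have : n%:R <= N%:R :> R by rewrite ler_nat.
have : 1 <= N%:R :> R by rewrite ler1n.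
have : 0 <= n%:R :> R by [].
by move: (n%:R) (N%:R) => a b; lra.
Qed.

Lemma sum_vec1_norm c i : 0 <= c -> \sum_j `|vec1 c i j| = c.
Proof.
move=> c0; rewrite (bigD1 i)//= /vec1 eqxx big1 ?addr0 ?ger0_norm// => j /negbTE ->.
exact: normr0.
Qed.

Lemma goodfac_hat i n : (n <= N)%N -> goodfac (hatf i n).
Proof.
move=> nN; have nN' : n%:R <= N%:R :> R by rewrite ler_nat.
split; last by move=> x _; rewrite fval_hatf hat_itv.
split; first by rewrite !big_ord_recl big_ord0 /= normrN normr1 normr_nat; lra.
move=> q /=; rewrite sum_vec1_norm//.
have q2 : (q : nat)%:R <= 2 :> R by rewrite ler_nat -ltnS.
have q0 : 0 <= (q : nat)%:R :> R by [].
have n0 : 0 <= n%:R :> R by [].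
have N1 : 1 <= N%:R :> R by rewrite ler1n.
move: (n%:R : R) (N%:R : R) ((q : nat)%:R : R) nN' q2 q0 n0 N1 => a b c *.
suff : `|1 - a - c| <= b + 1 by lra.
by rewrite ler_norml; apply/andP; split; lra.
Qed.

Lemma goodfac_mono i n : (n <= N)%N -> goodfac (monof i n).
Proof.
move=> nN; have N1 : 1 <= N%:R :> R by rewrite ler1n.
have := node_norm nN; rewrite ler_norml => /andP[m1 m2].
split.
  split; first by rewrite !big_ord_recl big_ord0 /= !normr0 ger0_norm ?invr_ge0//; lra.
  move=> q; rewrite sum_vec1_norm// normrN.
  by rewrite (le_trans (lerD (lexx _) (node_norm nN)))//; lra.
move=> x cx; rewrite fval_monof posE; have /andP[x0 x1] := cx i.
by case: (lerP 0 (x i ord0 - node n)); lra.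
Qed.

Lemma goodfac1 : goodfac (fac1 R d).
Proof.
split; last by move=> x _; rewrite fval1 ler01 lexx.
by apply: fac1_ok; rewrite lerDr mulr_ge0.
Qed.

(** A term has one hat per coordinate and monomials of total degree at most [r - size s], since
    every expansion uses up derivatives; over all coordinates this is [d + r] factors, hence a tree
    of depth [gamma]. Out of range, the default [(0, [::])] qualifies too. *)
Lemma terms_good l s y m j : (size s <= r)%N ->
  let t := nth (0, [::]) (terms l s y) m in
  goodfac (nth (fac1 R d) t.2 j) /\ (size t.2 <= size l + (r - size s))%N.
Proof.
pose P n (t : R * seq (fac R d)) := (forall j, goodfac (nth (fac1 R d) t.2 j)) /\ (size t.2 <= n)%N.
suff H : (size s <= r)%N -> forall m, P (size l + (r - size s))%N (nth (0, [::]) (terms l s y) m).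
  by move=> sr; have [h1 h2] := H sr m; split.
have P0 n : P n (0, [::]).
  by split=> // i; rewrite nth_nil; exact: goodfac1.
elim: l s y {m j} => [|i l IH] s y sr m.
  by case: m => [|m]; [split=> // j|]; rewrite /= nth_nil; [exact: goodfac1|exact: P0].
cbn [terms]; set n0 := (_ + _)%N.
have catP (ts1 ts2 : seq (R * seq (fac R d))) : (forall m, P n0 (nth (0, [::]) ts1 m)) ->
    (forall m, P n0 (nth (0, [::]) ts2 m)) -> forall m, P n0 (nth (0, [::]) (ts1 ++ ts2) m).
  by move=> h1 h2 m'; rewrite nth_cat; case: ifP.
have flatP (T : eqType) (F : T -> seq (R * seq (fac R d))) (a : seq T) :
    (forall c, c \in a -> forall m, P n0 (nth (0, [::]) (F c) m)) ->
    forall m, P n0 (nth (0, [::]) (flatten (map F a)) m).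
  elim: a => [|c a IHa] h m' /=; first by rewrite nth_nil; exact: P0.
  apply: catP => [|m'']; first by apply: h; rewrite mem_head.
  by apply: IHa => c' ca; apply: h; rewrite in_cons ca orbT.
apply: (flatP) => n; rewrite mem_iota add0n ltnS => nN {}m.
apply: (flatP) => j; rewrite mem_iota add0n => /= jr {}m.
have jr' : (j + size s <= r)%N by exact: (ord_subD (Ordinal jr)).
set ts := terms l _ _; have [mt|tm] := ltnP m (size ts); last first.
  by rewrite nth_default ?size_map//; exact: P0.
rewrite (nth_map (0, [::]))//; have sz : size (nseq j i ++ s) = (j + size s)%N.
  by rewrite size_cat size_nseq.
have := IH (nseq j i ++ s) (upd y i (node n)); rewrite sz => /(_ jr' m) [h1 h2].
split=> /=.
  case=> [|j']; first exact: goodfac_hat.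
  rewrite /= nth_cat size_nseq; case: ifP => jj'; last exact: h1.
  by rewrite nth_nseq jj'; exact: goodfac_mono.
rewrite size_cat size_nseq /n0 /= addSn ltnS.
have -> : (r - size s = j + (r - (j + size s)))%N.
  by rewrite [RHS]addnC [(j + size s)%N]addnC subnDA subnK// -(leq_add2r (size s)) subnK.
by rewrite addnCA leq_add2l.
Qed.

(** Once all coordinates are in [l], the base point is forgotten: one network, built at the base
    point 0, can be analysed at each [x] with base point [x], as [taylor_interp_err] requires. *)
Lemma terms_ext l s (y y' : 'cV[R]_d) : (forall i, i \notin l -> y i ord0 = y' i ord0) ->
  terms l s y = terms l s y'.
Proof.
elim: l s y y' => [|i l IH] s y y' yy.
  by rewrite /=; congr [:: (pder s f _, _)]; apply/matrixP => i j; rewrite ord1 yy.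
cbn [terms]; congr flatten; apply: eq_map => n; congr flatten; apply: eq_map => j.
congr map; apply: IH => i' i'l; rewrite !updE; case: eqP => // /eqP ne.
by rewrite yy// in_cons negb_or ne.
Qed.

(* The last factor, 0 wherever the exact product vanishes, makes the errors add up only over the
   hats that are active at [x]. *)
Lemma tprod_err k g fs x : (0 < k)%N -> cube x -> (forall j, goodfac (nth (fac1 R d) fs j)) ->
  (size fs <= 2 ^ g)%N ->
  `|tprod k g fs x - \prod_(h <- fs) fval h x| <=
    (2 ^ g)%:R * k%:R ^- 2 * (\prod_(h <- fs) fval h x != 0)%:R.
Proof.
move=> k0 cx fsg sz.
have F01 j : 0 <= leaf g fs x j <= 1.
  by rewrite /leaf; case: ifP => _; [apply: (fsg j).2|rewrite lexx ler01].
have e : \prod_(i < 2 ^ g) leaf g fs x (2 ^ g * 0 + i) = \prod_(h <- fs) fval h x.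
  rewrite (big_nth (fac1 R d)) big_mkord (big_ord_widen _ (fun i => fval (nth (fac1 R d) fs i) x) sz).
  rewrite [RHS]big_mkcond /=; apply: eq_bigr => i _; rewrite muln0 add0n /leaf ltn_ord.
  by case: ltnP => // ge; rewrite nth_default// fval1.
have [z|nz] := eqVneq (\prod_(h <- fs) fval h x) 0.
  by rewrite /tprod tree_prod0 ?e// z subr0 normr0 mulr0.
by rewrite mulr1 -e; exact: tree_err.
Qed.

Lemma NN_approx g k W L (K : R) : (0 < k)%N -> (d + r <= 2 ^ g)%N -> (g <= L)%N ->
  ((N.+1 * r.+1) ^ d * 2 ^ g * (3 * k.*2) <= W)%N ->
  6 * (N.+1%:R * (r.+1%:R * 2 ^+ r)) ^+ d * ((2 * N%:R + 1) * 14 ^+ g) <= K ->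
  exists2 phi, NN W L.+1 K phi & forall x, cube x ->
    `|phi x - f x| <= taylor_interpC d * ((2 / N%:R) ^+ r * (2 / N%:R) `^ beta) +
       (3 * (r.+1%:R * 2 ^+ r)) ^+ d * ((2 ^ g)%:R * k%:R ^- 2).
Proof.
move=> k0 dr gL WW KK; pose ts := terms (enum 'I_d) [::] 0.
have sz0 : (size ([::] : seq 'I_d) <= r)%N by [].
have good m j := terms_good (enum 'I_d) 0 m j sz0.
exists (fun x => \sum_(t <- ts) t.1 * tprod k g t.2 x).
  apply: (@NN_tprod R d k g k0 ts (2 * N%:R + 1) _ _ W L K _ gL _ _ KK).
  - by rewrite lerDr mulr_ge0.
  - by move=> m j; have [[] ] := good m j.
  - apply: leq_trans WW; rewrite leq_mul2r leq_mul2r.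
    by have := terms_size (enum 'I_d) 0 sz0; rewrite size_enum_ord => ->; rewrite !orbT.
  - by have := terms_coef (enum 'I_d) 0 sz0; rewrite size_enum_ord.
move=> x cx; have ex : ts = terms (enum 'I_d) [::] x.
  by apply: terms_ext => i; rewrite mem_enum.
have := @taylor_interp_err (enum 'I_d) [::] x x (enum_uniq _) sz0 cx (fun _ _ => erefl).
rewrite size_enum_ord subn0 -terms_taylor_interp -ex [pder _ f x]/= => H.
set A := \sum_(t <- ts) _; set B := \sum_(t <- ts) _ in H.
rewrite -(subrK B A) -addrA addrC (le_trans (ler_normD _ _))// lerD//.
rewrite /A /B -sumrB (le_trans (ler_norm_sum _ _ _))//.
have := terms_active (enum 'I_d) x x sz0; rewrite size_enum_ord -ex => act.
have E0 : 0 <= (2 ^ g)%:R * k%:R ^- 2 :> R by rewrite mulr_ge0 ?invr_ge0 ?exprn_ge0.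
apply: le_trans (ler_wpM2r E0 act); rewrite mulr_suml.
rewrite !(big_nth (0, [::])) !big_mkord; apply: ler_sum => m _.
rewrite -mulrBr normrM -mulrA ler_wpM2l// mulrC.
apply: tprod_err => //; first by move=> j; have [] := good m j.
have [_ h] := good m 0%N; apply: leq_trans h _.
by rewrite size_enum_ord subn0.
Qed.

End Partials.

(** * Concentration *)

(* No measurability is required: the integral of a nonnegative function is a supremum over the
   simple functions below it, which makes the lemma applicable to the adversarial loss. *)
Lemma ge0_le_lower_integral d (T : measurableType d) (R : realType)
    (mu : {measure set T -> \bar R}) (f1 f2 : T -> \bar R) :
  (forall x, 0 <= f1 x)%E -> (forall x, f1 x <= f2 x)%E ->
  (\int[mu]_x f1 x <= \int[mu]_x f2 x)%E.
Proof.
move=> f10 f12; rewrite !ge0_integralTE//; last by move=> x; exact: le_trans (f12 x).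
apply: le_ereal_sup => _ [h /= hf <-]; exists h => //= x.
exact: le_trans (hf x) (f12 x).
Qed.

(** * Integrals of bounded and of finite-valued functions *)

Section FiniteIntegrals.
Context d (T : measurableType d) (R : realType) (mu : probability T R).

Lemma integrable_cst_prob (c : R) : mu.-integrable setT (EFin \o cst c).
Proof. exact: finite_measure_integrable_cst. Qed.

Lemma Rintegral_cst_prob (c : R) : \int[mu]_(x in setT) c = c.
Proof.
have e := probability_setT mu.
by rewrite Rintegral_cst// [X in fine X]e mulr1.
Qed.

Lemma bounded_meas_integrable (f : T -> R) B : measurable_fun setT f ->
  (forall x, `|f x| <= B) -> mu.-integrable setT (EFin \o f).
Proof.
move=> mf fB; apply: measurable_bounded_integrable => //.
  by have e := probability_setT mu; rewrite [X in (X < _)%E]e ltry.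
exists B; split; first exact: num_real.
by move=> M BM x _; exact: le_trans (fB x) (ltW BM).
Qed.

Lemma Rintegral_sum (I : Type) (s : seq I) (f : I -> T -> R) :
  (forall i, mu.-integrable setT (EFin \o f i)) ->
  mu.-integrable setT (EFin \o (fun x => \sum_(i <- s) f i x)) /\
  \int[mu]_x (\sum_(i <- s) f i x) = \sum_(i <- s) \int[mu]_x f i x.
Proof.
move=> fi; elim: s => [|i s [IH1 IH2]].
  under eq_fun do rewrite big_nil.
  split; first exact: integrable_cst_prob.
  by rewrite Rintegral_cst_prob big_nil.
have e : (fun x => \sum_(j <- i :: s) f j x) = (fun x => f i x + \sum_(j <- s) f j x).
  by apply/funext => x; rewrite big_cons.
rewrite e big_cons -IH2; split; last by rewrite RintegralD.
exact: (integrableD measurableT (fi i) IH1).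
Qed.

Lemma Rintegral_affine (f : T -> R) c b : mu.-integrable setT (EFin \o f) ->
  mu.-integrable setT (EFin \o (fun x => c * f x + b)) /\
  \int[mu]_x (c * f x + b) = c * (\int[mu]_x f x) + b.
Proof.
move=> fi; have cf : mu.-integrable setT (EFin \o (fun x => c * f x)).
  exact: (integrableZl measurableT c fi).
split; first exact: (integrableD measurableT cf (integrable_cst_prob b)).
rewrite RintegralD//; last exact: integrable_cst_prob.
by rewrite RintegralZl// Rintegral_cst_prob.
Qed.

Lemma integrable_indic (A : set T) : measurable A -> mu.-integrable setT (EFin \o \1_A).
Proof.
move=> mA; apply: (@bounded_meas_integrable _ 1); first exact: measurable_indic.
by move=> x; rewrite indicE; case: (_ \in _); rewrite ?normr1 ?normr0.
Qed.

Lemma Rintegral_indic (A : set T) : measurable A -> \int[mu]_x \1_A x = fine (mu A).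
Proof. by move=> mA; rewrite /Rintegral integral_indic// setIT. Qed.

Lemma Rintegral_simple (I : finType) (A : I -> set T) (c : I -> R) :
  (forall i, measurable (A i)) ->
  mu.-integrable setT (EFin \o (fun x => \sum_i c i * \1_(A i) x)) /\
  \int[mu]_x (\sum_i c i * \1_(A i) x) = \sum_i c i * fine (mu (A i)).
Proof.
move=> mA; have H i : mu.-integrable setT (EFin \o (fun x => c i * \1_(A i) x)).
  exact: (integrableZl measurableT (c i) (integrable_indic (mA i))).
have [h1 h2] := Rintegral_sum (index_enum I) H; split=> //.
rewrite h2; apply: eq_bigr => i _; rewrite RintegralZl ?Rintegral_indic//.
exact: integrable_indic.
Qed.

Lemma finite_valued_sum (I : finType) (V : T -> I) (u : I -> R) x :
  u (V x) = \sum_a u a * \1_(V @^-1` [set a]) x.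
Proof.
rewrite (bigD1 (V x))//= indicE mem_set// mulr1 big1 ?addr0// => a ax.
rewrite indicE memNset ?mulr0//= => e; move: ax; rewrite e.
by rewrite eqxx.
Qed.

Lemma finite_valued_integral (I : finType) (V : T -> I) (u : I -> R) :
  (forall a, measurable (V @^-1` [set a])) ->
  mu.-integrable setT (EFin \o (fun x => u (V x))) /\
  \int[mu]_x u (V x) = \sum_a u a * fine (mu (V @^-1` [set a])).
Proof.
move=> mV; have e : (fun x => u (V x)) = (fun x => \sum_a u a * \1_(V @^-1` [set a]) x).
  by apply/funext => x; exact: finite_valued_sum.
by rewrite e; exact: Rintegral_simple.
Qed.

Lemma finite_valued_law (I : finType) (V : T -> I) :
  (forall a, measurable (V @^-1` [set a])) ->
  \sum_a fine (mu (V @^-1` [set a])) = 1.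
Proof.
move=> mV; have [_] := finite_valued_integral (fun=> 1) mV.
by rewrite Rintegral_cst_prob => ->; apply: eq_bigr => a _; rewrite mul1r.
Qed.

Lemma quantise (g : T -> R) B q : measurable_fun setT g -> (forall x, `|g x| <= B) ->
  (0 < q)%N -> exists s, exists V : T -> 'I_s.+1, exists v : 'I_s.+1 -> R,
  [/\ forall a, measurable (V @^-1` [set a]), forall x, `|g x - v (V x)| <= q%:R^-1 &
      forall a, `|v a| <= B].
Proof.
move=> mg gB q0; have qp : 0 < q%:R :> R by rewrite ltr0n.
have B0 : 0 <= B by apply: le_trans (gB point).
pose s := Num.truncn ((B + B) * q%:R).
pose tr x := Num.truncn ((g x + B) * q%:R).
have g0 x : 0 <= (g x + B) * q%:R.
  by rewrite mulr_ge0// -lerBlDr sub0r; have := gB x; rewrite ler_norml => /andP[].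
have trs x : (tr x < s.+1)%N.
  rewrite ltnS truncn_le_nat// ; apply: le_lt_trans (_ : _ < s.+1%:R).
    apply: (@ler_wpM2r _ q%:R _ (g x + B) (B + B)) => //.
    by rewrite lerD2r; have := gB x; rewrite ler_norml => /andP[].
  by have /andP[] := truncn_itv (mulr_ge0 (addr_ge0 B0 B0) (ltW qp)).
pose V x : 'I_s.+1 := Ordinal (trs x).
(* A cell is represented by its lower end, which keeps the values in [[-B, B]]. *)
exists s, V, (fun a => a%:R / q%:R - B).
split.
- move=> a; have -> : V @^-1` [set a] = g @^-1` `[a%:R / q%:R - B, a.+1%:R / q%:R - B[%classic.
    apply/seteqP; split=> x /=.
      move=> /(congr1 val) /= e; have /andP[h1 h2] := truncn_itv (g0 x).
      rewrite -/(tr x) e in h1 h2; rewrite in_itv /= lerBlDr ltrBrDr.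
      by rewrite ler_pdivrMr// ltr_pdivlMr// h1.
    rewrite in_itv /= lerBlDr ltrBrDr ler_pdivrMr// ltr_pdivlMr// => /andP[h1 h2].
    by apply/val_inj => /=; apply/truncn_def; rewrite h1.
  by rewrite -[X in measurable X]setTI; apply: mg => //; exact: measurable_itv.
- move=> x; have /andP[h1 h2] := truncn_itv (g0 x).
  have -> : g x - ((tr x)%:R / q%:R - B) = ((g x + B) * q%:R - (tr x)%:R) / q%:R.
    by field; rewrite gt_eqF.
  rewrite normrM [X in _ * X]ger0_norm ?invr_ge0 ?(ltW qp)// ler_piMl ?invr_ge0 ?(ltW qp)//.
  by rewrite ger0_norm ?subr_ge0// lerBlDl natr1 ltW.
- move=> a; have aB : a%:R / q%:R <= B + B.
    rewrite ler_pdivrMr//; have /andP[h _] := truncn_itv (mulr_ge0 (addr_ge0 B0 B0) (ltW qp)).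
    by apply: le_trans h; rewrite ler_nat -ltnS.
  rewrite ler_norml lerBrDr addrC subrr divr_ge0//=.
  by rewrite lerBlDr.
Qed.

End FiniteIntegrals.

(** * Exponential moments of an i.i.d. sample *)

Section Concentration.
Context (R : realType) dD (D : measurableType dD) (P : probability D R).
Variable n : nat.
Context dO (Omega : measurableType dO) (Q : probability Omega R) (Z : 'I_n -> Omega -> D).
Hypothesis n0 : (0 < n)%N.
Hypothesis mZ : forall i, measurable_fun setT (Z i).
Hypothesis lawZ : forall i (A : set D), measurable A -> Q (Z i @^-1` A) = P A.
Hypothesis indZ : forall A : 'I_n -> set D, (forall i, measurable (A i)) ->
  Q (\bigcap_(i in [set: 'I_n]) (Z i @^-1` A i)) = (\prod_(i < n) fine (Q (Z i @^-1` A i)))%:E.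

(* Independence is only given for events, whence the restriction to finite-valued functions;
   [quantise] reduces the general case to it. *)
Lemma iid_prod (I : finType) (V : D -> I) (u : I -> R) :
  (forall a, measurable (V @^-1` [set a])) ->
  Q.-integrable setT (EFin \o (fun w => \prod_i u (V (Z i w)))) /\
  \int[Q]_w (\prod_i u (V (Z i w))) = (\sum_a u a * fine (P (V @^-1` [set a]))) ^+ n.
Proof.
move=> mV; pose A (f : {ffun 'I_n -> I}) := \bigcap_(i in [set: 'I_n]) (Z i @^-1` (V @^-1` [set f i])).
have mA f : measurable (A f).
  apply: fin_bigcap_measurable => // i _; rewrite -[X in measurable X]setTI.
  exact: mZ.
(* Expanding over the values [f] of the sample gives a combination of indicators of cylinders, to
   which [indZ] applies. *)
have e : (fun w => \prod_i u (V (Z i w))) =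
    (fun w => \sum_(f : {ffun 'I_n -> I}) (\prod_i u (f i)) * \1_(A f) w).
  apply/funext => w; pose fw := [ffun i => V (Z i w)].
  rewrite (bigD1 fw)//= [X in _ + X]big1 ?addr0 => [|f fne]; last first.
    rewrite indicE memNset ?mulr0// => h; move/eqP: fne; apply; apply/ffunP => i.
    by rewrite ffunE; have := h i Logic.I; move=> /= ->.
  rewrite indicE mem_set ?mulr1; last by move=> i _ /=; rewrite ffunE.
  by apply: eq_bigr => i _; rewrite ffunE.
rewrite e; have [h1 h2] := Rintegral_simple Q (fun f : {ffun 'I_n -> I} => \prod_i u (f i)) mA.
split=> //; rewrite h2.
rewrite -[in RHS](card_ord n) -prodr_const bigA_distr_bigA /=; apply: eq_bigr => f _.
rewrite indZ//= -big_split /=; apply: eq_bigr => i _.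
by rewrite lawZ.
Qed.

(** Squaring [expR (x/2) <= 1/(1 - x/2)] leaves a polynomial inequality, which holds once
    [1 - 3x + x^2 >= 0]; this is the origin of the threshold 1/3. *)
Lemma expR_quadratic (x : R) : `|x| <= 3^-1 -> expR x <= 1 + x + x ^+ 2.
Proof.
rewrite ler_norml => /andP[x1 x2].
have e2 : expR x = expR (x / 2) ^+ 2.
  by rewrite expr2 -expRD; congr expR; field.
have h : expR (x / 2) * (1 - x / 2) <= 1.
  have := expR_ge1Dx (- (x / 2)); rewrite -(ler_pM2l (expR_gt0 (x / 2))).
  by rewrite -expRD subrr expR0.
have p : 0 < 1 - x / 2 by lra.
have h' : expR (x / 2) <= (1 - x / 2)^-1 by rewrite -[leRHS]mul1r ler_pdivlMr.
rewrite e2 (@le_trans _ _ ((1 - x / 2)^-1 ^+ 2))//.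
  by rewrite lerXn2r ?nnegrE ?expR_ge0// invr_ge0 ltW.
rewrite exprVn -[leLHS]mul1r ler_pdivrMr ?exprn_gt0//.
have -> : (1 + x + x ^+ 2) * (1 - x / 2) ^+ 2 = 1 + (x / 2) ^+ 2 * (1 - 3 * x + x ^+ 2) by field.
by rewrite lerDl mulr_ge0 ?sqr_ge0//; nra.
Qed.

(** Centring cancels the linear term of [expR_quadratic], and the centred values are at most [2B],
    whence [4 t^2 B^2]. *)
Lemma mgf_bound (I : finType) (v p : I -> R) B t : (forall a, `|v a| <= B) ->
  (forall a, 0 <= p a) -> \sum_a p a = 1 -> 0 <= t -> t * (2 * B) <= 3^-1 ->
  \sum_a expR (t * (\sum_b v b * p b - v a)) * p a <= expR (4 * t ^+ 2 * B ^+ 2).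
Proof.
move=> vB p0 p1 t0 tB; set c := \sum_b v b * p b.
have cB : `|c| <= B.
  rewrite (le_trans (ler_norm_sum _ _ _))// -[B]mulr1 -p1 mulr_sumr ler_sum// => a _.
  by rewrite normrM [ `|p a|]ger0_norm// ler_wpM2r.
have dB a : `|c - v a| <= 2 * B.
  by rewrite (le_trans (ler_normB _ _))// mulr_natl mulr2n lerD.
have pt a : expR (t * (c - v a)) <= 1 + t * (c - v a) + 4 * t ^+ 2 * B ^+ 2.
  apply: le_trans (expR_quadratic _) _.
    by rewrite normrM ger0_norm// (le_trans _ tB)// ler_wpM2l.
  rewrite lerD2l exprMn; have -> : 4 * t ^+ 2 * B ^+ 2 = t ^+ 2 * (2 * B) ^+ 2 by ring.
  rewrite ler_wpM2l ?sqr_ge0// -[leLHS]real_normK ?num_real//.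
  by rewrite lerXn2r// nnegrE// (le_trans _ (dB a)).
apply: le_trans (_ : 1 + 4 * t ^+ 2 * B ^+ 2 <= _); last exact: expR_ge1Dx.
apply: (@le_trans _ _ (\sum_a (1 + t * (c - v a) + 4 * t ^+ 2 * B ^+ 2) * p a)).
  by apply: ler_sum => a _; rewrite ler_wpM2r.
have -> : \sum_a (1 + t * (c - v a) + 4 * t ^+ 2 * B ^+ 2) * p a =
   \sum_a ((1 + t * c + 4 * t ^+ 2 * B ^+ 2) * p a - t * (v a * p a)).
  by apply: eq_bigr => a _; ring.
rewrite sumrB -!mulr_sumr p1 -/c.
have -> : (1 + t * c + 4 * t ^+ 2 * B ^+ 2) * 1 - t * c = 1 + 4 * t ^+ 2 * B ^+ 2 by ring.
by [].
Qed.

(* [G] is a soft maximum of the deviations, linearised by [ln x <= ln a + x / a - 1]. *)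
Lemma concentration (J : finType) (g : J -> D -> R) B t :
  (0 < #|J|)%N -> (forall j, measurable_fun setT (g j)) -> (forall j z, `|g j z| <= B) ->
  0 < t -> t * (2 * B) <= 3^-1 ->
  exists G : Omega -> R, [/\ Q.-integrable setT (EFin \o G),
    forall w j, \int[P]_z g j z - n%:R^-1 * \sum_i g j (Z i w) <= G w &
    \int[Q]_w G w <= ln #|J|%:R / (n%:R * t) + 4 * t * B ^+ 2 + 2 / n%:R].
Proof.
move=> J0 mg gB t0 tB; have np : 0 < n%:R :> R by rewrite ltr0n.
have /choice[s Hs] : forall j, exists s, exists V : D -> 'I_s.+1, exists v : 'I_s.+1 -> R,
  [/\ forall a, measurable (V @^-1` [set a]), forall x, `|g j x - v (V x)| <= n%:R^-1 &
      forall a, `|v a| <= B] by move=> j; exact: quantise.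
pose V j := projT1 (cid (Hs j)); have Hv j := projT2 (cid (Hs j)).
pose v j := projT1 (cid (Hv j)); have H j : [/\ _, _ & _] := projT2 (cid (Hv j)).
pose c j := \sum_b v j b * fine (P (V j @^-1` [set b])).
pose u j a := expR (t * (c j - v j a)).
pose E j w := \prod_i u j (V j (Z i w)).
have mV j : forall a, measurable (V j @^-1` [set a]) by case: (H j).
have EI j := iid_prod (u j) (mV j).
have Ele j : \int[Q]_w E j w <= expR (4 * t ^+ 2 * B ^+ 2 * n%:R).
  case: (EI j) => _ ->; rewrite mulrC expRM_natl.
  rewrite lerXn2r ?nnegrE ?expR_ge0//.
    by apply: sumr_ge0 => a _; rewrite mulr_ge0 ?expR_ge0// fine_ge0.
  apply: mgf_bound => //; first by case: (H j).
  - by move=> a; rewrite fine_ge0.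
  - exact: (finite_valued_law P (mV j)).
  - exact: ltW.
pose a := #|J|%:R * expR (4 * t ^+ 2 * B ^+ 2 * n%:R).
have a0 : 0 < a by rewrite mulr_gt0 ?ltr0n ?expR_gt0.
have [SI SE] := Rintegral_sum (index_enum J) (fun j => (EI j).1).
(* [a] bounds the mean of [\sum_j E j], so the linearisation of [ln] at [a] costs nothing on
   average. The [2/n] pays for quantising to within [1/n], once in the mean and once in the sample
   average. *)
pose b := (n%:R * t)^-1 * (ln a - 1) + 2 / n%:R.
have nt : 0 < n%:R * t by rewrite mulr_gt0.
exists (fun w => (n%:R * t * a)^-1 * (\sum_j E j w) + b); split.
- exact: (Rintegral_affine _ _ SI).1.
- move=> w j; have [_ q1 _] := H j.
  have cg : \int[P]_z g j z <= c j + n%:R^-1.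
    have [vi ve] := finite_valued_integral P (v j) (mV j).
    rewrite /c -ve -[X in _ + X](Rintegral_cst_prob P) -RintegralD//; last exact: integrable_cst_prob.
    apply: le_Rintegral => //.
    + exact: bounded_meas_integrable (gB j).
    + exact: (integrableD measurableT vi (integrable_cst_prob P _)).
    + move=> z _; rewrite -lerBlDl (le_trans (ler_norm _))//.
  have gs : n%:R^-1 * \sum_i v j (V j (Z i w)) - n%:R^-1 <= n%:R^-1 * \sum_i g j (Z i w).
    rewrite lerBlDr -lerBlDl -mulrBr -sumrB -[leRHS]mulr1 ler_wpM2l ?invr_ge0//.
    rewrite (@le_trans _ _ (\sum_(i < n) n%:R^-1))//.
      by apply: ler_sum => i _; rewrite (le_trans (ler_norm _))// distrC.
    by rewrite sumr_const card_ord -[leLHS]mulr_natr mulVf// gt_eqF.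
  have key : c j - n%:R^-1 * \sum_i v j (V j (Z i w)) <=
     (n%:R * t * a)^-1 * (\sum_j E j w) + (n%:R * t)^-1 * (ln a - 1).
    have -> : c j - n%:R^-1 * \sum_i v j (V j (Z i w)) =
        n%:R^-1 * \sum_i (c j - v j (V j (Z i w))).
      rewrite sumrB sumr_const card_ord -[c j *+ n]mulr_natl mulrBr mulrA mulVf ?mul1r//.
      by rewrite gt_eqF.
    rewrite invfM -mulrA -mulrDr invfM -mulrA ler_wpM2l ?invr_ge0//.
    rewrite -(ler_pM2l t0) [leRHS]mulrA mulfV ?mul1r ?gt_eqF//.
    set S := t * _.
    have := expR_ge1Dx (S - ln a).
    have -> : expR (S - ln a) = a^-1 * E j w.
      rewrite expRD expRN lnK ?posrE// mulrC; congr (_ * _).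
      by rewrite /S mulr_sumr expR_sum.
    move=> h; have : a^-1 * E j w <= a^-1 * \sum_j E j w.
      rewrite ler_wpM2l ?invr_ge0 ?(ltW a0)// (bigD1 j)//= lerDl sumr_ge0// => j' _.
      by rewrite prodr_ge0// => i _; rewrite expR_ge0.
    by lra.
  rewrite /b addrA; have : 2 / n%:R = n%:R^-1 + n%:R^-1 :> R by lra.
  by lra.
- rewrite (Rintegral_affine _ _ SI).2 SE /b.
  have : (n%:R * t * a)^-1 * (\sum_j \int[Q]_w E j w) <= (n%:R * t)^-1.
    rewrite invfM -mulrA -[leRHS]mulr1 ler_wpM2l ?invr_ge0 ?(ltW nt)// mulrC ler_pdivrMr// mul1r.
    apply: (@le_trans _ _ (\sum_(j : J) expR (4 * t ^+ 2 * B ^+ 2 * n%:R))).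
      by apply: ler_sum.
    by rewrite sumr_const -[leLHS]mulr_natl.
  have -> : ln a = ln #|J|%:R + 4 * t ^+ 2 * B ^+ 2 * n%:R.
    by rewrite lnM ?posrE ?ltr0n ?expR_gt0// expRK.
  have -> : (n%:R * t)^-1 * (ln #|J|%:R + 4 * t ^+ 2 * B ^+ 2 * n%:R - 1) =
     ln #|J|%:R / (n%:R * t) + 4 * t * B ^+ 2 - (n%:R * t)^-1.
    by field; rewrite !gt_eqF.
  by lra.
Qed.

End Concentration.

(** * Risks *)

Section Borel.
Variables (R : realType) (d : nat).

Lemma lip_open_gt (f : 'cV[R]_d -> R) C a : 0 <= C ->
  (forall x y, `|f x - f y| <= C * supn (x - y)) -> open (f @^-1` `]a, +oo[).
Proof.
move=> C0 fC; rewrite openE => x /=; rewrite in_itv /= andbT => ax.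
have C1 : 0 < C + 1 by rewrite ltr_wpDl.
apply/nbhs_ballP; exists ((f x - a) / (C + 1)) => /=; first by rewrite divr_gt0// subr_gt0.
move=> y; rewrite mx_norm_ball /ball_ /= => xy; rewrite in_itv /= andbT.
have : `|f x - f y| < f x - a.
  apply: le_lt_trans (fC x y) _.
  apply: le_lt_trans (_ : (C + 1) * supn (x - y) < _); last first.
    by rewrite mulrC -ltr_pdivlMr// (le_lt_trans (supn_le_norm _)).
  by rewrite ler_wpM2r ?supn_ge0// lerDl.
by move=> /(le_lt_trans (ler_norm _)); rewrite ltrD2l ltrN2.
Qed.

Definition borelT := g_sigma_algebraType [set A : set 'cV[R]_d | open A].

Lemma lip_borel (f : 'cV[R]_d -> R) C : 0 <= C ->
  (forall x y, `|f x - f y| <= C * supn (x - y)) ->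
  measurable_fun setT (f : borelT -> R).
Proof.
move=> C0 fC; apply: (measurability _ (RGenOInfty.measurableE R)) => _ [_ [a ->] <-].
rewrite setTI; apply: sub_sigma_algebra; exact: lip_open_gt fC.
Qed.

End Borel.

Section Risk.
Context (R : realType) (d r : nat) (beta : R) dD (D : measurableType dD) (P : probability D R).
Variables (Xset : set 'cV[R]_d) (X : D -> 'cV[R]_d) (Y : D -> R).
Hypothesis Xcube : Xset `<=` @cube R d.
Hypothesis XX : forall z, Xset (X z).
Hypothesis Y1 : forall z, `|Y z| <= 1.
Hypothesis mX : forall A, borelV A -> measurable (X @^-1` A).
Hypothesis mY : measurable_fun setT Y.

Definition sqloss (f : 'cV[R]_d -> R) (z : D) : R := (f (X z) - Y z) ^+ 2.

Lemma sqloss_ge0 f z : 0 <= sqloss f z. Proof. exact: sqr_ge0. Qed.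

Lemma measurable_compX (f : borelT R d -> R) :
  measurable_fun setT f -> measurable_fun setT (fun z => f (X z)).
Proof.
move=> mf _ B mB; rewrite setTI; apply: (mX (A := f @^-1` B)).
by have := mf measurableT B mB; rewrite setTI; exact.
Qed.

Lemma measurable_sqloss (f : borelT R d -> R) :
  measurable_fun setT f -> measurable_fun setT (sqloss f).
Proof.
move=> mf; apply: measurable_funX; apply: measurable_funB => //.
exact: measurable_compX.
Qed.

Lemma sqr_diff_le (M u v y e : R) : `|u| <= M -> `|v| <= M -> `|y| <= 1 -> `|u - v| <= e ->
  (u - y) ^+ 2 <= (v - y) ^+ 2 + 2 * (M + 1) * e.
Proof.
move=> uM vM y1 uv; rewrite -lerBlDl.
have -> : (u - y) ^+ 2 - (v - y) ^+ 2 = (u + v - 2 * y) * (u - v) by ring.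
rewrite (le_trans (ler_norm _))// normrM ler_pM//.
rewrite (le_trans (ler_normB _ _))// normrM normr_nat mulrDr mulr1.
have := ler_normD u v; lra.
Qed.

Lemma sqr_le (M u y : R) : `|u| <= M -> `|y| <= 1 -> `|(u - y) ^+ 2| <= (M + 1) ^+ 2.
Proof.
move=> uM y1; rewrite normrX lerXn2r ?nnegrE//.
  by rewrite (le_trans (normr_ge0 u))// (le_trans uM)// lerDl.
by rewrite (le_trans (ler_normB _ _))// lerD.
Qed.

Lemma advloss_ge f eps z : 0 <= eps -> ((sqloss f z)%:E <= advloss Xset X Y f eps z)%E.
Proof.
move=> e0; apply: ereal_sup_ubound; exists (X z) => //; split => //.
by rewrite subrr supn0.
Qed.

Lemma advloss_ge0 f eps z : 0 <= eps -> (0 <= advloss Xset X Y f eps z)%E.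
Proof. by move=> e0; apply: le_trans (advloss_ge f z e0); rewrite lee_fin sqloss_ge0. Qed.

Lemma advloss_le f (eps M K : R) z : 0 <= K ->
  (forall x, cube x -> `|f x| <= M) ->
  (forall x y, `|f x - f y| <= K * supn (x - y)) ->
  (advloss Xset X Y f eps z <= (sqloss f z + 2 * (M + 1) * (K * eps))%:E)%E.
Proof.
move=> K0 fM fK; apply: ge_ereal_sup => _ [x [xX xe] <-]; rewrite lee_fin.
apply: sqr_diff_le => //; [exact/fM/Xcube|exact/fM/Xcube|].
by rewrite (le_trans (fK _ _))// ler_wpM2l.
Qed.

Lemma sqloss_integrable (f : borelT R d -> R) (M : R) : measurable_fun setT f ->
  (forall x, cube x -> `|f x| <= M) -> P.-integrable setT (EFin \o sqloss f).
Proof.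
move=> mf fM; apply: bounded_meas_integrable (measurable_sqloss mf) _ => z.
by apply: sqr_le => //; exact/fM/Xcube.
Qed.

Definition risk (f : 'cV[R]_d -> R) : R := \int[P]_z sqloss f z.

Lemma EFin_risk (f : borelT R d -> R) (M : R) : measurable_fun setT f ->
  (forall x, cube x -> `|f x| <= M) -> (\int[P]_z (sqloss f z)%:E)%E = (risk f)%:E.
Proof.
by move=> mf fM; rewrite /risk /Rintegral fineK// integrable_fin_num// (sqloss_integrable mf fM).
Qed.

Lemma advrisk_ge (f : borelT R d -> R) (M eps : R) : 0 <= eps -> measurable_fun setT f ->
  (forall x, cube x -> `|f x| <= M) -> ((risk f)%:E <= advrisk P Xset X Y f eps)%E.
Proof.
move=> e0 mf fM; rewrite -(EFin_risk mf fM); apply: ge0_le_lower_integral => z.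
  by rewrite lee_fin sqloss_ge0.
exact: advloss_ge.
Qed.

Lemma advrisk_le (f : borelT R d -> R) (M K eps : R) : 0 <= eps -> 0 <= K ->
  (forall x, cube x -> `|f x| <= M) -> (forall x y, `|f x - f y| <= K * supn (x - y)) ->
  (advrisk P Xset X Y f eps <= (risk f + 2 * (M + 1) * (K * eps))%:E)%E.
Proof.
move=> e0 K0 fM fK; have mf := lip_borel K0 fK.
have fi := sqloss_integrable mf fM.
have [h1 h2] := Rintegral_affine 1 (2 * (M + 1) * (K * eps)) fi.
rewrite mul1r in h2; rewrite /risk -h2 /Rintegral fineK; last first.
  by apply: integrable_fin_num.
apply: ge0_le_lower_integral => z; first exact: advloss_ge0.
by rewrite mul1r; exact: advloss_le.
Qed.

(** * The regression function minimises the plain risk *)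

Variable f0 : 'cV[R]_d -> R.
Hypothesis mf0 : measurable_fun setT (f0 : borelT R d -> R).
Hypothesis f0M : forall x, cube x -> `|f0 x| <= 1.
Hypothesis cond0 : forall A, borelV A -> (\int[P]_(z in X @^-1` A) (Y z - f0 (X z))%:E = 0)%E.

Let resid z := Y z - f0 (X z).

Lemma resid_le z : `|resid z| <= 2.
Proof.
rewrite (le_trans (ler_normB _ _))// -[2]/(1 + 1) lerD//; exact/f0M/Xcube.
Qed.

Lemma resid_measurable : measurable_fun setT resid.
Proof. by apply: measurable_funB => //; exact: measurable_compX. Qed.

(* From sets to functions: approximate [h] uniformly by finite-valued functions. *)
Lemma resid_orthogonal (h : borelT R d -> R) M : measurable_fun setT h ->
  (forall x, `|h x| <= M) -> \int[P]_z (resid z * h (X z)) = 0.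
Proof.
move=> mh hM; apply/eqP; rewrite -normr_le0; apply/ler_addgt0Pl => e e0; rewrite addr0.
pose q := (Num.truncn (2 / e)).+1.
have q0 : 0 < q%:R :> R by rewrite ltr0n.
have qe : 2 / q%:R <= e.
  rewrite ler_pdivrMr// mulrC -ler_pdivrMr// ltW//.
  by have /andP[] := truncn_itv (divr_ge0 (ler0n R 2) (ltW e0)).
have [s [V [v [mV hv vM]]]] := quantise mh hM (ltn0Sn (Num.truncn (2 / e))).
have mrV a : measurable_fun setT (fun z => resid z * \1_(X @^-1` (V @^-1` [set a])) z).
  apply: measurable_funM; first exact: resid_measurable.
  by apply: measurable_indic; apply: mX; exact: mV.
have irV a : P.-integrable setT (EFin \o (fun z => resid z * \1_(X @^-1` (V @^-1` [set a])) z)).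
  apply: (@bounded_meas_integrable _ _ _ _ _ 2) => // z; rewrite normrM.
  by rewrite -[leRHS]mulr1 ler_pM// ?resid_le// indicE; case: (_ \in _); rewrite ?normr1 ?normr0.
have zero a : \int[P]_z (resid z * \1_(X @^-1` (V @^-1` [set a])) z) = 0.
  transitivity (\int[P]_(z in X @^-1` (V @^-1` [set a])) resid z); last first.
    by rewrite /Rintegral cond0//; exact: mV.
  rewrite [RHS]Rintegral_mkcond; apply: eq_Rintegral => z _.
  by rewrite patchE indicE; case: ifP; rewrite ?mulr1 ?mulr0.
have e1 : (fun z => resid z * v (V (X z))) =
    (fun z => \sum_a (v a * (resid z * \1_(X @^-1` (V @^-1` [set a])) z))).
  apply/funext => z; rewrite (finite_valued_sum (V \o X)) mulr_sumr.
  by apply: eq_bigr => a _; rewrite mulrCA.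
have iv a : P.-integrable setT (EFin \o (fun z => v a * (resid z * \1_(X @^-1` (V @^-1` [set a])) z))).
  exact: (integrableZl measurableT (v a) (irV a)).
have [iS eS] := Rintegral_sum (index_enum 'I_s.+1) iv.
rewrite -e1 in iS.
have z1 : \int[P]_z (resid z * v (V (X z))) = 0.
  have -> : \int[P]_z (resid z * v (V (X z))) =
      \int[P]_z (\sum_a (v a * (resid z * \1_(X @^-1` (V @^-1` [set a])) z))).
    by congr (Rintegral _ _ _).
  by rewrite eS big1// => a _; rewrite RintegralZl// zero mulr0.
have ih : P.-integrable setT (EFin \o (fun z => resid z * h (X z))).
  apply: (@bounded_meas_integrable _ _ _ _ _ (2 * M)).
    by apply: measurable_funM; [exact: resid_measurable|exact: measurable_compX].
  by move=> z; rewrite normrM ler_pM// resid_le.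
have -> : \int[P]_z (resid z * h (X z)) = \int[P]_z (resid z * h (X z) - resid z * v (V (X z))).
  by rewrite RintegralB// z1 subr0.
have id := integrableB measurableT ih iS.
apply: le_trans (le_normr_Rintegral measurableT id) _.
rewrite -[leRHS](Rintegral_cst_prob P); apply: le_Rintegral => //.
- exact: integrable_norm id.
- exact: integrable_cst_prob.
by move=> z _; rewrite -mulrBr normrM (le_trans _ qe)// ler_pM// resid_le.
Qed.

(** Pythagoras: the cross term integrates the residual against a function of [X] and vanishes. *)
Lemma risk_decomp (f : borelT R d -> R) (M : R) : measurable_fun setT f ->
  (forall x, cube x -> `|f x| <= M) ->
  risk f = risk f0 + \int[P]_z ((f (X z) - f0 (X z)) ^+ 2).
Proof.
(* [resid_orthogonal] wants a bound everywhere, while [f] and [f0] are bounded on the cube only; on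
   the range of [X] the clipping changes nothing. *)
move=> mf fM; pose h x := Num.max (- (1 + M)) (Num.min (1 + M) (f0 x - f x)).
have mh : measurable_fun setT (h : borelT R d -> R).
  apply: measurable_maxr => //; apply: measurable_minr => //.
  exact: measurable_funB.
have M0 (z : D) : 0 <= 1 + M by rewrite addr_ge0// (le_trans _ (fM _ (Xcube (XX z)))).
have df (z : D) : `|f0 (X z) - f (X z)| <= 1 + M.
  by rewrite (le_trans (ler_normB _ _))// lerD//; [exact/f0M/Xcube|exact/fM/Xcube].
have hX (z : D) : h (X z) = f0 (X z) - f (X z).
  have := df z; rewrite ler_norml => /andP[h1 h2].
  by rewrite /h min_r// max_r.
have M0' := M0 point.
have hM x : `|h x| <= 1 + M.
  by rewrite ler_norml /h le_max lexx /= ge_max ge_min lexx /= andbT; exact: (ge0_cp M0').2.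
have orth := resid_orthogonal mh hM.
have mc g : measurable_fun setT (g : borelT R d -> R) -> measurable_fun setT (fun z => g (X z)).
  exact: measurable_compX.
have i1 := sqloss_integrable mf0 f0M.
have i2 : P.-integrable setT (EFin \o (fun z => (f (X z) - f0 (X z)) ^+ 2)).
  apply: (@bounded_meas_integrable _ _ _ _ _ ((1 + M) ^+ 2)).
    by apply: measurable_funX; apply: measurable_funB; exact: mc.
  by move=> z; rewrite normrX distrC lerXn2r// nnegrE.
have i3 : P.-integrable setT (EFin \o (fun z => resid z * h (X z))).
  apply: (@bounded_meas_integrable _ _ _ _ _ (2 * (1 + M))).
    by apply: measurable_funM; [exact: resid_measurable|exact: mc].
  by move=> z; rewrite normrM ler_pM// resid_le.
have [i4 e4] := Rintegral_affine 2 0 i3.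
rewrite orth mulr0 addr0 in e4.
rewrite /risk -[RHS]addr0 -e4 -RintegralD// -RintegralD//; last first.
  exact: (integrableD measurableT i1 i2).
apply: eq_Rintegral => z _; rewrite /sqloss hX /resid; ring.
Qed.

Lemma risk_ge (f : borelT R d -> R) (M : R) : measurable_fun setT f ->
  (forall x, cube x -> `|f x| <= M) -> risk f0 <= risk f.
Proof.
move=> mf fM; rewrite (risk_decomp mf fM) lerDl; apply: Rintegral_ge0 => z _.
exact: sqr_ge0.
Qed.

Lemma risk_le (f : borelT R d -> R) (M tau : R) : measurable_fun setT f ->
  (forall x, cube x -> `|f x| <= M) -> (forall x, cube x -> `|f x - f0 x| <= tau) ->
  risk f <= risk f0 + tau ^+ 2.
Proof.
move=> mf fM ft; rewrite (risk_decomp mf fM) lerD2l -[leRHS](Rintegral_cst_prob P).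
have sq z : (f (X z) - f0 (X z)) ^+ 2 <= tau ^+ 2.
  rewrite -[leLHS]real_normK ?num_real// lerXn2r ?nnegrE//; last exact/ft/Xcube.
  by rewrite (le_trans _ (ft _ (Xcube (XX z)))).
apply: le_Rintegral => //; last exact: integrable_cst_prob.
apply: (@bounded_meas_integrable _ _ _ _ _ (tau ^+ 2)).
  by apply: measurable_funX; apply: measurable_funB; exact: measurable_compX.
by move=> z; rewrite ger0_norm ?sqr_ge0.
Qed.

(** * Excess risk and empirical risk *)

Variables (W L n : nat) (K M eps : R).
Hypothesis K0 : 0 < K.
Hypothesis eps0 : 0 <= eps.
Hypothesis n0 : (0 < n)%N.
(** A function of the class is arbitrary outside the cube, so measurability is asked of an
    extension, which has the same adversarial risk ([eq_advrisk]). *)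
Hypothesis HoelderM : forall g, Hoelder r beta g ->
  exists2 g' : borelT R d -> R, measurable_fun setT g' & forall x, cube x -> g x = g' x /\ `|g' x| <= 1.

Lemma eq_advrisk g g' : (forall x, cube x -> g x = g' x) ->
  advrisk P Xset X Y g eps = advrisk P Xset X Y g' eps.
Proof.
move=> gg; apply: eq_integral => z _; rewrite /advloss; congr ereal_sup.
apply/seteqP; split=> _ [x xX <-]; exists x => //; rewrite gg//; exact/Xcube/xX.1.
Qed.

Lemma NN_bounded (g : 'cV[R]_d -> R) (L' : nat) (K' : R) : 0 <= K' -> NN W L'.+1 K' g ->
  exists B, forall x, cube x -> `|g x| <= B.
Proof.
move=> K'0 gNN; exists (K' + `|g 0|) => x cx; rewrite -[g x](subrK (g 0)).
rewrite (le_trans (ler_normD _ _))// lerD2r (le_trans (NN_lip _ _ K'0 gNN))//.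
rewrite subr0 -[leRHS]mulr1 ler_wpM2l//; apply: supn_le => // i.
by have /andP[h1 h2] := cx i; rewrite ger0_norm.
Qed.

Lemma NN_borel (g : 'cV[R]_d -> R) (L' : nat) (K' : R) : 0 <= K' -> NN W L'.+1 K' g ->
  measurable_fun setT (g : borelT R d -> R).
Proof. by move=> K'0 gNN; apply: (lip_borel K'0) => x y; exact: NN_lip gNN. Qed.

Lemma inf_advrisk_ge :
  ((risk f0)%:E <= ereal_inf [set advrisk P Xset X Y g eps | g in Hoelder r beta `|` NN W L.+1 K])%E.
Proof.
apply: le_ereal_inf_tmp => _ [g [gH|gN] <-].
  have [g' mg' gg'] := HoelderM gH.
  rewrite (@eq_advrisk g g') => [|x cx]; last by case: (gg' x cx).
  have g1 x : cube x -> `|g' x| <= 1 by move=> cx; case: (gg' x cx).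
  by apply: le_trans (advrisk_ge eps0 mg' g1); rewrite lee_fin (risk_ge mg' g1).
have [B gB] := NN_bounded (ltW K0) gN; have mg := NN_borel (ltW K0) gN.
by apply: le_trans (advrisk_ge eps0 mg gB); rewrite lee_fin (risk_ge mg gB).
Qed.

Lemma excess_le f : NN W L.+1 K f -> (forall x, cube x -> `|f x| <= M) ->
  (adv_excess P r beta W L.+1 K Xset X Y f eps
   <= (risk f - risk f0 + 2 * (M + 1) * (K * eps))%:E)%E.
Proof.
move=> fN fM; have fK x y := NN_lip x y (ltW K0) fN.
rewrite /adv_excess; apply: le_trans (leeB (advrisk_le eps0 (ltW K0) fM fK) inf_advrisk_ge) _.
by rewrite -EFinB lee_fin; lra.
Qed.

(** Required by [ge0_le_lower_integral] to bound the expected excess; the risk is finite, so the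
    difference is meaningful. *)
Lemma excess_ge0 f : NN W L.+1 K f -> (forall x, cube x -> `|f x| <= M) ->
  (0 <= adv_excess P r beta W L.+1 K Xset X Y f eps)%E.
Proof.
move=> fN fM; have fK x y := NN_lip x y (ltW K0) fN.
rewrite /adv_excess; have a1 := advrisk_le eps0 (ltW K0) fM fK.
have a2 := advrisk_ge eps0 (NN_borel (ltW K0) fN) fM.
have fin : advrisk P Xset X Y f eps \is a fin_num.
  by rewrite fin_numElt (lt_le_trans (ltNyr _) a2) (le_lt_trans a1 (ltry _)).
rewrite -(subee fin) leeB//; apply: ereal_inf_lbound; exists f => //; right; exact: fN.
Qed.

(** Free of [K] and [eps]: this covers the finitely many small [n]. *)
Lemma excess_trivial f : NN W L.+1 K f -> (forall x, cube x -> `|f x| <= M) ->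
  (adv_excess P r beta W L.+1 K Xset X Y f eps <= ((M + 1) ^+ 2)%:E)%E.
Proof.
move=> fN fM; rewrite /adv_excess.
have i0 : (0 <= ereal_inf [set advrisk P Xset X Y g eps | g in Hoelder r beta `|` NN W L.+1 K])%E.
  by apply: le_trans inf_advrisk_ge; rewrite lee_fin; apply: Rintegral_ge0 => z _; exact: sqloss_ge0.
have a1 : (advrisk P Xset X Y f eps <= ((M + 1) ^+ 2)%:E)%E.
  have -> : ((M + 1) ^+ 2)%:E = (\int[P]_z ((M + 1) ^+ 2)%:E)%E.
    have e := probability_setT P.
    by rewrite integral_cst// [X in (_ * X)%E]e mule1.
  apply: ge0_le_lower_integral => z; first exact: advloss_ge0.
  apply: ge_ereal_sup => _ [x [xX xe] <-]; rewrite lee_fin -[leLHS]ger0_norm ?sqr_ge0//.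
  by apply: sqr_le => //; exact/fM/Xcube.
by apply: le_trans (leeB a1 i0) _; rewrite sube0.
Qed.

Lemma mean_addC (a : 'I_n -> R) c :
  n%:R^-1 * \sum_i (a i + c) = n%:R^-1 * (\sum_i a i) + c.
Proof.
rewrite big_split sumr_const card_ord mulrDr -[c *+ n]mulr_natl mulrA mulVf ?mul1r//.
by rewrite gt_eqF// ltr0n.
Qed.

Section Sample.
Variables (zs : 'I_n -> D).

Definition emprisk (f : 'cV[R]_d -> R) : R := n%:R^-1 * \sum_i sqloss f (zs i).

Lemma emp_ge f : ((emprisk f)%:E <= emp_advrisk Xset X Y zs f eps)%E.
Proof.
rewrite /emp_advrisk /emprisk EFinM -sumEFin lee_wpmul2l ?lee_fin ?invr_ge0//.
by apply: lee_sum => i _; exact: advloss_ge.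
Qed.

Lemma emp_le f : NN W L.+1 K f -> (forall x, cube x -> `|f x| <= M) ->
  (emp_advrisk Xset X Y zs f eps <= (emprisk f + 2 * (M + 1) * (K * eps))%:E)%E.
Proof.
move=> fN fM; have fK x y := NN_lip x y (ltW K0) fN.
have -> : emprisk f + 2 * (M + 1) * (K * eps) =
    n%:R^-1 * \sum_i (sqloss f (zs i) + 2 * (M + 1) * (K * eps)).
  by rewrite mean_addC.
rewrite /emp_advrisk EFinM -sumEFin lee_wpmul2l ?lee_fin ?invr_ge0//.
by apply: lee_sum => i _; exact: advloss_le (ltW K0) fM fK.
Qed.

Lemma emprisk_near f g e : (forall x, cube x -> `|f x| <= M) -> (forall x, cube x -> `|g x| <= M) ->
  (forall x, cube x -> `|f x - g x| <= e) -> emprisk f <= emprisk g + 2 * (M + 1) * e.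
Proof.
move=> fM gM fg.
have -> : emprisk g + 2 * (M + 1) * e = n%:R^-1 * \sum_i (sqloss g (zs i) + 2 * (M + 1) * e).
  by rewrite mean_addC.
rewrite ler_wpM2l ?invr_ge0//; apply: ler_sum => i _.
by apply: sqr_diff_le => //; [exact/fM/Xcube|exact/gM/Xcube|exact/fg/Xcube].
Qed.

End Sample.

Lemma risk_near (f g : borelT R d -> R) e : measurable_fun setT f -> measurable_fun setT g ->
  (forall x, cube x -> `|f x| <= M) -> (forall x, cube x -> `|g x| <= M) ->
  (forall x, cube x -> `|f x - g x| <= e) -> risk f <= risk g + 2 * (M + 1) * e.
Proof.
move=> mf mg fM gM fg.
have [h1 h2] := Rintegral_affine 1 (2 * (M + 1) * e) (sqloss_integrable mg gM).
rewrite mul1r in h2; rewrite /risk -h2; apply: le_Rintegral => //.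
  exact: sqloss_integrable mf fM.
move=> z _; rewrite mul1r.
by apply: sqr_diff_le => //; [exact/fM/Xcube|exact/gM/Xcube|exact/fg/Xcube].
Qed.

Definition clipM (f : 'cV[R]_d -> R) x := Num.max (- M) (Num.min M (f x)).

Lemma clipM_le f x : 0 <= M -> `|clipM f x| <= M.
Proof. by move=> M0; rewrite ler_norml /clipM le_max lexx /= ge_max ge_min lexx andbT; lra. Qed.

(** Clipping to [[-M, M]] is a contraction that fixes [f x]. *)
Lemma clipM_near f g x e : `|f x| <= M -> `|f x - g x| <= e -> `|f x - clipM g x| <= e.
Proof.
rewrite !ler_norml /clipM => /andP[f1 f2] /andP[h1 h2].
have : (g x <= M /\ Num.min M (g x) = g x) \/ (M <= g x /\ Num.min M (g x) = M).
  by case: (lerP M (g x)) => h; [right|left; split=> //; exact: ltW].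
move: (Num.min M (g x)) => c hc.
have : (c <= - M /\ Num.max (- M) c = - M) \/ (- M <= c /\ Num.max (- M) c = c).
  by case: (lerP (- M) c) => h; [right|left; split=> //; exact: ltW].
move: (Num.max (- M) c) => e' he'.
by case: hc => -[? ?]; case: he' => -[? ?]; subst; lra.
Qed.

(** * Oracle inequality *)

Variables (q : nat) (phi : 'cV[R]_d -> R) (tau rho : R).
Hypothesis q0 : (0 < q)%N.
Hypothesis M0 : 0 <= M.
Hypothesis phiN : NN W L.+1 K phi.
Hypothesis phiM : forall x, cube x -> `|phi x| <= M.
Hypothesis phit : forall x, cube x -> `|phi x - f0 x| <= tau.
Hypothesis rho0 : 0 < rho.
Hypothesis rho1 : rho <= 3^-1.
Hypothesis entropy : ln (#|code d W L q|.+1)%:R <= n%:R * rho ^+ 2.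

(* [None] stands for the opposite of the comparison network, whose deviation is needed from
   above; the codes are clipped so that all losses are bounded. *)
Definition family (j : option (code d W L q)) (z : D) : R :=
  if j is Some c then sqloss (clipM (net_eval (decode K c))) z else - sqloss phi z.

Lemma decode_borel (c : code d W L q) :
  measurable_fun setT (net_eval (decode K c) : borelT R d -> R).
Proof.
apply: (@NN_borel _ L (net_normprod (decode K c))); last by exists (decode K c).
rewrite /net_normprod mulr_ge0 ?opnorm_ge0// mulr_ge0 ?le_max ?ler01 ?orbT//.
by apply: prodr_ge0 => i _; rewrite le_max ler01 orbT.
Qed.

Lemma clipM_borel f : measurable_fun setT (f : borelT R d -> R) ->
  measurable_fun setT (clipM f : borelT R d -> R).
Proof. by move=> mf; apply: measurable_maxr => //; exact: measurable_minr. Qed.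

Lemma family_measurable j : measurable_fun setT (family j).
Proof.
case: j => [c|] /=.
  by apply: measurable_sqloss; apply: clipM_borel; exact: decode_borel.
by apply: measurable_funN; apply: measurable_sqloss; exact: NN_borel (ltW K0) phiN.
Qed.

Lemma family_le j z : `|family j z| <= (M + 1) ^+ 2.
Proof.
case: j => [c|] /=; rewrite ?normrN; apply: sqr_le => //; first exact: clipM_le.
exact/phiM/Xcube.
Qed.

Context dO (Omega : measurableType dO) (Q : probability Omega R) (Z : 'I_n -> Omega -> D).
Hypothesis mZ : forall i, measurable_fun setT (Z i).
Hypothesis lawZ : forall i (A : set D), measurable A -> Q (Z i @^-1` A) = P A.
Hypothesis indZ : forall A : 'I_n -> set D, (forall i, measurable (A i)) ->
  Q (\bigcap_(i in [set: 'I_n]) (Z i @^-1` A i)) = (\prod_(i < n) fine (Q (Z i @^-1` A i)))%:E.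
Variable fhat : ('I_n -> D) -> 'cV[R]_d -> R.
Hypothesis fhatN : forall zs, NN W L.+1 K (fhat zs).
Hypothesis fhat_min : forall zs g, NN W L.+1 K g ->
  (emp_advrisk Xset X Y zs (fhat zs) eps <= emp_advrisk Xset X Y zs g eps)%E.
Hypothesis fhatM : forall zs x, cube x -> `|fhat zs x| <= M.

Lemma cover_fhat zs : exists c : code d W L q, forall x, cube x ->
  `|fhat zs x - clipM (net_eval (decode K c)) x| <= K * (d.+1 + L.+1 * W.+1)%:R / q%:R.
Proof.
have [N [Nn NK fN]] := NN_normalised (fhatN zs).
exists (encode q K N) => x cx; apply: clipM_near; first exact: fhatM.
rewrite fN; apply: decode_eval => //; apply: supn_le => // i.
by have /andP[h1 h2] := cx i; rewrite ger0_norm.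
Qed.

(** Every cost is paid twice: [G] for the estimator and for [phi], the rounding when leaving and
    when re-entering the true class, [K eps] in the population and in the sample. *)
Lemma oracle :
  (\int[Q]_w adv_excess P r beta W L.+1 K Xset X Y (fhat (fun i => Z i w)) eps
   <= (8 * (M + 1) ^+ 2 * rho + 4 / n%:R
       + 4 * (M + 1) * (K * (d.+1 + L.+1 * W.+1)%:R / q%:R)
       + 4 * (M + 1) * (K * eps) + tau ^+ 2)%:E)%E.
Proof.
pose B := (M + 1) ^+ 2; have B0 : 0 < B by rewrite exprn_gt0// ltr_wpDl.
(* Balances the two terms of [concentration]: under [entropy] both [ln #|J| / (n t)] and [4 t B^2]
   are at most [2 B rho]. *)
pose t := rho / (2 * B); have t0 : 0 < t by rewrite divr_gt0// mulr_gt0.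
have tB : t * (2 * B) <= 3^-1 by rewrite divfK// gt_eqF// mulr_gt0.
have J0 : (0 < #|{: option (code d W L q)}|)%N by rewrite card_option.
have [G [iG Gle GE]] := concentration n0 mZ lawZ indZ J0 family_measurable family_le t0 tB.
set delta := K * _ / _; set E := _ + tau ^+ 2.
pose b := 4 * (M + 1) * delta + 4 * (M + 1) * (K * eps) + tau ^+ 2.
have pw w : (adv_excess P r beta W L.+1 K Xset X Y (fhat (fun i => Z i w)) eps <= (2 * G w + b)%:E)%E.
  set zs := fun i => Z i w; apply: le_trans (excess_le (fhatN zs) (fhatM zs)) _.
  rewrite lee_fin; have [c cc] := cover_fhat zs; set fc := clipM _ in cc.
  have fcM x : cube x -> `|fc x| <= M by move=> _; exact: clipM_le.
  have mfc := clipM_borel (decode_borel c).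
  have cc' x : cube x -> `|fc x - fhat zs x| <= delta by move=> cx; rewrite distrC cc.
  have s1 := risk_near (NN_borel (ltW K0) (fhatN zs)) mfc (fhatM zs) fcM cc.
  have s2 : risk fc - emprisk zs fc <= G w by exact: (Gle w (Some c)).
  have s3 := emprisk_near zs fcM (fhatM zs) cc'.
  have s4 : emprisk zs (fhat zs) <= emprisk zs phi + 2 * (M + 1) * (K * eps).
    have := le_trans (emp_ge zs (fhat zs)) (le_trans (fhat_min zs phiN) (emp_le zs phiN phiM)).
    by rewrite lee_fin.
  have s5 : emprisk zs phi - risk phi <= G w.
    have := Gle w None; rewrite /= sumrN mulrN opprK addrC.
    suff -> : \int[P]_z (- sqloss phi z) = - risk phi by [].
    have [_ h] := Rintegral_affine (-1) 0 (sqloss_integrable (NN_borel (ltW K0) phiN) phiM).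
    rewrite addr0 mulN1r in h; rewrite /risk -h; apply: eq_Rintegral => z _.
    by rewrite addr0 mulN1r.
  have s6 := risk_le (NN_borel (ltW K0) phiN) phiM phit.
  rewrite /b; rewrite -/delta in s1 s3 *; lra.
have [iA eA] := Rintegral_affine 2 b iG.
apply: (@le_trans _ _ (\int[Q]_w (2 * G w + b)%:E)%E).
  by apply: ge0_le_lower_integral => w //; exact: excess_ge0 (fhatN _) (fhatM _).
have -> : (\int[Q]_w (2 * G w + b)%:E = (2 * (\int[Q]_w G w) + b)%:E)%E.
  by rewrite -eA /Rintegral fineK//; exact: integrable_fin_num.
have cJ : #|{: option (code d W L q)}| = #|code d W L q|.+1 by exact: card_option.
have H1 : ln (#|code d W L q|.+1)%:R / (n%:R * t) <= 2 * B * rho.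
  have nt : 0 < n%:R * t by rewrite mulr_gt0 ?ltr0n.
  rewrite ler_pdivrMr//; apply: le_trans entropy _.
  rewrite /t (_ : 2 * B * rho * (n%:R * (rho / (2 * B))) = n%:R * rho ^+ 2)//.
  by field; rewrite gt_eqF.
have H2 : 4 * t * B ^+ 2 = 2 * B * rho by rewrite /t; field; rewrite gt_eqF.
rewrite lee_fin /E /b; have : 4 / n%:R = 2 * (2 / n%:R) :> R by lra.
rewrite -/B; move: GE H1; rewrite [X in ln X%:R]cJ H2; lra.
Qed.

End Risk.

(** * Rates *)

Section Rates.
Variable R : realType.
Implicit Types (a b x : R) (n g : nat).

Lemma powR_large a b : 0 < a -> exists n0, forall n, (n0 <= n)%N -> b <= n%:R `^ a.
Proof.
move=> a0; have [b0|b0] := lerP b 0.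
  by exists 0%N => n _; rewrite (le_trans b0)// powR_ge0.
exists (Num.truncn (b `^ a^-1)).+1 => n nn.
have -> : b = (b `^ a^-1) `^ a by rewrite -powRrM mulVf ?powRr1 ?gt_eqF// ltW.
rewrite ge0_ler_powR ?nnegrE ?powR_ge0// ?ltW//.
have /andP[_ h] := truncn_itv (powR_ge0 b a^-1).
by apply: lt_le_trans h _; rewrite ler_nat.
Qed.

Lemma ln_le_powR a x : 0 < a -> 1 <= x -> ln x <= x `^ a / a.
Proof.
move=> a0 x1; rewrite ler_pdivlMr// mulrC -ln_powR ltW//.
by apply: ln_sublinear; rewrite powR_gt0// (lt_le_trans _ x1).
Qed.

(** Half of the exponent absorbs the logarithms, the other half the constant. *)
Lemma powR_lnX a b g : 0 < a -> 0 <= b ->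
  exists n0, forall n, (n0 <= n)%N -> b * ln n%:R ^+ g <= n%:R `^ a.
Proof.
move=> a0 b0; pose s := a / (2 * g.+1%:R).
have s0 : 0 < s by rewrite divr_gt0// mulr_gt0.
have a2 : 0 < a / 2 by rewrite divr_gt0.
have [n0 Hn] := powR_large (b / s ^+ g) a2.
exists (maxn 1 n0) => n; rewrite geq_max => /andP[n1 nn].
have n1' : 1 <= n%:R :> R by rewrite ler1n.
have l0 : 0 <= ln n%:R :> R by rewrite ln_ge0.
apply: (@le_trans _ _ (b * (n%:R `^ (a / 2) / s ^+ g))).
  rewrite ler_wpM2l// (@le_trans _ _ ((n%:R `^ s / s) ^+ g))//.
    have qs : 0 <= n%:R `^ s / s by rewrite divr_ge0 ?powR_ge0 ?(ltW s0).
    by rewrite lerXn2r ?nnegrE// ln_le_powR.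
  rewrite exprMn exprVn ler_wpM2r ?invr_ge0 ?exprn_ge0 ?(ltW s0)//.
  rewrite -powR_mulrn ?powR_ge0// -powRrM ler_powR//.
  have -> : s * g%:R = a / 2 * (g%:R / g.+1%:R).
    by rewrite /s; field; rewrite nat1r pnatr_eq0.
  by rewrite ler_piMr ?(ltW a2)// ler_pdivrMr// mul1r ler_nat.
have -> : n%:R `^ a = n%:R `^ (a / 2) * n%:R `^ (a / 2).
  rewrite -powRD; first by congr (_ `^ _); field.
  by apply/implyP => _; rewrite gt_eqF// (lt_le_trans _ n1').
by rewrite mulrCA ler_wpM2l ?powR_ge0//; exact: Hn.
Qed.

End Rates.

(** * Approximation error as a power of [K] *)

Section ApproxRate.
Variables (R : realType) (d r g : nat) (beta : R).
Hypothesis beta0 : 0 < beta.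
Hypothesis dr : (d + r <= 2 ^ g)%N.
Let alpha : R := r%:R + beta.

Let cr : R := r.+1%:R * 2 ^+ r.
(** The constants of [NN_approx] after [N + 1 <= 2N], [2N + 1 <= 3N] and [k <= 2 N^(alpha/2)]; the
    denominator of [errC] reflects [N >= T / (2 normC)], where [T] is the root of order [d + 1] of
    [K / (ln K)^g]. *)
Definition normC : R := 6 * (2 * cr) ^+ d * (3 * 14 ^+ g).
Definition widthC : R := (2 * r.+1%:R) ^+ d * 2 ^+ g * 12.
Definition errC : R :=
  (taylor_interpC R r d * 2 `^ alpha + (3 * cr) ^+ d * 2 ^+ g) / (normC^-1 / 2) `^ alpha.

Let cr1 : 1 <= cr.
Proof. by rewrite /cr mulr_ege1// ?ler1n// exprn_ege1// ler1n. Qed.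

Let cr0 : 0 <= cr. Proof. exact: le_trans cr1. Qed.

Lemma normC_ge1 : 1 <= normC.
Proof.
rewrite /normC mulr_ege1//; last by rewrite mulr_ege1// ?ler1n// exprn_ege1// ler1n.
by rewrite mulr_ege1// ?ler1n// exprn_ege1// mulr_ege1// ler1n.
Qed.

Lemma widthC_gt0 : 0 < widthC.
Proof. by rewrite /widthC !mulr_gt0 ?exprn_gt0. Qed.

Lemma errC_ge0 : 0 <= errC.
Proof.
rewrite /errC divr_ge0 ?powR_ge0// addr_ge0// mulr_ge0 ?powR_ge0 ?exprn_ge0//.
  exact: taylor_interpC_ge0.
by rewrite mulr_ge0.
Qed.

Lemma approx_rate f W L (K : R) : Hoelder_ext r beta f -> (g <= L)%N -> 1 <= ln K ->
  2 * normC <= (K / ln K ^+ g) `^ (d.+1)%:R^-1 ->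
  widthC * (K / ln K ^+ g) `^ ((2 * d%:R + alpha) / (2 * d%:R + 2)) <= W%:R ->
  exists2 phi : 'cV[R]_d -> R, NN W L.+1 K phi & forall x, cube x ->
    `|phi x - f x| <= errC * (K / ln K ^+ g) `^ (- (alpha / (d.+1)%:R)).
Proof.
move=> fH gL lK; set x := K / ln K ^+ g; set T := x `^ _ => TC WC.
have K0 : 0 < K by rewrite ltNge; apply/negP => K0; rewrite ln0// ler10 in lK.
have l1 : 1 <= ln K ^+ g by rewrite exprn_ege1.
have x0 : 0 < x by rewrite divr_gt0// (lt_le_trans _ l1).
have xK : x <= K by rewrite ler_pdivrMr ?(lt_le_trans _ l1)// ler_peMr// ltW.
have nC1 := normC_ge1; have nC0 : 0 < normC by apply: lt_le_trans nC1.
have T0 : 0 < T by rewrite powR_gt0.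
have alpha0 : 0 < alpha by rewrite /alpha ltr_wpDl.
pose y := T / normC; have y2 : 2 <= y by rewrite ler_pdivlMr.
have y0 : 0 <= y by apply: le_trans y2.
pose N := Num.truncn y; have /andP[Ny yN] := truncn_itv y0; rewrite -/N in Ny yN.
have N0 : (0 < N)%N.
  by rewrite lt0n; apply/eqP => e; move: yN; rewrite e => /(le_lt_trans y2); rewrite ltr_nat.
have Np : 0 < N%:R :> R by rewrite ltr0n.
have N1 : 1 <= N%:R :> R by rewrite ler1n.
have yT : y <= T by rewrite ler_pdivrMr// ler_peMr// ltW.
have TX : T ^+ d.+1 = x.
  by rewrite -powR_mulrn ?ltW// /T -powRrM mulVf// powRr1// ltW.
(* [k] just above [p] makes the product error [k^-2] at most [N^-alpha]. *)
pose p := N%:R `^ (alpha / 2).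
have p1 : 1 <= p by rewrite -(powRr0 N%:R) ler_powR// divr_ge0// ltW.
pose k := (Num.truncn p).+1.
have /andP[kp pk] := truncn_itv (le_trans ler01 p1); rewrite -/k in pk.
have k2 : k%:R <= 2 * p by rewrite /k -natr1 mulr_natl mulr2n lerD.
have p2 : p ^+ 2 = N%:R `^ alpha.
  by rewrite -powR_mulrn ?powR_ge0// -powRrM; congr (_ `^ _); field.
have NS : N.+1%:R <= 2 * N%:R :> R by rewrite -natr1 mulr_natl mulr2n lerD2l.
have [||phi phiN phiE] := @NN_approx R d r beta f beta0 fH N N0 g k W L K isT dr gL.
- rewrite -(ler_nat R) (le_trans _ WC)//.
  apply: (@le_trans _ _ (widthC * (N%:R ^+ d * p))).
    rewrite -muln2 !natrM !natrX natrM.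
    have -> : widthC * (N%:R ^+ d * p) =
      ((2 * N%:R * r.+1%:R) ^+ d * 2 ^+ g) * (3 * (2 * p * 2)).
      by rewrite /widthC !exprMn; ring.
    apply: ler_pM; rewrite ?mulr_ge0 ?exprn_ge0// ?mulr_ge0//.
      by rewrite ler_wpM2r ?exprn_ge0// lerXn2r ?nnegrE ?mulr_ge0// ler_wpM2r.
    by rewrite ler_wpM2l// ler_wpM2r.
  rewrite ler_wpM2l ?(ltW widthC_gt0)//.
  have -> : N%:R ^+ d * p = N%:R `^ (d%:R + alpha / 2).
    rewrite powRD ?powR_mulrn//; apply/implyP => _; exact: lt0r_neq0.
  have -> : x `^ ((2 * d%:R + alpha) / (2 * d%:R + 2)) = T `^ (d%:R + alpha / 2).
    rewrite /T -powRrM; congr (_ `^ _); rewrite -natr1; field.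
    by rewrite nat1r pnatr_eq0 /= gt_eqF// ltr_wpDl// mulr_ge0.
  rewrite ge0_ler_powR ?nnegrE ?(ltW T0)//; first by rewrite addr_ge0// divr_ge0// ltW.
  exact: le_trans Ny yT.
- apply: le_trans xK; rewrite -TX.
  apply: (@le_trans _ _ (normC * N%:R ^+ d.+1)).
    have -> : normC * N%:R ^+ d.+1 = 6 * (2 * N%:R * cr) ^+ d * (3 * N%:R * 14 ^+ g).
      by rewrite /normC exprS !exprMn; ring.
    rewrite -/cr; apply: ler_pM; rewrite ?mulr_ge0 ?exprn_ge0 ?addr_ge0 ?mulr_ge0//.
      by rewrite ler_wpM2l// lerXn2r ?nnegrE ?mulr_ge0// ler_wpM2r.
    by rewrite ler_wpM2r ?exprn_ge0//; lra.
  rewrite (@le_trans _ _ (normC * y ^+ d.+1))//.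
    by rewrite ler_wpM2l ?(ltW nC0)// lerXn2r ?nnegrE.
  have nn : normC != 0 by exact: lt0r_neq0.
  have -> : normC * y ^+ d.+1 = T ^+ d.+1 * (normC ^+ d)^-1.
    by rewrite /y exprMn exprVn [normC ^+ d.+1]exprS; field; rewrite ?expf_neq0 ?nn.
  by rewrite ler_piMr ?exprn_ge0 ?(ltW T0)// invf_le1 ?exprn_gt0// exprn_ege1.
exists phi => // z cz; apply: le_trans (phiE z cz) _.
have -> : x `^ (- (alpha / d.+1%:R)) = (T `^ alpha)^-1.
  by rewrite powRN /T -powRrM; congr (_ `^ _)^-1; rewrite mulrC.
have NaT : (normC^-1 / 2 * T) `^ alpha <= N%:R `^ alpha.
  rewrite ge0_ler_powR ?nnegrE ?(ltW alpha0)//.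
    by rewrite mulr_ge0 ?divr_ge0 ?invr_ge0 ?(ltW nC0) ?(ltW T0).
  have -> : normC^-1 / 2 * T = y / 2 by rewrite /y; ring.
  rewrite ler_pdivrMr// mulrC; apply: le_trans (ltW yN) _; exact: NS.
have h0 : 0 < (normC^-1 / 2) `^ alpha by rewrite powR_gt0// divr_gt0// invr_gt0.
have h1 : 0 <= normC^-1 / 2 by rewrite divr_ge0 ?invr_ge0 ?(ltW nC0).
rewrite /errC -[leRHS]mulrA -invfM -powRM ?(ltW T0)//.
apply: (@le_trans _ _ ((taylor_interpC R r d * 2 `^ alpha + (3 * cr) ^+ d * 2 ^+ g)
  / N%:R `^ alpha)); last first.
  rewrite ler_wpM2l//.
    rewrite addr_ge0// mulr_ge0 ?powR_ge0 ?exprn_ge0 ?mulr_ge0//; exact: taylor_interpC_ge0.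
  by rewrite lef_pV2 ?posrE ?powR_gt0// mulr_gt0// divr_gt0// invr_gt0.
rewrite [leRHS]mulrDl; apply: lerD.
  rewrite -mulrA ler_wpM2l ?taylor_interpC_ge0//.
  have h2 : 0 < 2 / N%:R :> R by rewrite divr_gt0.
  rewrite -powR_mulrn ?(ltW h2)// -powRD; last by apply/implyP => _; exact: lt0r_neq0.
  by rewrite -/alpha powRM ?invr_ge0// -powR_inv1// -powRrM mulN1r powRN.
rewrite -mulrA natrX ler_wpM2l ?exprn_ge0 ?mulr_ge0// ler_wpM2l ?exprn_ge0//.
rewrite -p2 lef_pV2 ?posrE ?exprn_gt0 ?(lt_le_trans _ p1)//.
by rewrite lerXn2r ?nnegrE ?(le_trans _ p1)// ltW.
Qed.

End ApproxRate.

Lemma mul_succ_le W L : (0 < W)%N -> (L.+1 * W.+1 <= 2 * (W * L.+1))%N.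
Proof. by move=> W0; rewrite mulnA [leqRHS]mulnC leq_mul2l /= mul2n -addnn -addn1 leq_add2l. Qed.

Lemma mul_sqr_le W L : (L.+1 * W ^ 2 <= (W * L.+1) ^ 2)%N.
Proof. by rewrite expnMn mulnC leq_mul2l -mulnn leq_pmulr// orbT. Qed.

Lemma double_succ_le q : (0 < q)%N -> (q.*2.+1 <= 3 * q)%N.
Proof. by case: q => // q _; rewrite -addnn; lia. Qed.

(** * Choice of the parameters as functions of [n] *)

Section Constants.
Variables (R : realType) (d r g : nat) (beta c1 c2 c4 : R).
Hypothesis d0 : (0 < d)%N.
Let alpha : R := r%:R + beta.
Hypothesis beta01 : 0 < beta <= 1.
Hypothesis alpha1 : 1 <= alpha.
Hypothesis c1_gt0 : 0 < c1.
Hypothesis c2_gt0 : 0 < c2.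
Hypothesis c4_gt0 : 0 < c4.

Let lambda : R := Num.max 1 (2 * g%:R * alpha / d.+1%:R).
Let A : R := 2 * d%:R + 5 * alpha.
Let kappa : R := d.+1%:R / A.
Let omega : R := (2 * d%:R + alpha) / (4 * d%:R + 10 * alpha).
Let expo : R := (2 * alpha) / A.

Let A0 : 0 < A.
Proof. by rewrite /A ltr_wpDl ?mulr_ge0 ?mulr_gt0 ?(lt_le_trans _ alpha1). Qed.

Let alpha0 : 0 < alpha. Proof. exact: lt_le_trans alpha1. Qed.

Let kappa0 : 0 < kappa. Proof. by rewrite /kappa divr_gt0. Qed.

Let kappa_le1 : kappa <= 1.
Proof.
rewrite /kappa ler_pdivrMr// mul1r /A -natr1; have := alpha1.
by have : 0 <= d%:R :> R by []; lra.
Qed.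

Let omega_le1 : omega <= 1.
Proof.
have x0 : 0 <= d%:R :> R by [].
by rewrite /omega ler_pdivrMr; move: alpha1; move: (d%:R : R) x0 => x; lra.
Qed.

Let expo0 : 0 < expo. Proof. by rewrite /expo divr_gt0// mulr_gt0. Qed.

Let expo_le1 : expo <= 1.
Proof.
have x0 : 0 <= d%:R :> R by [].
by rewrite /expo ler_pdivrMr// mul1r /A; move: alpha1; move: (d%:R : R) x0 => x; lra.
Qed.

(** So [(W L)^2 / n] is of order [n^(-2 expo)]: its square root, the deviation, has the same power
    of [n] as [tau^2]. *)
Let omegaE : 2 * omega = 1 - 2 * expo.
Proof.
have Ax : 4 * d%:R + 10 * alpha = 2 * A by rewrite /A; ring.
rewrite /omega /expo Ax; have := A0 => /lt0r_neq0 An.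
have -> : 2 * d%:R + alpha = A - 4 * alpha by rewrite /A; ring.
by field.
Qed.

(** Chosen for [cover_le]: [K <= c2 n], and the layer sizes in [decode_eval] total at most
    [(d + 1 + 2 c4) n], so the mesh [1/(q0 n^3)] brings the rounding error below [1/n]. *)
Let q0 := (Num.truncn (c2 * (d.+1%:R + 2 * c4))).+1.
Let entC : R := 2 * d.+2%:R * c4 ^+ 2 * (ln (3 * q0%:R) + 3).
Let rhoC : R := entC + 1.
Let lnC : R := `|ln c2| + kappa.
Let tauC : R :=
  errC d r g beta ^+ 2 * c1 `^ (- (2 * alpha / d.+1%:R)) * lnC `^ (2 * g%:R * alpha / d.+1%:R).

Let q30 : 0 <= ln (3 * q0%:R) :> R.
Proof. by rewrite ln_ge0// mulr_ege1// ler1n. Qed.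

Let entC0 : 0 <= entC.
Proof. by rewrite /entC mulr_ge0 ?addr_ge0// mulr_ge0 ?sqr_ge0. Qed.

Section AtN.
Variables (n W L : nat) (K : R).
Hypothesis n0 : (0 < n)%N.
Hypothesis ln1 : 1 <= ln n%:R :> R.
Hypothesis W0 : (0 < W)%N.
Hypothesis K1 : c1 * n%:R `^ kappa <= K.
Hypothesis K2 : K <= c2 * n%:R `^ kappa.
Hypothesis WL : (W * L.+1)%:R <= c4 * n%:R `^ omega.

Let nu : R := n%:R `^ (- expo).
Let Lam : R := ln n%:R `^ lambda.
Definition rhoN : R := rhoC * (nu * ln n%:R).

Let n1 : 1 <= n%:R :> R. Proof. by rewrite ler1n. Qed.

Let np : 0 < n%:R :> R. Proof. exact: lt_le_trans n1. Qed.

Let nn : n%:R != 0 :> R. Proof. exact: lt0r_neq0. Qed.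

Lemma lnC_ge1 : 1 <= ln K -> ln K <= lnC * ln n%:R.
Proof.
move=> lK; have K0 : 0 < K by apply: lt_le_trans K1; rewrite mulr_gt0 ?powR_gt0.
rewrite (@le_trans _ _ (ln (c2 * n%:R `^ kappa)))//.
  by rewrite ler_ln ?posrE// mulr_gt0 ?powR_gt0.
rewrite lnM ?posrE ?powR_gt0// ln_powR /lnC mulrDl lerD2r (le_trans (ler_norm _))//.
by rewrite ler_peMr.
Qed.

Lemma cover_le : K * (d.+1 + L.+1 * W.+1)%:R / (q0 * n ^ 3)%:R <= n%:R^-1.
Proof.
have Kn : K <= c2 * n%:R.
  rewrite (le_trans K2)// ler_wpM2l ?(ltW c2_gt0)// -[leRHS]powRr1 ?ler_powR//.
have LWn : (d.+1 + L.+1 * W.+1)%:R <= (d.+1%:R + 2 * c4) * n%:R :> R.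
  apply: (@le_trans _ _ (d.+1%:R + 2 * (W * L.+1)%:R)).
    by rewrite -(natrM R 2) -natrD ler_nat leq_add2l mul_succ_le.
  rewrite [leRHS]mulrDl; apply: lerD; first by rewrite ler_peMr.
  rewrite -[leRHS]mulrA ler_wpM2l// (le_trans WL)//.
  rewrite ler_wpM2l ?(ltW c4_gt0)// -[leRHS]powRr1 ?ler_powR//.
have q0c : c2 * (d.+1%:R + 2 * c4) <= q0%:R.
  have h : 0 <= c2 * (d.+1%:R + 2 * c4) by rewrite mulr_ge0 ?addr_ge0 ?mulr_ge0// ltW.
  by have /andP[_ /ltW] := truncn_itv h.
rewrite natrM natrX ler_pdivrMr; last by rewrite mulr_gt0 ?exprn_gt0 ?ltr0n.
rewrite (_ : n%:R^-1 * (q0%:R * n%:R ^+ 3) = q0%:R * n%:R ^+ 2); last by field.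
apply: (@le_trans _ _ (c2 * n%:R * ((d.+1%:R + 2 * c4) * n%:R))).
  by apply: ler_pM => //; apply: le_trans K1; rewrite mulr_ge0 ?powR_ge0// ltW.
by rewrite (_ : c2 * _ * _ = c2 * (d.+1%:R + 2 * c4) * n%:R ^+ 2)?ler_wpM2r ?exprn_ge0//; ring.
Qed.

(** There are at most [(d + 2) (W (L + 1))^2] parameters, and the logarithm of the number of levels
    is [O(ln n)] because [q] is polynomial in [n]. *)
Lemma entropy_le : ln (#|code d W L (q0 * n ^ 3)|.+1)%:R <= n%:R * rhoN ^+ 2.
Proof.
set q := (q0 * n ^ 3)%N; set p := (d.+2 * L.+1 * W ^ 2)%N.
have q1 : (0 < q)%N by rewrite muln_gt0 expn_gt0 n0.
have p1 : (0 < p)%N by rewrite /p !muln_gt0 ?expn_gt0 W0.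
(* Doubling the exponent makes room for the comparison network. *)
have cs : (#|code d W L q|.+1 <= q.*2.+1 ^ (2 * p))%N.
  apply: (@leq_trans (q.*2.+1 ^ p).+1); first by rewrite ltnS card_code_le.
  apply: (@leq_trans (q.*2.+1 ^ p.+1)); last by rewrite leq_pexp2l// mul2n -addnn -addn1 leq_add2l.
  by rewrite expnS mulSn -[(_ ^ p).+1]addn1 leq_add2l muln_gt0 double_gt0 q1 expn_gt0.
have s1 : ln (q.*2.+1)%:R <= (ln (3 * q0%:R) + 3) * ln n%:R :> R.
  apply: (@le_trans _ _ (ln (3 * q0%:R * n%:R ^+ 3))).
    rewrite ler_ln ?posrE ?mulr_gt0 ?exprn_gt0 ?ltr0n//.
    by rewrite -mulrA -natrX -natrM -natrM ler_nat double_succ_le.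
  have a0 : 0 < 3 * q0%:R :> R by rewrite mulr_gt0// ltr0n.
  have b0 : 0 < n%:R ^+ 3 :> R by rewrite exprn_gt0.
  rewrite [ln (_ * _ ^+ _)]lnM ?posrE// lnXn// [leRHS]mulrDl.
  by apply: lerD; [rewrite ler_peMr|rewrite mulr_natl].
have pW : p%:R <= d.+2%:R * (c4 * n%:R `^ omega) ^+ 2 :> R.
  apply: (@le_trans _ _ (d.+2%:R * (W * L.+1)%:R ^+ 2)).
    by rewrite -natrX -natrM ler_nat /p -mulnA leq_mul2l mul_sqr_le orbT.
  by rewrite ler_wpM2l// lerXn2r ?nnegrE ?mulr_ge0 ?powR_ge0 ?(ltW c4_gt0).
apply: (@le_trans _ _ (2 * p%:R * ((ln (3 * q0%:R) + 3) * ln n%:R))).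
  apply: (@le_trans _ _ (ln ((q.*2.+1)%:R ^+ (2 * p)))).
    by rewrite -natrX ler_ln ?posrE ?ltr0n ?expn_gt0// ler_nat.
  by rewrite lnXn ?ltr0n// -[leLHS]mulr_natl natrM ler_wpM2l// mulr_ge0.
apply: (@le_trans _ _ (entC * (n%:R `^ omega) ^+ 2 * ln n%:R)).
  rewrite mulrA ler_wpM2r ?(le_trans ler01)//.
  have -> : entC * (n%:R `^ omega) ^+ 2 =
     2 * (d.+2%:R * (c4 * n%:R `^ omega) ^+ 2) * (ln (3 * q0%:R) + 3).
    by rewrite /entC exprMn; ring.
  by rewrite ler_wpM2r ?addr_ge0// ler_wpM2l.
have -> : n%:R * rhoN ^+ 2 = rhoC ^+ 2 * (n%:R `^ omega) ^+ 2 * ln n%:R ^+ 2.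
  rewrite /rhoN !exprMn; have <- : n%:R * nu ^+ 2 = (n%:R `^ omega) ^+ 2; last by ring.
  rewrite /nu -!powR_mulrn ?powR_ge0// -!powRrM -{1}[n%:R]powRr1// -powRD ?nn ?implybT//.
  by congr (_ `^ _); have := omegaE; lra.
(* The square of [rhoN] has one more factor [ln n] than the entropy. *)
rewrite [ln n%:R ^+ 2]expr2 mulrA ler_wpM2r ?(le_trans ler01)//.
apply: (@le_trans _ _ (rhoC ^+ 2 * (n%:R `^ omega) ^+ 2)).
  rewrite ler_wpM2r ?exprn_ge0 ?powR_ge0//.
  by rewrite /rhoC; move: entC0; set e := entC => e0; nra.
by rewrite ler_peMr// mulr_ge0 ?sqr_ge0.
Qed.

Lemma Lam_ge : ln n%:R <= Lam.
Proof.
by rewrite -{1}[ln _]powRr1 ?(le_trans ler01)// ler_powR// le_max lexx.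
Qed.

(** [K^(-2 alpha/(d+1))] is of order [n^(-expo)], and the power [2 g alpha/(d+1)] of [ln K] is the
    second entry in the maximum [lambda]; the first one serves the [ln n] of the deviation
    ([Lam_ge]). *)
Lemma tau_le : 1 <= ln K ->
  (errC d r g beta * (K / ln K ^+ g) `^ (- (alpha / d.+1%:R))) ^+ 2 <= tauC * (nu * Lam).
Proof.
move=> lK; have K0 : 0 < K by apply: lt_le_trans K1; rewrite mulr_gt0 ?powR_gt0.
have l0 : 0 < ln K by apply: lt_le_trans lK.
set s := 2 * alpha / d.+1%:R.
have s0 : 0 <= s by rewrite divr_ge0// mulr_ge0// ltW.
have lg0 : 0 < ln K ^+ g by rewrite exprn_gt0.
have e1 : ((K / ln K ^+ g) `^ (- (alpha / d.+1%:R))) ^+ 2 =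
    K `^ (- s) * ln K `^ (2 * g%:R * alpha / d.+1%:R).
  rewrite -powR_mulrn ?powR_ge0// -powRrM.
  have -> : - (alpha / d.+1%:R) * 2%:R = - s by rewrite /s; ring.
  rewrite powRM ?invr_ge0 ?(ltW K0) ?(ltW lg0)//; congr (_ * _).
  rewrite -powR_inv1 ?(ltW lg0)// -powRrM mulN1r opprK -powR_mulrn ?(ltW l0)// -powRrM.
  by congr (_ `^ _); rewrite /s; ring.
set e := 2 * g%:R * alpha / d.+1%:R in e1.
have e0 : 0 <= e by rewrite /e divr_ge0// !mulr_ge0// ltW.
have -> : tauC * (nu * Lam) = errC d r g beta ^+ 2 * (c1 `^ (- s) * nu * (lnC `^ e * Lam)).
  by rewrite /tauC; ring.
rewrite exprMn e1 ler_wpM2l ?sqr_ge0//.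
apply: ler_pM; rewrite ?powR_ge0//.
  have -> : nu = (n%:R `^ kappa) `^ (- s).
    rewrite /nu -powRrM; congr (_ `^ _); rewrite /kappa /s /expo; field.
    by rewrite nat1r pnatr_eq0 /= lt0r_neq0.
  rewrite -powRM ?powR_ge0 ?(ltW c1_gt0)// !powRN lef_pV2 ?posrE ?powR_gt0 ?mulr_gt0 ?powR_gt0//.
  have cn : 0 <= c1 * n%:R `^ kappa by rewrite mulr_ge0 ?powR_ge0 ?(ltW c1_gt0).
  by apply: ge0_ler_powR => //; rewrite nnegrE// ltW.
apply: (@le_trans _ _ ((lnC * ln n%:R) `^ e)).
  have h := lnC_ge1 lK.
  by rewrite ge0_ler_powR ?nnegrE ?(ltW l0)// (le_trans (ltW l0)).
have lC0 : 0 <= lnC by rewrite /lnC addr_ge0// ltW.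
rewrite powRM ?(le_trans ler01 ln1)// ler_wpM2l ?powR_ge0// ler_powR//.
by rewrite /lambda le_max /e lexx orbT.
Qed.

End AtN.

Lemma eventually_large : exists m, forall n K, (m <= n)%N -> c1 * n%:R `^ kappa <= K ->
  K <= c2 * n%:R `^ kappa ->
  [/\ 1 <= ln n%:R :> R, 1 <= ln K, rhoN n <= 3^-1 &
      2 * normC R d r g <= (K / ln K ^+ g) `^ (d.+1)%:R^-1].
Proof.
have nC0 : 0 < normC R d r g by apply: lt_le_trans (normC_ge1 R d r g).
pose m1 := (Num.truncn (expR (1 : R))).+1.
have e1 : 0 <= expR 1 / c1 by rewrite divr_ge0 ?expR_ge0// ltW.
have [m2 H2] := powR_lnX 0 kappa0 e1.
have rC : 0 <= 3 * rhoC by rewrite mulr_ge0// addr_ge0.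
have [m3 H3] := powR_lnX 1 expo0 rC.
have lC0 : 0 <= lnC by rewrite /lnC addr_ge0// ltW.
have b4 : 0 <= (2 * normC R d r g) ^+ d.+1 * lnC ^+ g / c1.
  by rewrite divr_ge0 ?(ltW c1_gt0)// mulr_ge0 ?exprn_ge0// mulr_ge0// ltW.
have [m4 H4] := powR_lnX g kappa0 b4.
exists (m1 + m2 + m3 + m4)%N => n K mn K1 K2.
have n1 : (0 < n)%N by apply: leq_trans mn; rewrite !addSn.
have np : 0 < n%:R :> R by rewrite ltr0n.
have lnn : 1 <= ln n%:R :> R.
  rewrite -[leLHS]expRK ler_ln ?posrE ?expR_gt0//.
  have /andP[_ /ltW h] := truncn_itv (expR_ge0 (1 : R)).
  by apply: le_trans h _; rewrite ler_nat (leq_trans _ mn)// -!addnA leq_addr.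
have K0 : 0 < K by apply: lt_le_trans K1; rewrite mulr_gt0 ?powR_gt0.
have lK : 1 <= ln K.
  rewrite -[leLHS]expRK ler_ln ?posrE ?expR_gt0// (le_trans _ K1)//.
  have := H2 n; rewrite expr0 mulr1 ler_pdivrMr// mulrC; apply.
  by apply: leq_trans mn; rewrite -!addnA addnCA leq_addr.
split=> //.
  have /H3 : (m3 <= n)%N by apply: leq_trans mn; rewrite -addnA addnCA leq_addr.
  rewrite expr1 /rhoN powRN => h; rewrite -(ler_pM2l (ltr0Sn R 2)) mulfV//.
  have -> : 3 * (rhoC * ((n%:R `^ expo)^-1 * ln n%:R)) = 3 * rhoC * ln n%:R / n%:R `^ expo by ring.
  by rewrite ler_pdivrMr ?powR_gt0// mul1r.
have lg0 : 0 < ln K ^+ g by rewrite exprn_gt0// (lt_le_trans _ lK).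
have c0 : 0 <= 2 * normC R d r g by rewrite mulr_ge0// ltW.
have e2 : 2 * normC R d r g = ((2 * normC R d r g) ^+ d.+1) `^ d.+1%:R^-1.
  by rewrite -powR_mulrn// -powRrM mulfV// powRr1.
rewrite e2; apply: ge0_ler_powR.
- by rewrite invr_ge0.
- by rewrite nnegrE exprn_ge0.
- by rewrite nnegrE divr_ge0 ?(ltW K0) ?(ltW lg0).
rewrite ler_pdivlMr// (le_trans _ K1)// mulrC.
have /H4 : (m4 <= n)%N by apply: leq_trans mn; rewrite leq_addl.
rewrite mulrAC ler_pdivrMr// [leRHS]mulrC => h; apply: le_trans h.
rewrite mulrC -mulrA ler_wpM2l ?exprn_ge0// -exprMn.
have h := lnC_ge1 n1 lnn K1 K2 lK.
by rewrite lerXn2r ?nnegrE ?(le_trans _ lK)// (le_trans _ h)// (le_trans _ lK).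
Qed.

Let nu (n : nat) : R := n%:R `^ (- expo).
Let Lam (n : nat) : R := ln n%:R `^ lambda.

Let tauC0 : 0 <= tauC.
Proof. by apply: mulr_ge0; [apply: mulr_ge0|]; rewrite ?sqr_ge0 ?powR_ge0. Qed.

Definition rateC (M : R) : R :=
  8 * (M + 1) ^+ 2 * rhoC + 4 + 4 * (M + 1) + 4 * (M + 1) * c2 + tauC.

Lemma rateC_gt0 (M : R) : 0 <= M -> 0 < rateC M.
Proof.
move=> M0; have M1 : 0 <= M + 1 by rewrite addr_ge0.
have r0 : 0 <= rhoC by rewrite addr_ge0.
have h1 : 0 <= 8 * (M + 1) ^+ 2 * rhoC by rewrite mulr_ge0// mulr_ge0 ?sqr_ge0.
have h2 : 0 <= 4 * (M + 1) * c2 by rewrite mulr_ge0 ?(ltW c2_gt0)// mulr_ge0.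
rewrite /rateC; move: tauC0 h1 h2; set t := tauC; set u := 8 * _ * _; set v := _ * c2.
by lra.
Qed.

Lemma large_n_rate : exists m, forall (n W L : nat) (K : R), (m <= n)%N -> (0 < W)%N ->
  c1 * n%:R `^ kappa <= K -> K <= c2 * n%:R `^ kappa ->
  (W * L.+1)%:R <= c4 * n%:R `^ omega ->
  let tau := errC d r g beta * (K / ln K ^+ g) `^ (- (alpha / d.+1%:R)) in
  exists q rho, [/\ (0 < q)%N, 0 < rho <= 3^-1,
    ln (#|code d W L q|.+1)%:R <= n%:R * rho ^+ 2,
    (1 <= ln K) /\ 2 * normC R d r g <= (K / ln K ^+ g) `^ (d.+1)%:R^-1 &
    forall M eps : R, 0 <= M -> 0 <= eps ->
      8 * (M + 1) ^+ 2 * rho + 4 / n%:R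
       + 4 * (M + 1) * (K * (d.+1 + L.+1 * W.+1)%:R / q%:R)
       + 4 * (M + 1) * (K * eps) + tau ^+ 2
      <= rateC M * (nu n * Lam n + n%:R `^ kappa * eps)].
Proof.
have [m Hm] := eventually_large; exists m.+1 => n W L K mn W0 K1 K2 WL tau.
have [ln1 lK rho1 NC] := Hm n K (ltnW mn) K1 K2.
have n0 : (0 < n)%N by apply: leq_trans mn.
have np : 0 < n%:R :> R by rewrite ltr0n.
have n1 : 1 <= n%:R :> R by rewrite ler1n.
have rC0 : 0 < rhoC by rewrite /rhoC ltr_wpDl.
have nu0 : 0 < nu n by rewrite powR_gt0.
have Lam1 : ln n%:R <= Lam n  by exact: Lam_ge.
have Lam1' : 1 <= Lam n := le_trans ln1 Lam1.
exists (q0 * n ^ 3)%N, (rhoN n); split => //.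
- by rewrite muln_gt0 expn_gt0 n0.
- by rewrite rho1 andbT /rhoN !mulr_gt0// (lt_le_trans ltr01).
- exact: entropy_le.
move=> M eps M0 e0; have M1 : 0 <= M + 1 by rewrite addr_ge0.
have cov : K * (d.+1 + L.+1 * W.+1)%:R / (q0 * n ^ 3)%:R <= n%:R^-1 by exact: cover_le.
have tl : tau ^+ 2 <= tauC * (nu n * Lam n)  by exact: tau_le.
have inv_nu : n%:R^-1 <= nu n.
  by rewrite -powR_inv1 ?(ltW np)// /nu ler_powR// lerN2.
have nuLam : nu n <= nu n * Lam n by rewrite ler_peMr// ltW.
have invL : n%:R^-1 <= nu n * Lam n := le_trans inv_nu nuLam.
have rL : rhoN n <= rhoC * (nu n * Lam n).
  by rewrite /rhoN ler_wpM2l ?(ltW rC0)// ler_wpM2l// ltW.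
have X0 : 0 <= nu n * Lam n := le_trans (ltW nu0) nuLam.
have kp0 : 0 <= n%:R `^ kappa * eps by rewrite mulr_ge0 ?powR_ge0.
have Ke : K * eps <= c2 * (n%:R `^ kappa * eps) by rewrite mulrA ler_wpM2r.
set X := nu n * Lam n in rL X0 invL tl *; set Y := n%:R `^ kappa * eps in kp0 Ke *.
have t1 : 8 * (M + 1) ^+ 2 * rhoN n <= 8 * (M + 1) ^+ 2 * rhoC * X.
  by rewrite -[leRHS]mulrA ler_wpM2l// mulr_ge0 ?sqr_ge0.
have t2 : 4 / n%:R <= 4 * X by rewrite ler_wpM2l.
have t3 : 4 * (M + 1) * (K * (d.+1 + L.+1 * W.+1)%:R / (q0 * n ^ 3)%:R) <= 4 * (M + 1) * X.
  by rewrite ler_wpM2l ?mulr_ge0// (le_trans cov).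
have t4 : 4 * (M + 1) * (K * eps) <= 4 * (M + 1) * c2 * Y.
  by rewrite -[leRHS]mulrA ler_wpM2l ?mulr_ge0.
have -> : rateC M * (X + Y) = 8 * (M + 1) ^+ 2 * rhoC * X + 4 * X + 4 * (M + 1) * X
   + 4 * (M + 1) * c2 * Y + tauC * X + (4 * (M + 1) * c2 * X +
     (8 * (M + 1) ^+ 2 * rhoC + 4 + 4 * (M + 1) + tauC) * Y) by rewrite /rateC; ring.
rewrite -[leLHS]addr0; apply: lerD; last first.
  rewrite addr_ge0// mulr_ge0// ?mulr_ge0 ?(ltW c2_gt0)//.
  by rewrite !addr_ge0// ?mulr_ge0 ?sqr_ge0// ltW.
by do !apply: lerD.
Qed.

(** Between 2 and [m] the rate is bounded below by [low]; starting at 2 keeps the logarithm away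
    from 0. *)
Lemma small_n_rate m (B : R) : 0 <= B -> exists2 C, 0 < C & forall n, (2 <= n)%N -> (n <= m)%N ->
  B <= C * (nu n * Lam n).
Proof.
move=> B0; have l2 : 0 < ln 2 :> R by rewrite ln_gt0// ltr1n.
have lam0 : 0 <= lambda by rewrite le_max ler01.
pose low : R := m.+1%:R `^ (- expo) * ln 2 `^ lambda.
have low0 : 0 < low by rewrite mulr_gt0// powR_gt0// ltr0n.
exists (B / low + 1) => [|n n2 nm]; first by rewrite ltr_wpDl// divr_ge0// ltW.
have n0 : (0 < n)%N by apply: leq_trans n2.
have h : low <= nu n * Lam n.
  apply: ler_pM; rewrite ?powR_ge0//.
    rewrite /nu !powRN lef_pV2 ?posrE ?powR_gt0 ?ltr0n//.
    by rewrite ge0_ler_powR ?nnegrE ?(ltW expo0)// ler_nat (leq_trans nm).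
  have l2n : ln 2 <= ln n%:R :> R by rewrite ler_ln ?posrE ?ltr0n// ler_nat.
  by apply: ge0_ler_powR => //; rewrite nnegrE ltW// (lt_le_trans l2).
apply: (@le_trans _ _ (B / low * (nu n * Lam n))).
  by rewrite mulrAC ler_pdivlMr// ler_wpM2l.
by rewrite ler_wpM2r ?lerDl// (le_trans (ltW low0)).
Qed.

End Constants.

Lemma depth_le a b : (4 * a + 2 <= b.+1)%N -> (a <= b)%N.
Proof. by lia. Qed.

Unset Implicit Arguments.
Set Strict Implicit.
Set Printing Implicit Defensive.

Theorem theorem4p5 (R : realType) (d r : nat) (beta : R) :
  (0 < d)%N -> 0 < beta <= 1 -> 1 <= r%:R + beta ->
  let alpha := r%:R + beta in
  let gamma := up_log 2 (d + r) in
  let lambda := Num.max 1 (2 * gamma%:R * alpha / (d.+1)%:R) in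
  exists c : R, 0 < c /\
  exists M0 : R, forall M : R, M0 <= M ->
  (* the population: a probability space D carrying (X, Y) ~ P *)
  forall (dD : measure_display) (D : measurableType dD) (P : probability D R)
    (Xset : set 'cV[R]_d) (X : D -> 'cV[R]_d) (Y : D -> R) (f0 : 'cV[R]_d -> R),
  Xset `<=` @cube R d ->
  (forall z, Xset (X z)) ->
  (forall z, `|Y z| <= 1) ->
  (forall A, borelV A -> measurable (X @^-1` A)) ->
  measurable_fun setT Y ->
  (* model Y = f0(X) + eta, f0 in H^alpha, E(eta | X) = 0, E eta^2 < oo *)
  Hoelder r beta f0 ->
  P.-integrable setT (fun z => (Y z - f0 (X z))%:E) ->
  (forall A, borelV A -> (\int[P]_(z in X @^-1` A) (Y z - f0 (X z))%:E = 0)%E) ->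
  (\int[P]_z ((Y z - f0 (X z)) ^+ 2)%:E < +oo)%E ->
  (* architecture sequences W_n, L_n, K_n *)
  forall (Wn Ln : nat -> nat) (Kn : nat -> R) (c1 c2 c3 c4 : R),
  0 < c1 -> 0 < c2 -> 0 < c3 -> 0 < c4 ->
  (forall n : nat, (2 <= n)%N ->
     c1 * n%:R `^ ((d.+1)%:R / (2 * d%:R + 5 * alpha)) <= Kn n
     <= c2 * n%:R `^ ((d.+1)%:R / (2 * d%:R + 5 * alpha))) ->
  (forall n : nat, (2 <= n)%N ->
     c3 * n%:R `^ ((2 * d%:R + alpha) / (4 * d%:R + 10 * alpha))
       <= (Wn n * Ln n)%:R
     <= c4 * n%:R `^ ((2 * d%:R + alpha) / (4 * d%:R + 10 * alpha))) ->
  (forall n : nat, (2 <= n)%N ->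
     c * (Kn n / ln (Kn n) ^+ gamma) `^ ((2 * d%:R + alpha) / (2 * d%:R + 2))
       <= (Wn n)%:R) ->
  (forall n : nat, (2 <= n)%N -> (4 * gamma + 2 <= Ln n)%N) ->
  exists C : R, 0 < C /\
  forall (n : nat) (eps : R), (2 <= n)%N -> 0 <= eps ->
  (* Assumption 2.1 *)
  (forall x, Xset x -> advball Xset x eps `<=` @cube R d) ->
  (* an i.i.d. sample Z_1, ..., Z_n ~ P on a probability space (Omega, Q) *)
  forall (dO : measure_display) (Omega : measurableType dO) (Q : probability Omega R)
    (Z : 'I_n -> Omega -> D),
  (forall i, measurable_fun setT (Z i)) ->
  (forall i (A : set D), measurable A -> Q (Z i @^-1` A) = P A) ->
  (forall A : 'I_n -> set D, (forall i, measurable (A i)) ->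
     Q (\bigcap_(i in [set: 'I_n]) (Z i @^-1` A i))
     = (\prod_(i < n) fine (Q (Z i @^-1` A i)))%:E) ->
  (* any adversarial estimator with sup norm <= M *)
  forall fhat : ('I_n -> D) -> 'cV[R]_d -> R,
  (forall zs, NN (Wn n) (Ln n) (Kn n) (fhat zs)) ->
  (forall zs g, NN (Wn n) (Ln n) (Kn n) g ->
     (emp_advrisk Xset X Y zs (fhat zs) eps <= emp_advrisk Xset X Y zs g eps)%E) ->
  (forall zs x, @cube R d x -> `|fhat zs x| <= M) ->
  measurable_fun [set: Omega]
    ((fun w => adv_excess P r beta (Wn n) (Ln n) (Kn n) Xset X Y
                (fhat (fun i => Z i w)) eps) : Omega -> \bar R) ->
  (\int[Q]_w adv_excess P r beta (Wn n) (Ln n) (Kn n) Xset X Y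
                (fhat (fun i => Z i w)) eps
   <= (C * (n%:R `^ (- (2 * alpha) / (2 * d%:R + 5 * alpha)) * ln n%:R `^ lambda
            + n%:R `^ ((d.+1)%:R / (2 * d%:R + 5 * alpha)) * eps))%:E)%E.
Proof.
move=> d0 beta01 alpha1 alpha gamma lambda.
have [beta0 beta1] := andP beta01.
exists (widthC R d r gamma); split; first exact: widthC_gt0.
exists 0 => M M0 dD D P Xset X Y f0 Xcube XX Y1 mX mY [fe [feH f0E]] _ cond0 _.
move=> Wn Ln Kn c1 c2 c3 c4 c10 c20 c30 c40 Kb WLb Wb Lb.
have HoelderM g : Hoelder r beta g ->
  exists2 g' : borelT R d -> R, measurable_fun setT g' & forall x, cube x -> g x = g' x /\ `|g' x| <= 1.
  move=> [g' [gH gE]]; have [C C0 gC] := Hoelder_lip gH alpha1 beta1.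
  exists g'; first exact: lip_borel gC.
  by move=> x cx; split; [exact: gE|exact: (pder_le1 gH (s := [::]))].
have mfe : measurable_fun setT (fe : borelT R d -> R).
  by have [C C0 fC] := Hoelder_lip feH alpha1 beta1; exact: lip_borel fC.
have fe1 x : cube x -> `|fe x| <= 1 by move=> _; exact: (pder_le1 feH (s := [::])).
have cond0' A : borelV A -> (\int[P]_(z in X @^-1` A) (Y z - fe (X z))%:E = 0)%E.
  move=> /cond0 <-; apply: eq_integral => z _; rewrite f0E//; exact: Xcube.
have [m Hm] := large_n_rate d gamma alpha1 c10 c20 c40.
have [Cs Cs0 HCs] := small_n_rate d gamma alpha1 m (sqr_ge0 (M + 1)).
(* [phi] is within [errC] of [fe], itself bounded by 1 on the cube, so [M'] bounds both [phi] and
   the estimator. *)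
pose M' := M + 1 + errC d r gamma beta.
have M'0 : 0 <= M' by rewrite addr_ge0 ?errC_ge0// addr_ge0.
have Cl0 := rateC_gt0 d r gamma beta c1 c4 c20 M'0.
exists (rateC d r gamma beta c1 c2 c4 M' + Cs); split; first exact: addr_gt0.
move=> n eps n2 eps0 _ dO Omega Q Z mZ lawZ indZ fhat fhatN fhat_min fhatM _.
have n0 : (0 < n)%N by apply: leq_trans n2.
have np : 0 < n%:R :> R by rewrite ltr0n.
have /andP[K1 K2] := Kb n n2; have /andP[WL1 WL2] := WLb n n2.
have WC := Wb n n2; have L4 := Lb n n2.
have K0 : 0 < Kn n by apply: lt_le_trans K1; rewrite mulr_gt0 ?powR_gt0.
have W0 : (0 < Wn n)%N.
  have : 0 < (Wn n * Ln n)%:R :> R by apply: lt_le_trans WL1; rewrite mulr_gt0 ?powR_gt0.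
  by rewrite ltr0n muln_gt0 => /andP[].
case: (Ln n) L4 WL2 fhatN fhat_min => [|L] L4 WL2 fhatN fhat_min; first by rewrite addn2 in L4.
have gL : (gamma <= L)%N := depth_le L4.
rewrite mulNr.
set rate := (_ * _ `^ lambda); set amp := _ * eps.
have rate0 : 0 <= rate by rewrite mulr_ge0 ?powR_ge0.
have amp0 : 0 <= amp by rewrite mulr_ge0 ?powR_ge0.
have [mn|nm] := leqP m n; last first.
  apply: (@le_trans _ _ ((M + 1) ^+ 2)%:E).
    have -> : ((M + 1) ^+ 2)%:E = (\int[Q]_w ((M + 1) ^+ 2)%:E)%E.
      have e := probability_setT Q.
      by rewrite integral_cst// [X in (_ * X)%E]e mule1.
    apply: ge0_le_lower_integral => w.
      exact: (excess_ge0 r beta P Xcube XX Y1 mX mY K0 eps0 (fhatN _) (fhatM _)).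
    exact: (excess_trivial Xcube XX Y1 mX mY mfe fe1 cond0' K0 eps0 HoelderM (fhatN _) (fhatM _)).
  rewrite lee_fin; apply: le_trans (HCs n n2 (ltnW nm)) _; rewrite -/rate.
  by apply: ler_pM; rewrite ?(ltW Cs0)// ?lerDr ?lerDl// ltW.
have [q [rho [q0 /andP[rho0 rho1] ent [lK nC] bound]]] := Hm n (Wn n) L (Kn n) mn W0 K1 K2 WL2.
have dr : (d + r <= 2 ^ gamma)%N by exact: up_logP.
have [phi phiN phiE] := approx_rate beta0 dr feH gL lK nC WC.
set tau := errC _ _ _ _ * _ in phiE bound.
(* [tau] is [errC] times a negative power of a quantity that [nC] puts above 1. *)
have tau1 : tau <= errC d r gamma beta.
  rewrite /tau ler_piMr ?errC_ge0//.
  set x := Kn n / _ in nC *.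
  have x1 : 1 <= x `^ d.+1%:R^-1.
    by apply: le_trans nC; have := normC_ge1 R d r gamma; lra.
  have -> : - ((r%:R + beta) / d.+1%:R) = d.+1%:R^-1 * - alpha by rewrite /alpha; ring.
  rewrite powRrM powRN; move: (x `^ _) x1 => y y1.
  by rewrite invf_le1 ?powR_gt0 ?(lt_le_trans _ y1)// -[leLHS](powRr0 y) ler_powR// (le_trans _ alpha1).
have phiM x : cube x -> `|phi x| <= M'.
  move=> cx; rewrite -[phi x](subrK (fe x)) (le_trans (ler_normD _ _))//.
  by have := phiE x cx; have := fe1 x cx; rewrite /M'; lra.
have fhatM' zs x : cube x -> `|fhat zs x| <= M'.
  move=> cx; apply: le_trans (fhatM zs x cx) _.
  by rewrite /M' -addrA lerDl addr_ge0// errC_ge0.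
apply: le_trans (oracle Xcube XX Y1 mX mY mfe fe1 cond0' K0 eps0 n0 HoelderM
  q0 M'0 phiN phiM phiE rho0 rho1 ent mZ lawZ indZ fhatN fhat_min fhatM') _.
rewrite lee_fin; apply: le_trans (bound M' eps M'0 eps0) _; rewrite -/rate -/amp.
by rewrite ler_wpM2r ?addr_ge0// lerDl ltW.
Qed.
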